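(* The set $SK/\mathbb{C}=\bigcup_{k\ge0}SK_k/\mathbb{C}$ of special quasi-elliptic functions modulo additive constants is a filtered algebra with respect to the convolution $\circledast_+$; that is, if $\hat f\in SK_r/\mathbb{C}$ and $\hat g\in SK_s/\mathbb{C}$, then $\hat f\circledast_+\hat g\in SK_{r+s}/\mathbb{C}$.
   Context: Fix $\tau\in\mathbb{C}$ with $\operatorname{Im}(\tau)>0$ and let $\Lambda=\mathbb{Z}+\tau\mathbb{Z}$. For a meromorphic function $f$ on $\mathbb{C}$ of period $1$ put $\Delta f(x)=f(x+\tau)-f(x)$. $SK_k$ is the set of meromorphic functions $f$ on $\mathbb{C}$ of period $1$, with all poles in $\Lambda$, such that $\Delta^kf=0$ ($\Delta^0$ is the identity, so $SK_0=\{0\}$), and $SK=\bigcup_{k\ge0}SK_k$. $\hat f$ denotes the class of $f$ modulo additive constants, and $SK_k/\mathbb{C}$ is the set of classes of elements of $SK_k$ (for $k=0$, only the zero class). Convolution: for meromorphic $1$-periodic functions $f,g$ on $\mathbb{C}$ with poles only in $\Lambda$, and for $0<\operatorname{Im}(x)<2\operatorname{Im}(\tau)$, define $(f\circledast_+ g)(x)=\oint_{\operatorname{Im}(z)=\operatorname{Im}(x)/2}f(x-z)g(z)\,dz$, where the integral runs over one real period, i.e. over $z=t+\tfrac{i}{2}\operatorname{Im}(x)$, $t\in[0,1]$. This has a unique analytic continuation to a meromorphic function on $\mathbb{C}$ of period $1$, also denoted $f\circledast_+ g$. The convolution of classes is $\hat f\circledast_+\hat g=\widehat{f\circledast_+ g}$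 (changing $f$ or $g$ by a constant changes $f\circledast_+g$ by a constant). *)

(* Defs.v *)
(* Stdlib reals with Coquelicot: R, C, ex_derive, RInt. *)
From Stdlib Require Import Reals ZArith ClassicalEpsilon.
From Coquelicot Require Import Coquelicot.

Open Scope C_scope.

(** * Meromorphic functions on C

    A meromorphic function is represented by a total function [C -> C] whose
    values on a closed discrete set (in particular at the poles) carry no
    information.  Two total functions represent the same meromorphic function
    when they agree on a punctured neighbourhood of every point; all the
    notions below are about meromorphic functions up to [mero_eq]. *)

Definition mero_eq (f g : C -> C) : Prop :=
  forall p : C, locally' p (fun z => f z = g z).

Definition holomorphic_at (h : C -> C) (p : C) : Prop :=
  locally p (fun z : C => ex_derive h z).

Definition meromorphic (f : C -> C) : Prop :=
  forall p : C, exists (n : nat) (h : C -> C),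
    holomorphic_at h p /\ locally' p (fun z => (z - p) ^ n * f z = h z).

(* For a meromorphic f: the singularity at p is not removable. *)
Definition pole (f : C -> C) (p : C) : Prop :=
  ~ exists h : C -> C, holomorphic_at h p /\ locally' p (fun z => f z = h z).

Definition one_periodic (f : C -> C) : Prop :=
  mero_eq (fun z => f (z + 1)) f.

(** * Special quasi-elliptic functions *)

Definition lattice (tau p : C) : Prop :=
  exists m n : Z, p = IZR m + IZR n * tau.

Definition Delta (tau : C) (f : C -> C) : C -> C :=
  fun x => f (x + tau) - f x.

Definition SK (tau : C) (k : nat) (f : C -> C) : Prop :=
  meromorphic f /\ one_periodic f /\
  (forall p : C, pole f p -> lattice tau p) /\
  mero_eq (Nat.iter k (Delta tau) f) (fun _ => 0).

Definition add_fun (f g : C -> C) : C -> C := fun z => f z + g z.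
Definition sub_fun (f g : C -> C) : C -> C := fun z => f z - g z.
Definition scal_fun (a : C) (f : C -> C) : C -> C := fun z => a * f z.

(* The class of f modulo additive constants equals that of g iff
   [constant_fun (sub_fun f g)]. *)
Definition constant_fun (f : C -> C) : Prop :=
  exists c : C, mero_eq f (fun _ => c).

(* The class of f modulo additive constants belongs to SK_k / C. *)
Definition SK_mod (tau : C) (k : nat) (f : C -> C) : Prop :=
  exists f0 : C -> C, SK tau k f0 /\ constant_fun (sub_fun f f0).

(** * Convolution *)

(* The contour is z = t + (i/2) Im x, 0 <= t <= 1, so that dz = dt. *)
Definition conv_integral (f g : C -> C) (x : C) : C :=
  RInt (V := C_R_CompleteNormedModule)
    (fun t : R => let z : C := (t, (Im x / 2)%R) in f (x - z) * g z)
    0%R 1%R.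

Definition is_conv (tau : C) (f g h : C -> C) : Prop :=
  meromorphic h /\ one_periodic h /\
  forall x : C, (0 < Im x < 2 * Im tau)%R -> h x = conv_integral f g x.

(* The analytic continuation of the convolution integral: a function h with
   [is_conv tau f g h], meaningful as soon as one exists. *)
Definition conv (tau : C) (f g : C -> C) : C -> C :=
  epsilon (inhabits (fun _ : C => RtoC 0)) (is_conv tau f g).

(** * Filtered algebras of functions modulo a subspace *)

Definition subspace (P : (C -> C) -> Prop) : Prop :=
  P (fun _ => 0) /\
  (forall f g, P f -> P g -> P (add_fun f g)) /\
  (forall a f, P f -> P (scal_fun a f)).

(* With A the union of the F k, the quotient A / N is a (not necessarily
   unital) associative C-algebra for the product induced by [mul], and it is
   filtered by the subspaces F k / N.  The F k contain N, so they are the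
   preimages of subspaces of the quotient. *)
Record filtered_algebra_mod
    (N : (C -> C) -> Prop) (F : nat -> (C -> C) -> Prop)
    (mul : (C -> C) -> (C -> C) -> (C -> C)) : Prop := {
  fa_N_subspace : subspace N;
  fa_F_subspace : forall k, subspace (F k);
  fa_N_F : forall k f, N f -> F k f;
  fa_increasing : forall k f, F k f -> F (S k) f;
  fa_mul_filtered : forall r s f g, F r f -> F s g -> F (r + s)%nat (mul f g);
  fa_mul_compat : forall r s f f' g g',
    F r f -> F r f' -> F s g -> F s g' ->
    N (sub_fun f f') -> N (sub_fun g g') ->
    N (sub_fun (mul f g) (mul f' g'));
  fa_mul_add_l : forall r s t f g h, F r f -> F s g -> F t h ->
    N (sub_fun (mul (add_fun f g) h) (add_fun (mul f h) (mul g h)));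
  fa_mul_add_r : forall r s t f g h, F r f -> F s g -> F t h ->
    N (sub_fun (mul f (add_fun g h)) (add_fun (mul f g) (mul f h)));
  fa_mul_scal_l : forall r s a f g, F r f -> F s g ->
    N (sub_fun (mul (scal_fun a f) g) (scal_fun a (mul f g)));
  fa_mul_scal_r : forall r s a f g, F r f -> F s g ->
    N (sub_fun (mul f (scal_fun a g)) (scal_fun a (mul f g)));
  fa_mul_assoc : forall r s t f g h, F r f -> F s g -> F t h ->
    N (sub_fun (mul (mul f g) h) (mul f (mul g h)))
}.

(* Main.v *)
Require Import Defs.
From Stdlib Require Import Reals ZArith Lra Lia Wf_nat Classical ClassicalEpsilon FunctionalExtensionality.
From Coquelicot Require Import Coquelicot.

(** The idea.  For f and g of period 1 with poles in the lattice, convolution along a horizontal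
    line does not depend on the height of the line as long as no pole is crossed, so f * g is
    holomorphic for 0 < Im x < 2 Im tau.  Replacing x by x + tau in the integral, with the line
    placed above x, and then pushing the line down below x crosses the single pole z = x of
    f(x + tau - z); hence, for 0 < Im x < Im tau,
    [(f * g)(x + tau) = (f * g)(x) + ((Delta f) * g)(x) + E(x)],
    where E collects the residue: it is a combination of g and its derivatives whose coefficients
    are the polar part of f at tau.  In particular Delta^s E = 0 as soon as Delta^s g = 0.  By
    induction on r, (Delta f) * g already extends to an element of SK_(r-1+s); the displayed equation
    then both defines the continuation of f * g to the whole plane, one strip after the other, and
    says that Delta (f * g) lies in SK_(r+s-1), that is, f * g lies in SK_(r+s).

    This is [conv_continuation]; its ingredients are [period_integral_const] (independence of the
    height), [normalized_jump] (the residue term), [conv_Delta_step] (the displayed equation) and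
    [glue] (continuation along a functional equation).  The residue is computed without Laurent
    expansions: polar parts are peeled off with powers of u(z) = 1 / (exp(2 i pi z) - 1), and
    the powers reduce to u itself because u' = - 2 i pi (u + u^2) turns u^(j+1) into u^j and its
    derivative.  The term of u comes from subtracting g(x), which makes the integrand regular.

    The algebra laws hold for the integrals on the strip 0 < Im x < Im tau: bilinearity is
    that of the integral, compatibility with additive constants uses that the integral of f over a
    period does not depend on the height, and associativity is Fubini's theorem for one common
    double integral.  The identity theorem for meromorphic functions carries them, and the
    uniqueness of the continuation, to the plane.

    A meromorphic function is given by arbitrary values on a discrete set, so each one is first
    replaced by a representative with prescribed values, [normalize]; on these all functional
    equations hold pointwise.

    Functions are only assumed complex differentiable.  Smoothness, division by z - p, isolated
    zeros and the identity theorem all follow from Goursat's theorem on triangles, the local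
    primitive that it provides, and Cauchy's formula for circles, where the formula is proved by
    differentiating under the integral sign along a homotopy to the centre. *)

Local Open Scope R_scope.

(** * Complex derivatives and continuity *)

Ltac cmod_tri := eapply Rle_trans; [apply Cmod_triangle|].
Ltac cmod_tri_lt := eapply Rle_lt_trans; [apply Cmod_triangle|].

(** Equations inherited from abstract derivatives live in the carrier of a normed module; [ring] and
    [field] only recognize them at the type C. *)
Ltac eq_in_C := match goal with |- @eq _ ?a ?b => change (@eq C a b) end.

Lemma Im_plus (z w : C) : Im (z + w) = Im z + Im w. Proof. reflexivity. Qed.
Lemma Re_plus (z w : C) : Re (z + w) = Re z + Re w. Proof. reflexivity. Qed.
Lemma Im_minus (z w : C) : Im (z - w) = Im z - Im w. Proof. reflexivity. Qed.
Lemma Im_RtoC (r : R) : Im (RtoC r) = 0. Proof. reflexivity. Qed.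
Lemma Re_RtoC (r : R) : Re (RtoC r) = r. Proof. reflexivity. Qed.
Lemma C_eq (z w : C) : Re z = Re w -> Im z = Im w -> z = w.
Proof. destruct z, w; simpl; intros -> ->; reflexivity. Qed.

Lemma Cmod_sub_sym (z w : C) : Cmod (z - w) = Cmod (w - z).
Proof. rewrite <- (Cmod_opp (w - z)). f_equal. ring. Qed.

Lemma im_le_Cmod (z : C) : Rabs (Im z) <= Cmod z.
Proof.
  apply Rle_trans with (2 := Rmax_Cmod z). apply Rmax_r.
Qed.

Lemma Cmod_le_re_im (z : C) : Cmod z <= Rabs (Re z) + Rabs (Im z).
Proof.
  assert (H : z = (RtoC (Re z) + Ci * RtoC (Im z))%C).
  { destruct z as [a b]. unfold Ci, RtoC, Cplus, Cmult; simpl. f_equal; ring. }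
  rewrite H at 1. cmod_tri.
  rewrite Cmod_mult, Cmod_Ci, !Cmod_R. lra.
Qed.

Lemma locally_C_iff (z : C) (P : C -> Prop) :
  locally (T := C_UniformSpace) z P <->
  exists d : R, 0 < d /\ forall w : C, Cmod (w - z) < d -> P w.
Proof.
  split.
  - intros [d Hd]. exists d. split. apply cond_pos. intros w Hw. apply Hd.
    split; simpl; unfold AbsRing_ball, abs, minus, plus, opp; simpl.
    + eapply Rle_lt_trans with (2 := Hw). apply (re_le_Cmod (w - z)).
    + eapply Rle_lt_trans with (2 := Hw). apply (im_le_Cmod (w - z)).
  - intros [d [Hd H]]. assert (Hd2 : 0 < d / 2) by lra. exists (mkposreal _ Hd2). intros w [H1 H2]. apply H.
    change (Rabs (fst w + - fst z) < d / 2) in H1. change (Rabs (snd w + - snd z) < d / 2) in H2.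
    eapply Rle_lt_trans. apply Cmod_le_re_im.
    change (Re (w - z)) with (fst w + - fst z). change (Im (w - z)) with (snd w + - snd z). lra.
Qed.

Lemma locally'_C_iff (z : C) (P : C -> Prop) :
  locally' (T := C_UniformSpace) z P <->
  exists d : R, 0 < d /\ forall w : C, Cmod (w - z) < d -> w <> z -> P w.
Proof. unfold locally', within. rewrite locally_C_iff. tauto. Qed.

Definition cder (f : C -> C) (z l : C) : Prop :=
  is_derive (K := C_AbsRing) (V := C_NormedModule) f z l.

Lemma cder_iff (f : C -> C) (z l : C) :
  cder f z l <->
  forall eps : R, 0 < eps -> exists d : R, 0 < d /\ forall w : C, Cmod (w - z) < d ->
    Cmod (f w - f z - l * (w - z))%C <= eps * Cmod (w - z).
Proof.
  split.
  - intros [_ H] eps He.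
    specialize (H z (fun P HP => HP) (mkposreal _ He)).
    apply locally_C in H. apply locally_C_iff in H. destruct H as [d [Hd H]].
    exists d; split; auto. intros w Hw. specialize (H w Hw). simpl in H.
    rewrite Cmult_comm. exact H.
  - intros H. split. apply is_linear_scal_l.
    intros x Hx. apply (is_filter_lim_locally_unique (V := AbsRing_NormedModule C_AbsRing)) in Hx. subst x.
    intros eps. apply locally_C. apply locally_C_iff.
    destruct (H eps (cond_pos eps)) as [d [Hd K]]. exists d; split; auto.
    intros w Hw. specialize (K w Hw). rewrite Cmult_comm in K. exact K.
Qed.

Lemma continuous_CC_iff (f : C -> C) (z : C) :
  continuous (T := C_UniformSpace) (U := C_UniformSpace) f z <->
  forall eps : R, 0 < eps -> exists d : R, 0 < d /\ forall w : C, Cmod (w - z) < d ->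
    Cmod (f w - f z) < eps.
Proof.
  split.
  - intros H eps He.
    assert (K : locally (T := C_UniformSpace) (f z) (fun y => Cmod (y - f z) < eps)).
    { apply locally_C_iff. exists eps; split; auto. }
    apply H in K. apply (proj1 (locally_C_iff z _)) in K. exact K.
  - intros H P HP. apply locally_C_iff in HP. destruct HP as [e [He HP]].
    destruct (H e He) as [d [Hd K]]. apply (proj2 (locally_C_iff z _)). exists d; split; auto.
Qed.

Lemma continuous_RC_iff (f : R -> C) (t : R) :
  continuous (T := R_UniformSpace) (U := C_UniformSpace) f t <->
  forall eps : R, 0 < eps -> exists d : R, 0 < d /\ forall s : R, Rabs (s - t) < d ->
    Cmod (f s - f t) < eps.
Proof.
  split.
  - intros H eps He.
    assert (K : locally (T := C_UniformSpace) (f t) (fun y => Cmod (y - f t) < eps)).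
    { apply locally_C_iff. exists eps; split; auto. }
    apply H in K. destruct K as [d K]. exists d; split. apply cond_pos. exact K.
  - intros H P HP. apply locally_C_iff in HP. destruct HP as [e [He HP]].
    destruct (H e He) as [d [Hd K]]. exists (mkposreal _ Hd). intros s Hs. apply HP, K, Hs.
Qed.

Lemma rder_iff (f : R -> C) (t : R) (l : C) :
  is_derive (K := R_AbsRing) (V := C_R_NormedModule) f t l <->
  forall eps : R, 0 < eps -> exists d : R, 0 < d /\ forall s : R, Rabs (s - t) < d ->
    Cmod (f s - f t - l * RtoC (s - t))%C <= eps * Rabs (s - t).
Proof.
  split.
  - intros [_ H] eps He.
    specialize (H t (fun P HP => HP) (mkposreal _ He)).
    destruct H as [d H]. exists d; split. apply cond_pos. intros s Hs. specialize (H s Hs).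
    simpl in H. rewrite Cmult_comm, <- scal_R_Cmult.
    replace (Cmod _) with (Cmod (minus (minus (f s) (f t)) (scal (minus s t) l))) by reflexivity.
    rewrite Cmod_norm. exact H.
  - intros H. split. apply is_linear_scal_l.
    intros x Hx. apply (is_filter_lim_locally_unique (V := AbsRing_NormedModule R_AbsRing)) in Hx. subst x.
    intros eps. destruct (H eps (cond_pos eps)) as [d [Hd K]]. exists (mkposreal _ Hd).
    intros s Hs. specialize (K s Hs). rewrite Cmult_comm, <- scal_R_Cmult, Cmod_norm in K. exact K.
Qed.

Section Continuity.
Context {U : UniformSpace}.
Notation ctsU f x := (continuous (T := U) (U := C_UniformSpace) f x).

Lemma cts_re (f : U -> C) x : ctsU f x -> continuous (U := R_UniformSpace) (fun y => Re (f y)) x.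
Proof. intros H. apply (continuous_comp (V := C_UniformSpace) f (fun z : C => Re z) x H). apply (continuous_fst (U:=R_UniformSpace) (V:=R_UniformSpace) (fst (f x)) (snd (f x))). Qed.

Lemma cts_im (f : U -> C) x : ctsU f x -> continuous (U := R_UniformSpace) (fun y => Im (f y)) x.
Proof. intros H. apply (continuous_comp (V := C_UniformSpace) f (fun z : C => Im z) x H). apply (continuous_snd (U:=R_UniformSpace) (V:=R_UniformSpace) (fst (f x)) (snd (f x))). Qed.

Lemma cts_pair (f g : U -> R) x : continuous (U := R_UniformSpace) f x -> continuous (U := R_UniformSpace) g x -> ctsU (fun y => (f y, g y) : C) x.
Proof.
  intros Hf Hg P [e HP].
  assert (H : locally x (fun y => ball (f x) e (f y) /\ ball (g x) e (g y))).
  { apply filter_and. apply Hf. apply locally_ball. apply Hg. apply locally_ball. }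
  apply (filter_imp (F := locally x) _ _ (fun y Hy => HP (f y, g y) Hy) H).
Qed.

Lemma cts_plus (f g : U -> C) x : ctsU f x -> ctsU g x -> ctsU (fun y => f y + g y)%C x.
Proof.
  intros Hf Hg. apply cts_pair.
  apply (continuous_plus (V := R_NormedModule) (fun y => Re (f y)) (fun y => Re (g y))); apply cts_re; auto.
  apply (continuous_plus (V := R_NormedModule) (fun y => Im (f y)) (fun y => Im (g y))); apply cts_im; auto.
Qed.

Lemma cts_opp (f : U -> C) x : ctsU f x -> ctsU (fun y => - f y)%C x.
Proof.
  intros Hf. apply cts_pair.
  apply (continuous_opp (V := R_NormedModule) (fun y => Re (f y))); apply cts_re; auto.
  apply (continuous_opp (V := R_NormedModule) (fun y => Im (f y))); apply cts_im; auto.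
Qed.

Lemma cts_minus (f g : U -> C) x : ctsU f x -> ctsU g x -> ctsU (fun y => f y - g y)%C x.
Proof. intros Hf Hg. apply cts_plus; auto. apply cts_opp; auto. Qed.

Lemma cts_mult (f g : U -> C) x : ctsU f x -> ctsU g x -> ctsU (fun y => f y * g y)%C x.
Proof.
  intros Hf Hg. generalize (cts_re _ _ Hf) (cts_im _ _ Hf) (cts_re _ _ Hg) (cts_im _ _ Hg). intros A B C D.
  apply cts_pair.
  - apply (continuous_minus (V := R_NormedModule)); apply (continuous_mult (K := R_AbsRing)); auto.
  - apply (continuous_plus (V := R_NormedModule)); apply (continuous_mult (K := R_AbsRing)); auto.
Qed.

Lemma cts_comp (f : U -> C) (g : C -> C) x : ctsU f x -> continuous (T := C_UniformSpace) (U := C_UniformSpace) g (f x) -> ctsU (fun y => g (f y)) x.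
Proof. apply (continuous_comp f g x). Qed.

Lemma cts_const (c : C) x : ctsU (fun _ => c) x.
Proof. apply continuous_const. Qed.

Lemma cts_RtoC (f : U -> R) x : continuous (U := R_UniformSpace) f x -> ctsU (fun y => RtoC (f y)) x.
Proof. intros H. apply cts_pair; auto. apply continuous_const. Qed.
End Continuity.

Lemma cder_cts (f : C -> C) z l : cder f z l -> continuous (T := C_UniformSpace) (U := C_UniformSpace) f z.
Proof.
  rewrite cder_iff, continuous_CC_iff. intros H eps He.
  destruct (H 1 Rlt_0_1) as [d [Hd K]].
  assert (HL : 0 < 1 + Cmod l) by (generalize (Cmod_ge_0 l); lra).
  exists (Rmin d (eps / (1 + Cmod l))). split.
  { apply Rmin_pos; auto. apply Rdiv_lt_0_compat; auto. }
  intros w Hw. destruct (Rmin_Rgt_l _ _ _ Hw) as [H1 H2].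
  specialize (K w H1).
  replace (f w - f z)%C with ((f w - f z - l * (w - z)) + l * (w - z))%C by ring.
  cmod_tri_lt. rewrite Cmod_mult.
  apply Rmult_lt_compat_r with (r := 1 + Cmod l) in H2; auto.
  unfold Rdiv in H2. rewrite Rmult_assoc, Rinv_l in H2; lra.
Qed.

Lemma cder_unique f z l1 l2 : cder f z l1 -> cder f z l2 -> l1 = l2.
Proof. intros H1 H2. rewrite <- (is_C_derive_unique f z l1 H1). apply is_C_derive_unique, H2. Qed.

Lemma ex_derive_cder f z : ex_derive (K := C_AbsRing) (V := C_NormedModule) f z <-> cder f z (C_derive f z).
Proof.
  split. intros H. apply C_derive_correct; auto. intros H. eexists; exact H.
Qed.

Lemma cder_C_derive f z l : cder f z l -> cder f z (C_derive f z).
Proof. intros H. apply ex_derive_cder. eexists; exact H. Qed.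

Lemma cder_const c z : cder (fun _ => c) z 0%C.
Proof. apply (is_derive_const (K := C_AbsRing) (V := C_NormedModule)). Qed.

Lemma cder_plus f g z a b : cder f z a -> cder g z b -> cder (fun w => f w + g w)%C z (a + b)%C.
Proof. apply (is_derive_plus (K := C_AbsRing) (V := C_NormedModule)). Qed.

Lemma cder_minus f g z a b : cder f z a -> cder g z b -> cder (fun w => f w - g w)%C z (a - b)%C.
Proof. apply (is_derive_minus (K := C_AbsRing) (V := C_NormedModule)). Qed.

Lemma cder_ext_loc f g z l : locally (T := C_UniformSpace) z (fun w => f w = g w) -> cder f z l -> cder g z l.
Proof. intros H. apply (is_derive_ext_loc (K := C_AbsRing) (V := C_NormedModule)). apply locally_C. exact H. Qed.

Lemma cder_eq f z l l' : cder f z l -> l = l' -> cder f z l'.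
Proof. intros H <-. exact H. Qed.

(** C carries two normed-module structures over itself, with the same norm; the product and chain
    rules are available for the second one. *)
Lemma cder_absring f z l : cder f z l <-> is_derive (K := C_AbsRing) (V := AbsRing_NormedModule C_AbsRing) f z l.
Proof. split; intros [_ H]; (split; [apply is_linear_scal_l | exact H]). Qed.

Lemma cder_id z : cder (fun w => w) z 1%C.
Proof. apply cder_absring, (is_derive_id (K := C_AbsRing)). Qed.

Lemma cder_mult (f g : C -> C) (z a b : C) :
  cder f z a -> cder g z b -> cder (fun w => f w * g w)%C z (a * g z + f z * b)%C.
Proof. rewrite !cder_absring. intros Hf Hg. apply (is_derive_mult f g z a b Hf Hg Cmult_comm). Qed.

Lemma cder_scal c f z a : cder f z a -> cder (fun w => c * f w)%C z (c * a)%C.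
Proof. intros H. eapply cder_eq. apply cder_mult. apply cder_const. exact H. cbv beta. ring. Qed.

Lemma cder_opp f z a : cder f z a -> cder (fun w => - f w)%C z (- a)%C.
Proof. apply (is_derive_opp (K := C_AbsRing) (V := C_NormedModule)). Qed.

Lemma cder_comp f g z a b : cder f (g z) a -> cder g z b -> cder (fun w => f (g w)) z (a * b)%C.
Proof. rewrite Cmult_comm, (cder_absring g). apply (is_derive_comp (V := C_NormedModule) f g). Qed.

Lemma cder_inv (z : C) : z <> 0%C -> cder Cinv z (- / (z * z))%C.
Proof.
  intros Hz. apply cder_iff. intros eps He. assert (Pz := proj1 (Cmod_gt_0 z) Hz).
  set (m := Cmod z) in *.
  exists (Rmin (m / 2) (eps * (m * m * m) / 2)). split.
  { apply Rmin_pos. lra. assert (0 < m * m) by (apply Rmult_lt_0_compat; auto). assert (0 < m * m * m) by (apply Rmult_lt_0_compat; auto). assert (0 < eps * (m*m*m)) by (apply Rmult_lt_0_compat; auto). lra. }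
  intros w Hw.
  destruct (Rmin_Rgt_l _ _ _ Hw) as [W1 W2].
  assert (Pw : m / 2 < Cmod w).
  { assert (m <= Cmod w + Cmod (w - z)). unfold m. rewrite Cmod_sub_sym. replace z with (w + (z - w))%C at 1 by ring. apply Cmod_triangle. lra. }
  assert (Hw0 : w <> 0%C) by (intros ->; rewrite Cmod_0 in Pw; lra).
  replace (/ w - / z - - / (z * z) * (w - z))%C with ((w - z) * (w - z) / (w * (z * z)))%C by (field; auto).
  rewrite Cmod_div. 2: { apply Cmult_neq_0; auto. apply Cmult_neq_0; auto. }
  rewrite !Cmod_mult. fold m. set (N := Cmod (w - z)) in *. assert (HN : 0 <= N) by apply Cmod_ge_0.
  assert (0 < m * m) by (apply Rmult_lt_0_compat; auto).
  apply Rmult_le_reg_r with (Cmod w * (m * m)). apply Rmult_lt_0_compat; lra.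
  unfold Rdiv. rewrite Rmult_assoc, Rinv_l. 2: { apply Rgt_not_eq, Rmult_lt_0_compat; lra. }
  assert (eps * (m * m * m / 2) <= eps * (Cmod w * (m * m))). { apply Rmult_le_compat_l. lra. nra. }
  nra.
Qed.

Lemma cder_pow (f : C -> C) (z a : C) n : cder f z a -> cder (fun w => f w ^ n)%C z (RtoC (INR n) * f z ^ (pred n) * a)%C.
Proof.
  intros H. induction n as [|n IH].
  - simpl. eapply cder_eq. apply cder_const. cbv beta. ring.
  - eapply cder_eq. apply (cder_mult f (fun w => f w ^ n)%C); eauto. simpl pred.
    destruct n as [|n]. simpl. ring. rewrite S_INR with (n := S n). simpl pred. rewrite RtoC_plus. simpl Cpow. ring.
Qed.

(** The chain rule along a real path mixes derivatives over two different fields of scalars. *)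
Lemma rder_comp (f : C -> C) (g : R -> C) t a b :
  cder f (g t) a -> is_derive (K := R_AbsRing) (V := C_R_NormedModule) g t b ->
  is_derive (K := R_AbsRing) (V := C_R_NormedModule) (fun s => f (g s)) t (a * b)%C.
Proof.
  rewrite cder_iff, !rder_iff. intros Hf Hg eps He.
  assert (P1 := Cmod_ge_0 a). assert (P2 := Cmod_ge_0 b).
  set (e := Rmin 1 (eps / (2 + Cmod a + Cmod b))).
  assert (He' : 0 < e) by (apply Rmin_pos; [lra | apply Rdiv_lt_0_compat; lra]).
  assert (E1 : e <= 1) by apply Rmin_l. assert (E2 : e * (2 + Cmod a + Cmod b) <= eps).
  { assert (e <= eps / (2 + Cmod a + Cmod b)) by apply Rmin_r.
    apply Rmult_le_compat_r with (r := 2 + Cmod a + Cmod b) in H; [|lra].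
    replace (eps / (2 + Cmod a + Cmod b) * (2 + Cmod a + Cmod b)) with eps in H by (field; lra). exact H. }
  destruct (Hf e He') as [d1 [Hd1 K1]]. destruct (Hg e He') as [d2 [Hd2 K2]].
  assert (Hd3 : 0 < d1 / (Cmod b + 1)) by (apply Rdiv_lt_0_compat; lra).
  exists (Rmin d2 (d1 / (Cmod b + 1))). split. apply Rmin_pos; auto. intros s Hs.
  destruct (Rmin_Rgt_l _ _ _ Hs) as [W2 W3].
  specialize (K2 s W2). set (N := Rabs (s - t)) in *. assert (HN : 0 <= N) by apply Rabs_pos.
  assert (G : Cmod (g s - g t) <= (Cmod b + 1) * N).
  { replace (g s - g t)%C with ((g s - g t - b * RtoC (s - t)) + b * RtoC (s - t))%C by ring.
    cmod_tri. rewrite Cmod_mult, Cmod_R. fold N. nra. }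
  assert (G2 : Cmod (g s - g t) < d1).
  { eapply Rle_lt_trans. exact G. apply Rmult_lt_compat_l with (r := Cmod b + 1) in W3; [|lra].
    replace ((Cmod b + 1) * (d1 / (Cmod b + 1))) with d1 in W3 by (field; lra). exact W3. }
  specialize (K1 (g s) G2).
  replace (f (g s) - f (g t) - a * b * RtoC (s - t))%C with
   ((f (g s) - f (g t) - a * (g s - g t)) + a * (g s - g t - b * RtoC (s - t)))%C by ring.
  cmod_tri. rewrite Cmod_mult.
  apply Rle_trans with (e * ((Cmod b + 1) * N) + Cmod a * (e * N)).
  - apply Rplus_le_compat. eapply Rle_trans. exact K1. apply Rmult_le_compat_l; lra.
    apply Rmult_le_compat_l; auto.
  - nra.
Qed.

Lemma rder_affine (a b : C) t : is_derive (K := R_AbsRing) (V := C_R_NormedModule) (fun s : R => a + RtoC s * b)%C t b.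
Proof.
  apply rder_iff. intros eps He. exists 1; split. lra. intros s _.
  replace (a + RtoC s * b - (a + RtoC t * b) - b * RtoC (s - t))%C with (RtoC 0).
  rewrite Cmod_0. apply Rmult_le_pos. lra. apply Rabs_pos. rewrite RtoC_minus. ring.
Qed.

Lemma rder_RtoC (a : R -> R) t l : is_derive a t l ->
  is_derive (K := R_AbsRing) (V := C_R_NormedModule) (fun s => RtoC (a s)) t (RtoC l).
Proof.
  intros [_ H]. apply rder_iff. intros eps He. specialize (H t (fun P HP => HP) (mkposreal _ He)).
  destruct H as [d H]. exists d. split. apply cond_pos. intros s Hs. specialize (H s Hs).
  rewrite <- !RtoC_minus, <- RtoC_mult, <- RtoC_minus, Cmod_R. simpl in H. rewrite Rmult_comm. exact H.
Qed.

(** * Complex-valued integrals over real intervals *)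

Definition CInt (f : R -> C) (a b : R) : C := RInt (V := C_R_CompleteNormedModule) f a b.
Local Notation is_CInt := (is_RInt (V := C_R_NormedModule)).
Local Notation ex_CInt := (ex_RInt (V := C_R_NormedModule)).
Local Notation ctsR f t := (continuous (T := R_UniformSpace) (U := C_UniformSpace) f t).
Local Notation ctsC f z := (continuous (T := C_UniformSpace) (U := C_UniformSpace) f z).

Lemma CInt_correct f a b : ex_CInt f a b -> is_CInt f a b (CInt f a b).
Proof. apply (RInt_correct (V := C_R_CompleteNormedModule)). Qed.

Lemma is_CInt_unique f a b l : is_CInt f a b l -> CInt f a b = l.
Proof. apply (is_RInt_unique (V := C_R_CompleteNormedModule)). Qed.

Lemma cts_ex_CInt f a b : (forall t, Rmin a b <= t <= Rmax a b -> ctsR f t) -> ex_CInt f a b.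
Proof. apply (ex_RInt_continuous (V := C_R_CompleteNormedModule)). Qed.

Lemma cts_ex_CInt_all f a b : (forall t, ctsR f t) -> ex_CInt f a b.
Proof. intros H. apply cts_ex_CInt. auto. Qed.

Lemma is_CInt_scal c f a b l : is_CInt f a b l -> is_CInt (fun t => c * f t)%C a b (c * l)%C.
Proof.
  intros H. assert (H1 := is_RInt_fct_extend_fst _ _ _ _ H). assert (H2 := is_RInt_fct_extend_snd _ _ _ _ H).
  apply (is_RInt_fct_extend_pair (U := R_NormedModule) (V := R_NormedModule)).
  - simpl. apply (is_RInt_minus (V := R_NormedModule)); apply (is_RInt_scal (V := R_NormedModule)); auto.
  - simpl. apply (is_RInt_plus (V := R_NormedModule)); apply (is_RInt_scal (V := R_NormedModule)); auto.
Qed.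

Lemma CInt_scal c f a b : ex_CInt f a b -> CInt (fun t => c * f t)%C a b = (c * CInt f a b)%C.
Proof. intros H. apply is_CInt_unique, is_CInt_scal, CInt_correct, H. Qed.

Lemma ex_CInt_scal c f a b : ex_CInt f a b -> ex_CInt (fun t => c * f t)%C a b.
Proof. intros [l H]. eexists. apply is_CInt_scal, H. Qed.

Lemma CInt_plus f g a b : ex_CInt f a b -> ex_CInt g a b -> CInt (fun t => f t + g t)%C a b = (CInt f a b + CInt g a b)%C.
Proof. apply (RInt_plus (V := C_R_CompleteNormedModule)). Qed.

Lemma CInt_minus f g a b : ex_CInt f a b -> ex_CInt g a b -> CInt (fun t => f t - g t)%C a b = (CInt f a b - CInt g a b)%C.
Proof. apply (RInt_minus (V := C_R_CompleteNormedModule)). Qed.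

Lemma ex_CInt_plus f g a b : ex_CInt f a b -> ex_CInt g a b -> ex_CInt (fun t => f t + g t)%C a b.
Proof. apply (ex_RInt_plus (V := C_R_NormedModule)). Qed.

Lemma ex_CInt_minus f g a b : ex_CInt f a b -> ex_CInt g a b -> ex_CInt (fun t => f t - g t)%C a b.
Proof. apply (ex_RInt_minus (V := C_R_NormedModule)). Qed.

Lemma CInt_ext f g a b : (forall t, f t = g t) -> CInt f a b = CInt g a b.
Proof. intros H. apply (RInt_ext (V := C_R_CompleteNormedModule)). auto. Qed.

Lemma CInt_Chasles f a b c : ex_CInt f a b -> ex_CInt f b c -> (CInt f a b + CInt f b c)%C = CInt f a c.
Proof. apply (RInt_Chasles (V := C_R_CompleteNormedModule)). Qed.

Lemma CInt_const c a b : CInt (fun _ => c) a b = (RtoC (b - a) * c)%C.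
Proof. apply is_CInt_unique. rewrite <- scal_R_Cmult. apply (is_RInt_const (V := C_R_NormedModule)). Qed.

Lemma Cmod_CInt_le f a b M : (forall t, Rmin a b <= t <= Rmax a b -> Cmod (f t) <= M) -> ex_CInt f a b ->
  Cmod (CInt f a b) <= M * Rabs (b - a).
Proof.
  intros H Hf. destruct (Rle_dec a b) as [L|L].
  - rewrite Rmin_left, Rmax_right in H; auto.
    rewrite Rabs_pos_eq by lra. rewrite Rmult_comm, Cmod_norm.
    apply (norm_RInt_le_const (V := C_R_NormedModule) f a b _ M L).
    + intros t Ht. eapply Rle_trans. apply Req_le. symmetry. apply (Cmod_norm (f t)). apply H, Ht.
    + apply CInt_correct, Hf.
  - assert (L' : b <= a) by lra. rewrite Rmin_right, Rmax_left in H; auto.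
    rewrite Rabs_left1 by lra. replace (- (b - a)) with (a - b) by ring. rewrite Rmult_comm.
    assert (K : is_CInt f b a (- CInt f a b)%C).
    { apply (is_RInt_swap (V := C_R_NormedModule)). apply CInt_correct; auto. }
    rewrite <- Cmod_opp, Cmod_norm.
    apply (norm_RInt_le_const (V := C_R_NormedModule) f b a _ M L').
    + intros t Ht. eapply Rle_trans. apply Req_le. symmetry. apply (Cmod_norm (f t)). apply H, Ht.
    + exact K.
Qed.

Lemma CInt_derive (f df : R -> C) a b :
  (forall t, Rmin a b <= t <= Rmax a b -> is_derive (K := R_AbsRing) (V := C_R_NormedModule) f t (df t)) ->
  (forall t, Rmin a b <= t <= Rmax a b -> ctsR df t) -> CInt df a b = (f b - f a)%C.
Proof. intros H1 H2. apply is_CInt_unique. apply (is_RInt_derive (V := C_R_CompleteNormedModule)); auto. Qed.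

Local Notation rder f t l := (is_derive (K := R_AbsRing) (V := C_R_NormedModule) f t l).

(** * Compactness by subdivision *)

(** A property of intervals that is local and stable under concatenation is global: take the
    supremum of the right ends reached from [a].  It serves both for compactness and for the
    connectedness of segments. *)
Lemma cousin (P : R -> R -> Prop) (a b : R) :
  a <= b ->
  (forall u v w, u <= v <= w -> P u v -> P v w -> P u w) ->
  (forall t, a <= t <= b -> exists d, 0 < d /\
     forall u v, t - d < u <= t -> t <= v < t + d -> a <= u -> v <= b -> P u v) ->
  P a b.
Proof.
  intros Hab Htr Hloc.
  set (E := fun x => a <= x <= b /\ P a x).
  assert (Ea : E a).
  { destruct (Hloc a) as [d [Hd K]]. lra. split. lra. apply K; lra. }
  destruct (completeness E) as [s [Hs1 Hs2]].
  { exists b. intros x [Hx _]. lra. }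
  { exists a; exact Ea. }
  assert (Has : a <= s) by (apply Hs1, Ea).
  assert (Hsb : s <= b) by (apply Hs2; intros x [Hx _]; lra).
  destruct (Hloc s (conj Has Hsb)) as [d [Hd K]].
  assert (Hx : exists x, E x /\ s - d < x).
  { apply NNPP. intros N. assert (s <= s - d); [|lra]. apply Hs2. intros x Ex.
    destruct (Rle_dec x (s - d)); auto. exfalso. apply N. exists x; split; auto. lra. }
  destruct Hx as [x [Ex Hx]]. assert (Hxs : x <= s) by (apply Hs1, Ex). destruct Ex as [Hx1 Px].
  assert (Ps : P a s). { apply Htr with x; auto. lra. apply K; lra. }
  destruct (Req_dec s b) as [<-|Hne]; auto.
  set (v := Rmin (s + d / 2) b).
  assert (Hv1 : s < v) by (apply Rmin_glb_lt; lra).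
  assert (Hv2 : v <= b) by apply Rmin_r. assert (Hv3 : v <= s + d / 2) by apply Rmin_l.
  assert (E v). { split. lra. apply Htr with s; auto. lra. apply K; lra. }
  assert (v <= s) by (apply Hs1; auto). lra.
Qed.

Lemma nested_intervals (u v : nat -> R) :
  (forall n, u n <= u (S n)) -> (forall n, v (S n) <= v n) -> (forall n, u n <= v n) ->
  exists p, forall n, u n <= p <= v n.
Proof.
  intros Hu Hv Huv.
  assert (Mu : forall n k, u n <= u (n + k)%nat).
  { intros n k; induction k. rewrite Nat.add_0_r; lra. rewrite Nat.add_succ_r. specialize (Hu (n + k)%nat). lra. }
  assert (Mv : forall n k, v (n + k)%nat <= v n).
  { intros n k; induction k. rewrite Nat.add_0_r; lra. rewrite Nat.add_succ_r. specialize (Hv (n + k)%nat). lra. }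
  assert (X : forall m n, u m <= v n).
  { intros m n. specialize (Mu m n). specialize (Mv n m). specialize (Huv (m + n)%nat).
    rewrite (Nat.add_comm n m) in Mv. lra. }
  destruct (completeness (fun x => exists n, x = u n)) as [p [H1 H2]].
  { exists (v 0%nat). intros x [n ->]. apply X. }
  { exists (u 0%nat), 0%nat; auto. }
  exists p. intros n. split. apply H1. exists n; auto. apply H2. intros x [m ->]. apply X.
Qed.

Definition in_tri (s t : R) : Prop := 0 <= s /\ 0 <= t /\ s + t <= 1.
(** In coordinates along two sides of a triangle, the four halves of a triangle are again of the
    form (vertex, legs of signed length h) when negative h is allowed: the middle one is reversed. *)
Definition sub_tri (s t h : R) : Prop := in_tri s t /\ in_tri (s + h) t /\ in_tri s (t + h).

(** Bisection: a triangle violating Q contains a half violating Q, and the resulting nested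
    sequence shrinks to a point where the local hypothesis applies. *)
Lemma cousin_triangle (Q : R -> R -> R -> Prop) :
  (forall s t h, sub_tri s t h -> Q s t (h/2) -> Q (s + h/2) t (h/2) -> Q s (t + h/2) (h/2) ->
     Q (s + h/2) (t + h/2) (- (h/2)) -> Q s t h) ->
  (forall p q, in_tri p q -> exists d, 0 < d /\ forall s t h, sub_tri s t h -> Rabs h < d ->
     Rabs (s - p) <= Rabs h -> Rabs (t - q) <= Rabs h -> Q s t h) ->
  Q 0 0 1.
Proof.
  intros Hsub Hloc. apply NNPP. intros HN.
  set (bad := fun c : R * R * R => let '(s, t, h) := c in sub_tri s t h /\ ~ Q s t h).
  set (sub := fun c c' : R * R * R => let '(s, t, h) := c in let '(s', t', h') := c' in
     Rabs h' = Rabs h / 2 /\ Rabs (s' - s) <= Rabs h / 2 /\ Rabs (t' - t) <= Rabs h / 2).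
  assert (step : forall c : {c | bad c}, exists c' : {c | bad c}, sub (proj1_sig c) (proj1_sig c')).
  { intros [[[s t] h] [B1 B2]]. simpl. apply NNPP. intros N.
    assert (K : forall s' t' h', sub_tri s' t' h' -> (s' = s \/ s' = s + h/2) -> (t' = t \/ t' = t + h/2) ->
      (h' = h/2 \/ h' = - (h/2)) -> Q s' t' h').
    { intros s' t' h' Hs Ds Dt Dh. apply NNPP; intros M. apply N. exists (exist bad (s', t', h') (conj Hs M)). simpl.
      assert (Ha : Rabs (h / 2) = Rabs h / 2) by (unfold Rdiv; rewrite Rabs_mult, (Rabs_pos_eq (/ 2)); lra).
      assert (Hp := Rabs_pos h).
      split; [|split].
      - destruct Dh as [->| ->]; rewrite ?Rabs_Ropp; exact Ha.
      - destruct Ds as [->| ->]; [rewrite Rminus_diag, Rabs_R0; lra | replace (s + h/2 - s) with (h/2) by ring; lra].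
      - destruct Dt as [->| ->]; [rewrite Rminus_diag, Rabs_R0; lra | replace (t + h/2 - t) with (h/2) by ring; lra]. }
    unfold sub_tri, in_tri in B1. apply B2, Hsub; auto; apply K; auto; unfold sub_tri, in_tri; lra. }
  set (next := fun c => proj1_sig (constructive_indefinite_description _ (step c))).
  assert (B0 : bad (0, 0, 1)) by (split; [unfold sub_tri, in_tri; lra | auto]).
  set (sq := fun n => Nat.iter n next (exist _ (0, 0, 1) B0)).
  set (ss := fun n => fst (fst (proj1_sig (sq n)))). set (tt := fun n => snd (fst (proj1_sig (sq n)))).
  set (hh := fun n => snd (proj1_sig (sq n))).
  assert (HB : forall n, bad (ss n, tt n, hh n)).
  { intros n. unfold ss, tt, hh. generalize (proj2_sig (sq n)). destruct (proj1_sig (sq n)) as [[? ?] ?]; auto. }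
  assert (HS : forall n, sub (ss n, tt n, hh n) (ss (S n), tt (S n), hh (S n))).
  { intros n. unfold ss, tt, hh. assert (K := proj2_sig (constructive_indefinite_description _ (step (sq n)))). cbv beta in K.
    change (proj1_sig (constructive_indefinite_description _ (step (sq n)))) with (sq (S n)) in K.
    destruct (proj1_sig (sq n)) as [[? ?] ?]. destruct (proj1_sig (sq (S n))) as [[? ?] ?]. exact K. }
  assert (Hh : forall n, Rabs (hh n) = (/2) ^ n).
  { induction n. apply Rabs_R1. destruct (HS n) as [E _]. rewrite E, IHn. simpl. field. }
  assert (Hsm : forall e, 0 < e -> exists n, Rabs (hh n) < e).
  { intros e He. destruct (pow_lt_1_zero (/2)) with (y := e) as [N HN']; auto. rewrite Rabs_pos_eq; lra.
    exists N. rewrite Hh. apply Rle_lt_trans with (2 := HN' N (le_n N)). apply Rle_abs. }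
  destruct (nested_intervals (fun n => ss n - Rabs (hh n)) (fun n => ss n + Rabs (hh n))) as [p Hp].
  { intros n. destruct (HS n) as [E [K _]]. rewrite E. apply Rabs_le_between in K. lra. }
  { intros n. destruct (HS n) as [E [K _]]. rewrite E. apply Rabs_le_between in K. lra. }
  { intros n. generalize (Rabs_pos (hh n)); lra. }
  destruct (nested_intervals (fun n => tt n - Rabs (hh n)) (fun n => tt n + Rabs (hh n))) as [q Hq].
  { intros n. destruct (HS n) as [E [_ K]]. rewrite E. apply Rabs_le_between in K. lra. }
  { intros n. destruct (HS n) as [E [_ K]]. rewrite E. apply Rabs_le_between in K. lra. }
  { intros n. generalize (Rabs_pos (hh n)); lra. }
  destruct (Hloc p q) as [d [Hd K]].
  { assert (X : forall e, 0 < e -> - e <= p /\ - e <= q /\ p + q <= 1 + 2 * e).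
    { intros e He. destruct (Hsm e He) as [n Hn]. specialize (Hp n). specialize (Hq n).
      destruct (HB n) as [[[B1 [B2 B3]] _] _]. lra. }
    split; [|split]; apply le_epsilon; intros e He; destruct (X (e / 2)) as [X1 [X2 X3]]; lra. }
  destruct (Hsm d Hd) as [n Hn]. destruct (HB n) as [B1 B2]. specialize (Hp n). specialize (Hq n).
  apply B2. apply K; auto; apply Rabs_le; lra.
Qed.

(** * Segment integrals and Goursat's theorem *)

Definition seg (z0 z1 : C) (s : R) : C := (z0 + RtoC s * (z1 - z0))%C.
Definition on_seg (P : C -> Prop) (z0 z1 : C) : Prop := forall s, 0 <= s <= 1 -> P (seg z0 z1 s).
Definition seg_int (f : C -> C) (z0 z1 : C) : C := ((z1 - z0) * CInt (fun s => f (seg z0 z1 s)) 0 1)%C.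

Lemma rder_seg z0 z1 s : rder (seg z0 z1) s (z1 - z0)%C.
Proof. apply rder_affine. Qed.

Lemma seg_0 z0 z1 : seg z0 z1 0 = z0. Proof. unfold seg. ring. Qed.
Lemma seg_1 z0 z1 : seg z0 z1 1 = z1. Proof. unfold seg. ring. Qed.

Lemma cts_rder f t l : rder f t l -> ctsR f t.
Proof. intros H. apply (ex_derive_continuous (K := R_AbsRing) (V := C_R_NormedModule)). eexists; exact H. Qed.

Lemma cts_seg f z0 z1 : on_seg (fun z => ctsC f z) z0 z1 -> forall s, Rmin 0 1 <= s <= Rmax 0 1 -> ctsR (fun s => f (seg z0 z1 s)) s.
Proof.
  intros H s Hs. rewrite Rmin_left, Rmax_right in Hs by lra. apply (cts_comp (seg z0 z1) f). eapply cts_rder, rder_seg. apply H, Hs.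
Qed.

Lemma ex_seg f z0 z1 : on_seg (fun z => ctsC f z) z0 z1 -> ex_CInt (fun s => f (seg z0 z1 s)) 0 1.
Proof. intros H. apply cts_ex_CInt, cts_seg, H. Qed.

Lemma seg_int_le f z0 z1 M : on_seg (fun z => ctsC f z) z0 z1 -> on_seg (fun z => Cmod (f z) <= M) z0 z1 ->
  Cmod (seg_int f z0 z1) <= Cmod (z1 - z0) * M.
Proof.
  intros Hf HM. unfold seg_int. rewrite Cmod_mult. apply Rmult_le_compat_l. apply Cmod_ge_0.
  replace M with (M * Rabs (1 - 0)) by (rewrite Rminus_0_r, Rabs_R1; ring).
  apply Cmod_CInt_le. rewrite Rmin_left, Rmax_right by lra. exact HM. apply ex_seg, Hf.
Qed.

Lemma seg_int_primitive G g z0 z1 : on_seg (fun z => cder G z (g z) /\ ctsC g z) z0 z1 -> seg_int g z0 z1 = (G z1 - G z0)%C.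
Proof.
  intros H. assert (Hc : on_seg (fun z => ctsC g z) z0 z1) by (intros s Hs; apply H, Hs).
  unfold seg_int. rewrite <- CInt_scal by (apply ex_seg; auto).
  rewrite (CInt_derive (fun s => G (seg z0 z1 s))). rewrite seg_0, seg_1. auto.
  - intros s Hs. rewrite Rmin_left, Rmax_right in Hs by lra. rewrite Cmult_comm. apply rder_comp. apply H, Hs. apply rder_seg.
  - intros s Hs. apply cts_mult. apply cts_const. apply (cts_seg g z0 z1); auto.
Qed.

Lemma seg_int_minus f g z0 z1 : on_seg (fun z => ctsC f z) z0 z1 -> on_seg (fun z => ctsC g z) z0 z1 ->
  seg_int (fun z => f z - g z)%C z0 z1 = (seg_int f z0 z1 - seg_int g z0 z1)%C.
Proof. intros Hf Hg. unfold seg_int. rewrite CInt_minus by (apply ex_seg; auto). ring. Qed.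

Lemma CInt_affine f u v a b : ex_CInt f (u * a + v) (u * b + v) ->
  CInt (fun s => RtoC u * f (u * s + v)%R)%C a b = CInt f (u * a + v) (u * b + v).
Proof.
  intros H. apply is_CInt_unique. eapply is_RInt_ext. 2: apply (is_RInt_comp_lin (V := C_R_NormedModule) f u v a b), CInt_correct, H.
  intros s _. apply scal_R_Cmult.
Qed.

Lemma seg_int_rev f z0 z1 : on_seg (fun z => ctsC f z) z0 z1 -> seg_int f z1 z0 = (- seg_int f z0 z1)%C.
Proof.
  intros H. assert (X := ex_seg f z0 z1 H). assert (X' : ex_CInt (fun s => f (seg z0 z1 s)) 1 0) by (apply ex_RInt_swap; exact X).
  assert (E := CInt_affine (fun s => f (seg z0 z1 s)) (- (1)) 1 0 1).
  replace (- (1) * 0 + 1) with 1 in E by ring. replace (- (1) * 1 + 1) with 0 in E by ring. specialize (E X').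
  assert (E2 := CInt_Chasles _ _ _ _ X X'). rewrite <- E in E2.
  assert (E3 : CInt (fun s => f (seg z0 z1 s)) 0 0 = 0%C) by (apply is_CInt_unique, (is_RInt_point (V := C_R_NormedModule))).
  rewrite E3, (CInt_ext (fun s => RtoC (- (1)) * f (seg z0 z1 (- (1) * s + 1)))%C (fun s => - (1) * f (seg z1 z0 s))%C) in E2.
  2: { intros s. rewrite RtoC_opp. do 2 f_equal. unfold seg. rewrite RtoC_plus, RtoC_mult, RtoC_opp. ring. }
  unfold seg_int. rewrite CInt_scal in E2.
  2: { apply cts_ex_CInt, cts_seg. intros s Hs. replace (seg z1 z0 s) with (seg z0 z1 (1 - s)). apply H; lra. unfold seg. rewrite RtoC_minus. ring. }
  set (I := CInt (fun s => f (seg z1 z0 s)) 0 1) in *.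
  replace I with (CInt (fun s => f (seg z0 z1 s)) 0 1) . ring.
  replace (CInt (fun s => f (seg z0 z1 s)) 0 1) with ((CInt (fun s => f (seg z0 z1 s)) 0 1 + - (1) * I) + I)%C by ring. rewrite E2. ring.
Qed.

Definition mid (a b : C) : C := ((a + b) / 2)%C.

(** Chasles' relation at the midpoint is the only additivity that subdivision requires. *)
Lemma seg_int_mid f a b : on_seg (fun z => ctsC f z) a b -> seg_int f a b = (seg_int f a (mid a b) + seg_int f (mid a b) b)%C.
Proof.
  intros H. assert (C2 : RtoC 2 <> 0%C) by (intros E; apply RtoC_inj in E; lra).
  assert (Xs : forall c d, 0 <= c -> c <= d -> d <= 1 -> ex_CInt (fun s => f (seg a b s)) c d).
  { intros c d Hc Hcd Hd. apply cts_ex_CInt. rewrite Rmin_left, Rmax_right by lra. intros s Hs. apply (cts_seg f a b H). rewrite Rmin_left, Rmax_right; lra. }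
  assert (E1 := CInt_affine (fun s => f (seg a b s)) (/2) 0 0 1). assert (E2 := CInt_affine (fun s => f (seg a b s)) (/2) (/2) 0 1).
  replace (/2 * 0 + 0) with 0 in E1 by ring. replace (/2 * 1 + 0) with (/2) in E1 by ring.
  replace (/2 * 0 + /2) with (/2) in E2 by ring. replace (/2 * 1 + /2) with 1 in E2 by field.
  assert (H1 : on_seg (fun z => ctsC f z) a (mid a b)).
  { intros s Hs. replace (seg a (mid a b) s) with (seg a b (/2 * s)). apply H; lra. unfold seg, mid. rewrite RtoC_mult, RtoC_inv by lra. field; auto. }
  assert (H2 : on_seg (fun z => ctsC f z) (mid a b) b).
  { intros s Hs. replace (seg (mid a b) b s) with (seg a b (/2 * s + /2)). apply H; lra. unfold seg, mid. rewrite RtoC_plus, RtoC_mult, RtoC_inv by lra. field; auto. }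
  unfold seg_int. rewrite <- (CInt_Chasles _ 0 (/2) 1), <- E1, <- E2 by (apply Xs; lra).
  rewrite (CInt_ext (fun s => RtoC (/2) * f (seg a b (/2 * s + 0)))%C (fun s => RtoC (/2) * f (seg a (mid a b) s))%C).
  2: { intros s. do 2 f_equal. unfold seg, mid. rewrite Rplus_0_r, RtoC_mult, RtoC_inv by lra. field; auto. }
  rewrite (CInt_ext (fun s => RtoC (/2) * f (seg a b (/2 * s + /2)))%C (fun s => RtoC (/2) * f (seg (mid a b) b s))%C).
  2: { intros s. do 2 f_equal. unfold seg, mid. rewrite RtoC_plus, RtoC_mult, RtoC_inv by lra. field; auto. }
  rewrite !CInt_scal by (apply ex_seg; auto). unfold mid. rewrite RtoC_inv by lra. field; auto.
Qed.

Definition tri_bd (f : C -> C) (a b c : C) : C := (seg_int f a b + seg_int f b c + seg_int f c a)%C.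
Definition tri_pt (a b c : C) (s t : R) : C := (a + RtoC s * (b - a) + RtoC t * (c - a))%C.

Lemma tri_pt_seg P a b c : (forall s t, in_tri s t -> P (tri_pt a b c s t)) ->
  forall s t s' t', in_tri s t -> in_tri s' t' -> on_seg P (tri_pt a b c s t) (tri_pt a b c s' t').
Proof.
  intros H s t s' t' Ht Ht' r Hr. unfold in_tri in *.
  replace (seg _ _ r) with (tri_pt a b c ((1 - r) * s + r * s') ((1 - r) * t + r * t')).
  apply H. split; [|split]; nra.
  unfold seg, tri_pt. rewrite !RtoC_plus, !RtoC_mult, RtoC_minus. ring.
Qed.

(** By [cousin_triangle] it suffices to bound the integral over small triangles by eps times the
    square of the size.  Near a point f is affine up to an error eps |z - z0|, and affine functions
    have primitives. *)
Lemma goursat f a b c : (forall s t, in_tri s t -> exists l, cder f (tri_pt a b c s t) l) -> tri_bd f a b c = 0%C.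
Proof.
  intros H. set (P := tri_pt a b c) in *.
  assert (Hc : forall s t s' t', in_tri s t -> in_tri s' t' -> on_seg (fun z => ctsC f z) (P s t) (P s' t')).
  { apply tri_pt_seg. intros s t Ht. destruct (H s t Ht) as [l Hl]. eapply cder_cts; eauto. }
  assert (C2 : RtoC 2 <> 0%C) by (intros E; apply RtoC_inj in E; lra).
  assert (Hmid : forall s t s' t', mid (P s t) (P s' t') = P ((s + s') / 2) ((t + t') / 2)).
  { intros. unfold mid, P, tri_pt. rewrite !RtoC_div, !RtoC_plus by lra. field; auto. }
  set (bd := fun s t h => tri_bd f (P s t) (P (s + h) t) (P s (t + h))).
  assert (X : forall eps, 0 < eps -> Cmod (bd 0 0 1) <= eps).
  { intros eps He. replace eps with (eps * (1 * 1)) by ring.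
    apply (cousin_triangle (fun s t h => Cmod (bd s t h) <= eps * (h * h))).
    - intros s t h [T1 [T2 T3]] Q1 Q2 Q3 Q4. unfold in_tri in *.
      replace (bd s t h) with (bd s t (h/2)%R + bd (s + h/2)%R t (h/2)%R + bd s (t + h/2)%R (h/2)%R + bd (s + h/2)%R (t + h/2)%R (- (h/2))%R)%C.
      { cmod_tri. eapply Rle_trans. apply Rplus_le_compat_r, Cmod_triangle.
        eapply Rle_trans. apply Rplus_le_compat_r, Rplus_le_compat_r, Cmod_triangle. nra. }
      unfold bd, tri_bd.
      replace (s + h/2 + h/2) with (s + h) by field. replace (t + h/2 + h/2) with (t + h) by field.
      replace (s + h/2 + - (h/2)) with s by ring. replace (t + h/2 + - (h/2)) with t by ring.
      rewrite (seg_int_mid f (P s t) (P (s + h) t)), (seg_int_mid f (P (s + h) t) (P s (t + h))), (seg_int_mid f (P s (t + h)) (P s t)) by (apply Hc; unfold in_tri; lra).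
      rewrite !Hmid. replace ((s + (s + h)) / 2) with (s + h/2) by field. replace ((t + t) / 2) with t by field.
      replace ((s + h + s) / 2) with (s + h/2) by field. replace ((t + (t + h)) / 2) with (t + h/2) by field.
      replace ((s + s) / 2) with s by field. replace ((t + h + t) / 2) with (t + h/2) by field.
      rewrite (seg_int_rev f (P (s + h/2) t) (P s (t + h/2))), (seg_int_rev f (P s (t + h/2)) (P (s + h/2) (t + h/2))),
        (seg_int_rev f (P (s + h/2) (t + h/2)) (P (s + h/2) t)) by (apply Hc; unfold in_tri; lra). ring.
    - intros p q Hpq. destruct (H p q Hpq) as [l Hl]. set (z0 := P p q) in *.
      set (L := Cmod (b - a) + Cmod (c - a)).
      assert (La := Cmod_ge_0 (b - a)). assert (Lb := Cmod_ge_0 (c - a)). assert (HL : 0 <= L) by (unfold L; lra).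
      (* three sides of length at most k L, on each of which f - A is at most e * 2 k L *)
      set (e := eps / (6 * L * L + 1)). assert (He' : 0 < e) by (apply Rdiv_lt_0_compat; nra).
      destruct (proj1 (cder_iff _ _ _) Hl e He') as [d [Hd K]].
      exists (d / (2 * L + 1)). split. apply Rdiv_lt_0_compat; lra.
      intros s t h [T1 [T2 T3]] Hh Hs Ht. set (k := Rabs h) in *. assert (Hk : 0 <= k) by apply Rabs_pos.
      set (A := fun z : C => (f z0 + l * (z - z0))%C).
      assert (DA : forall z, cder A z l).
      { intros z. eapply cder_eq. apply cder_plus. apply cder_const. apply cder_scal. apply cder_minus. apply cder_id. apply cder_const. ring. }
      assert (CA : forall z, ctsC A z) by (intros z; apply (cder_cts A z l), DA).
      assert (IA : forall z w, seg_int A z w = ((f z0 * w + l * ((w - z0) * (w - z0) * / 2)) - (f z0 * z + l * ((z - z0) * (z - z0) * / 2)))%C).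
      { intros z w. apply (seg_int_primitive (fun z => f z0 * z + l * ((z - z0) * (z - z0) * / 2))%C).
        intros r _. split; auto. set (y := seg z w r).
        eapply cder_eq. apply cder_plus. apply cder_scal, cder_id. apply cder_scal.
        apply cder_mult. apply cder_mult; (apply cder_minus; [apply cder_id | apply cder_const]). apply cder_const.
        unfold A. field. }
      (* f - A is at most e |z - z0| on the small triangle, whose points are 2 k L-close to z0 *)
      assert (E : forall s1 t1 s2 t2, in_tri s1 t1 -> in_tri s2 t2 -> Rabs (s1 - s) <= k -> Rabs (t1 - t) <= k -> Rabs (s2 - s) <= k -> Rabs (t2 - t) <= k ->
         Rabs (s2 - s1) <= k -> Rabs (t2 - t1) <= k ->
         Cmod (seg_int f (P s1 t1) (P s2 t2) - seg_int A (P s1 t1) (P s2 t2)) <= k * L * (e * (2 * k * L))).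
      { intros s1 t1 s2 t2 I1 I2 D1 D2 D3 D4 D5 D6. rewrite <- seg_int_minus. 2: apply Hc; auto. 2: { intros r _; apply CA. }
        assert (Bd : forall x y, Cmod (RtoC x * (b - a) + RtoC y * (c - a)) <= Rabs x * Cmod (b - a) + Rabs y * Cmod (c - a)).
        { intros x y. cmod_tri. rewrite !Cmod_mult, !Cmod_R. lra. }
        eapply Rle_trans. apply seg_int_le with (M := e * (2 * k * L)).
        - intros r Hr. apply cts_minus; auto. apply Hc; auto.
        - intros r Hr. set (z := seg _ _ r).
          assert (Hz : Cmod (z - z0) <= 2 * k * L).
          { replace (z - z0)%C with (RtoC ((s1 - s) + (s - p) + r * ((s2 - s) - (s1 - s))) * (b - a) + RtoC ((t1 - t) + (t - q) + r * ((t2 - t) - (t1 - t))) * (c - a))%C.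
            2: { unfold z, z0, seg, P, tri_pt. rewrite !RtoC_plus, !RtoC_mult, !RtoC_minus. ring. }
            eapply Rle_trans. apply Bd.
            apply Rabs_le_between in Hs, Ht, D1, D2, D3, D4.
            assert (Rabs (s1 - s + (s - p) + r * (s2 - s - (s1 - s))) <= 2 * k) by (apply Rabs_le; nra).
            assert (Rabs (t1 - t + (t - q) + r * (t2 - t - (t1 - t))) <= 2 * k) by (apply Rabs_le; nra).
            unfold L. nra. }
          replace (f z - A z)%C with (f z - f z0 - l * (z - z0))%C by (unfold A; ring).
          eapply Rle_trans. apply K. eapply Rle_lt_trans. exact Hz. apply Rlt_div_r in Hh; lra || nra.
          apply Rmult_le_compat_l; lra.
        - apply Rmult_le_compat_r. apply Rmult_le_pos; nra.
          replace (P s2 t2 - P s1 t1)%C with (RtoC (s2 - s1) * (b - a) + RtoC (t2 - t1) * (c - a))%C.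
          2: { unfold P, tri_pt. rewrite !RtoC_minus. ring. }
          eapply Rle_trans. apply Bd. unfold L. nra. }
      assert (r0 : forall x, Rabs (x - x) <= k) by (intros; rewrite Rminus_diag, Rabs_R0; auto).
      assert (r1 : forall x, Rabs (x + h - x) <= k) by (intros; replace (x + h - x) with h by ring; apply Rle_refl).
      assert (r2 : forall x, Rabs (x - (x + h)) <= k) by (intros; rewrite Rabs_minus_sym; auto).
      replace (bd s t h) with ((seg_int f (P s t) (P (s + h)%R t) - seg_int A (P s t) (P (s + h)%R t)) +
         (seg_int f (P (s + h)%R t) (P s (t + h)%R) - seg_int A (P (s + h)%R t) (P s (t + h)%R)) +
         (seg_int f (P s (t + h)%R) (P s t) - seg_int A (P s (t + h)%R) (P s t)))%C.
      2: { rewrite !IA. unfold bd, tri_bd. ring. }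
      cmod_tri. eapply Rle_trans. apply Rplus_le_compat_r, Cmod_triangle.
      assert (E1 := E s t (s + h) t T1 T2 (r0 _) (r0 _) (r1 _) (r0 _) (r1 _) (r0 _)).
      assert (E2 := E (s + h) t s (t + h) T2 T3 (r1 _) (r0 _) (r0 _) (r1 _) (r2 _) (r1 _)).
      assert (E3 := E s (t + h) s t T3 T1 (r0 _) (r1 _) (r0 _) (r0 _) (r0 _) (r2 _)).
      replace (h * h) with (k * k) by (unfold k; rewrite <- Rabs_mult; apply Rabs_pos_eq; nra).
      assert (Ee : eps = e * (6 * L * L + 1)) by (unfold e; field; nra). rewrite Ee. nra. }
  replace (tri_bd f a b c) with (bd 0 0 1).
  2: { unfold bd. f_equal; unfold P, tri_pt; rewrite ?Rplus_0_l; ring. }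
  apply Cmod_eq_0. apply Rle_antisym. 2: apply Cmod_ge_0.
  apply le_epsilon. intros eps He. rewrite Rplus_0_l. apply X; auto.
Qed.

Definition cdisc (c : C) (r : R) (z : C) : Prop := Cmod (z - c) < r.

Lemma cdisc_center p r : 0 < r -> cdisc p r p.
Proof. intros Hr. unfold cdisc. replace (p - p)%C with (RtoC 0) by ring. rewrite Cmod_0; auto. Qed.

Lemma cdisc_convex c r a b z s t : cdisc c r a -> cdisc c r b -> cdisc c r z -> in_tri s t -> cdisc c r (tri_pt a b z s t).
Proof.
  unfold cdisc, in_tri, tri_pt. intros Ha Hb Hz [Hs [Ht Hst]].
  replace (a + RtoC s * (b - a) + RtoC t * (z - a) - c)%C with (RtoC (1 - s - t) * (a - c) + RtoC s * (b - c) + RtoC t * (z - c))%C.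
  2: { rewrite !RtoC_minus. ring. }
  cmod_tri_lt. eapply Rle_lt_trans. apply Rplus_le_compat_r, Cmod_triangle.
  rewrite !Cmod_mult, !Cmod_R, !Rabs_pos_eq by lra.
  set (m := Rmax (Cmod (a - c)) (Rmax (Cmod (b - c)) (Cmod (z - c)))).
  assert (m < r) by (repeat apply Rmax_lub_lt; auto).
  assert (M1 : Cmod (a - c) <= m) by apply Rmax_l.
  assert (M2 : Cmod (b - c) <= m) by (eapply Rle_trans; [apply Rmax_l | apply Rmax_r]).
  assert (M3 : Cmod (z - c) <= m) by (eapply Rle_trans; [apply Rmax_r | apply Rmax_r]). nra.
Qed.

Definition holo (D : C -> Prop) (f : C -> C) : Prop := forall z, D z -> exists l, cder f z l.

(** The primitive is the integral along the radius from the centre; by [goursat] its increments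
    are integrals over short segments. *)
Lemma local_primitive (f : C -> C) (c : C) (r : R) :
  holo (cdisc c r) f -> exists F, forall z, cdisc c r z -> cder F z (f z).
Proof.
  intros H. exists (seg_int f c). intros z Hz.
  assert (Hr : cdisc c r c) by (apply cdisc_center; unfold cdisc in Hz; generalize (Cmod_ge_0 (z - c)); lra).
  assert (Hseg : forall p q, cdisc c r p -> cdisc c r q -> on_seg (fun z => cdisc c r z) p q).
  { intros p q Hp Hq s Hs. replace (seg p q s) with (tri_pt p q q s 0) by (unfold seg, tri_pt; ring).
    apply cdisc_convex; auto. unfold in_tri; lra. }
  assert (Hc : forall p q, cdisc c r p -> cdisc c r q -> on_seg (fun z => ctsC f z) p q).
  { intros p q Hp Hq s Hs. destruct (H _ (Hseg p q Hp Hq s Hs)) as [l Hl]. eapply cder_cts; eauto. }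
  apply cder_iff. intros eps He. destruct (H z Hz) as [l Hl].
  destruct (proj1 (continuous_CC_iff f z) (cder_cts f z l Hl) eps He) as [d [Hd K]].
  unfold cdisc in Hz. exists (Rmin d (r - Cmod (z - c))). split. apply Rmin_pos; lra.
  intros w Hw. apply Rmin_Rgt_l in Hw as [W1 W2].
  assert (Dw : cdisc c r w). { unfold cdisc. replace (w - c)%C with ((w - z) + (z - c))%C by ring. cmod_tri_lt. lra. }
  assert (G : tri_bd f c z w = 0%C) by (apply goursat; intros; apply H, cdisc_convex; auto).
  unfold tri_bd in G. rewrite (seg_int_rev f c w) in G by auto.
  replace (seg_int f c w) with (seg_int f c z + seg_int f z w)%C.
  2: { replace (seg_int f c w) with (0 + seg_int f c w)%C by ring. rewrite <- G. ring. }
  replace (seg_int f c z + seg_int f z w - seg_int f c z - f z * (w - z))%C with (seg_int (fun y => f y - f z)%C z w).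
  2: { rewrite seg_int_minus; auto. 2: { intros s _; apply cts_const. } unfold seg_int at 2. rewrite CInt_const, Rminus_0_r. ring. }
  rewrite Rmult_comm. apply seg_int_le.
  - intros s Hs. apply cts_minus. apply Hc; auto. apply cts_const.
  - intros s Hs. apply Rlt_le, K. eapply Rle_lt_trans with (2 := W1).
    replace (seg z w s - z)%C with (RtoC s * (w - z))%C by (unfold seg; ring).
    rewrite Cmod_mult, Cmod_R, Rabs_pos_eq by lra. generalize (Cmod_ge_0 (w - z)). nra.
Qed.

(** * Differentiation under the integral sign *)

Local Notation CR_space := (prod_UniformSpace C_UniformSpace R_UniformSpace).
Local Notation cts2 f z t := (continuous (T := CR_space) (U := C_UniformSpace)
   (fun p : C * R => f (fst p) (snd p)) (z, t)).

Lemma cts2_fst q : continuous (T := CR_space) (U := C_UniformSpace) (fun p => fst p) q.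
Proof. destruct q. apply (continuous_fst (U := C_UniformSpace) (V := R_UniformSpace)). Qed.

Lemma cts2_of_snd (k : R -> C) z t : ctsR k t -> continuous (T := CR_space) (U := C_UniformSpace) (fun p => k (snd p)) (z, t).
Proof.
  intros H. apply (continuous_comp (U := CR_space) (V := R_UniformSpace) (W := C_UniformSpace) (fun q => snd q) k); auto.
  apply (continuous_snd (U := C_UniformSpace) (V := R_UniformSpace)).
Qed.

Lemma cts2_eps (f : C -> R -> C) z t : cts2 f z t ->
  forall eps, 0 < eps -> exists d, 0 < d /\ forall w s, Cmod (w - z) < d -> Rabs (s - t) < d -> Cmod (f w s - f z t) < eps.
Proof.
  intros H eps He.
  assert (K : locally (T := C_UniformSpace) (f z t) (fun y => Cmod (y - f z t) < eps)).
  { apply locally_C_iff. exists eps; split; auto. }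
  apply H in K. destruct K as [d K]. exists d; split. apply cond_pos.
  intros w s Hw Hs. apply (K (w, s)). split. split; simpl.
  eapply Rle_lt_trans with (2 := Hw). apply (re_le_Cmod (w - z)).
  eapply Rle_lt_trans with (2 := Hw). apply (im_le_Cmod (w - z)).
  exact Hs.
Qed.

Lemma cts2_snd (f : C -> R -> C) z t : cts2 f z t -> ctsR (f z) t.
Proof.
  intros H. apply continuous_RC_iff. intros eps He. destruct (cts2_eps f z t H eps He) as [d [Hd K]].
  exists d; split; auto. intros s Hs. apply K; auto. replace (z - z)%C with (RtoC 0) by ring. rewrite Cmod_0; auto.
Qed.

(** Uniformity over the compact parameter interval, by [cousin]. *)
Lemma cts_unif (f : C -> R -> C) z a b : a <= b -> (forall t, a <= t <= b -> cts2 f z t) ->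
  forall eps, 0 < eps -> exists d, 0 < d /\ forall w t, Cmod (w - z) < d -> a <= t <= b -> Cmod (f w t - f z t) < eps.
Proof.
  intros Hab H eps He.
  apply (cousin (fun u v => exists d, 0 < d /\ forall w t, Cmod (w - z) < d -> u <= t <= v -> Cmod (f w t - f z t) < eps) a b Hab).
  - intros u v w Huv [d1 [Hd1 K1]] [d2 [Hd2 K2]]. exists (Rmin d1 d2). split. apply Rmin_pos; auto.
    intros x t Hx Ht. destruct (Rle_dec t v).
    apply K1. eapply Rlt_le_trans; [exact Hx | apply Rmin_l]. lra.
    apply K2. eapply Rlt_le_trans; [exact Hx | apply Rmin_r]. lra.
  - intros t Ht. destruct (cts2_eps f z t (H t Ht) (eps / 2)) as [d [Hd K]]. lra.
    exists d; split; auto. intros u v Hu Hv Hau Hvb. exists d; split; auto. intros w s Hw Hs.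
    assert (Rabs (s - t) < d) by (apply Rabs_def1; lra).
    replace (f w s - f z s)%C with ((f w s - f z t) - (f z s - f z t))%C by ring.
    cmod_tri_lt. rewrite Cmod_opp.
    assert (A := K w s Hw H0). assert (B := K z s).
    replace (z - z)%C with (RtoC 0) in B by ring. rewrite Cmod_0 in B. specialize (B Hd H0). lra.
Qed.

(** The increment is the integral of the derivative along the segment, so it inherits a bound on
    the deviation of the derivative from l. *)
Lemma mean_value_C (f f' : C -> C) (z0 z1 l : C) (e : R) :
  (forall s, 0 <= s <= 1 -> cder f (seg z0 z1 s) (f' (seg z0 z1 s)) /\ ctsC f' (seg z0 z1 s)
     /\ Cmod (f' (seg z0 z1 s) - l) <= e) ->
  Cmod (f z1 - f z0 - l * (z1 - z0))%C <= e * Cmod (z1 - z0).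
Proof.
  intros H.
  assert (I : CInt (fun s => (f' (seg z0 z1 s) - l) * (z1 - z0))%C 0 1 = (f z1 - f z0 - l * (z1 - z0))%C).
  { rewrite (CInt_derive (fun s => f (seg z0 z1 s) - (l * z0 + RtoC s * (l * (z1 - z0))))%C).
    - rewrite seg_0, seg_1. ring.
    - intros s Hs. rewrite Rmin_left, Rmax_right in Hs by lra.
      replace ((f' (seg z0 z1 s) - l) * (z1 - z0))%C with (f' (seg z0 z1 s) * (z1 - z0) - l * (z1 - z0))%C by ring.
      apply (is_derive_minus (K := R_AbsRing) (V := C_R_NormedModule)).
      apply rder_comp. apply H; auto. apply rder_seg. apply rder_affine.
    - intros s Hs. rewrite Rmin_left, Rmax_right in Hs by lra.
      apply cts_mult. 2: apply cts_const. apply cts_minus. 2: apply cts_const.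
      apply cts_comp. eapply cts_rder, rder_seg. apply H; auto. }
  rewrite <- I. eapply Rle_trans. apply Cmod_CInt_le with (M := e * Cmod (z1 - z0)).
  - intros s Hs. rewrite Rmin_left, Rmax_right in Hs by lra. rewrite Cmod_mult. apply Rmult_le_compat_r. apply Cmod_ge_0.
    apply H; auto.
  - apply cts_ex_CInt. intros s Hs. rewrite Rmin_left, Rmax_right in Hs by lra.
      apply cts_mult. 2: apply cts_const. apply cts_minus. 2: apply cts_const.
      apply cts_comp. eapply cts_rder, rder_seg. apply H; auto.
  - rewrite Rminus_0_r, Rabs_R1. lra.
Qed.

Lemma zero_der_const (f : C -> C) (z0 z1 : C) :
  (forall s, 0 <= s <= 1 -> cder f (seg z0 z1 s) 0%C) -> f z1 = f z0.
Proof.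
  intros H. assert (K : Cmod (f z1 - f z0 - 0 * (z1 - z0))%C <= 0 * Cmod (z1 - z0)).
  { apply (mean_value_C f (fun _ => 0%C)). intros s Hs. split; [|split]. apply H; auto. apply cts_const.
    replace (0 - 0)%C with (RtoC 0) by ring. rewrite Cmod_0; lra. }
  rewrite Rmult_0_l in K. assert (E := Cmod_eq_0 _ (Rle_antisym _ _ K (Cmod_ge_0 _))).
  replace (f z1) with (f z0 + (f z1 - f z0 - 0 * (z1 - z0)))%C by ring. rewrite E. ring.
Qed.

Lemma seg_disc c z s : 0 <= s <= 1 -> Cmod (seg c z s - c) <= Cmod (z - c).
Proof.
  intros Hs. unfold seg. replace (c + RtoC s * (z - c) - c)%C with (RtoC s * (z - c))%C by ring.
  rewrite Cmod_mult, Cmod_R, Rabs_pos_eq by lra. generalize (Cmod_ge_0 (z - c)); nra.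
Qed.

(** The difference quotients converge uniformly in the parameter, by [mean_value_C] and
    [cts_unif]. *)
Lemma cder_CInt_param (phi psi : C -> R -> C) (z0 : C) (rho a b : R) :
  0 < rho -> a <= b ->
  (forall z t, cdisc z0 rho z -> a <= t <= b -> cder (fun w => phi w t) z (psi z t)) ->
  (forall z t, cdisc z0 rho z -> a <= t <= b -> cts2 psi z t) ->
  (forall z, cdisc z0 rho z -> ex_CInt (phi z) a b) ->
  cder (fun z => CInt (phi z) a b) z0 (CInt (psi z0) a b).
Proof.
  intros Hr Hab H1 H2 H3.
  assert (D0 : cdisc z0 rho z0). { unfold cdisc. replace (z0 - z0)%C with (RtoC 0) by ring. rewrite Cmod_0; auto. }
  assert (E0 : ex_CInt (psi z0) a b).
  { apply cts_ex_CInt. rewrite Rmin_left, Rmax_right by lra. intros t Ht. apply (cts2_snd psi). auto. }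
  apply cder_iff. intros eps He.
  destruct (cts_unif psi z0 a b Hab (fun t Ht => H2 z0 t D0 Ht) (eps / (b - a + 1))) as [d [Hd K]].
  { apply Rdiv_lt_0_compat; lra. }
  exists (Rmin d rho). split. apply Rmin_pos; auto. intros w Hw.
  destruct (Rmin_Rgt_l _ _ _ Hw) as [W1 W2].
  assert (Ew : ex_CInt (phi w) a b) by (apply H3; auto). assert (Ez : ex_CInt (phi z0) a b) by (apply H3; auto).
  replace (CInt (phi w) a b - CInt (phi z0) a b - CInt (psi z0) a b * (w - z0))%C with
    (CInt (fun t => (phi w t - phi z0 t) - (w - z0) * psi z0 t)%C a b).
  2: { rewrite CInt_minus, CInt_minus, CInt_scal; auto. ring. apply ex_CInt_minus; auto. apply ex_CInt_scal; auto. }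
  eapply Rle_trans. apply Cmod_CInt_le with (M := eps / (b - a + 1) * Cmod (w - z0)).
  - rewrite Rmin_left, Rmax_right by lra. intros t Ht.
    rewrite (Cmult_comm (w - z0)). apply (mean_value_C (fun z => phi z t) (fun z => psi z t)).
    intros s Hs. assert (Ls := seg_disc z0 w s Hs). assert (Ds : cdisc z0 rho (seg z0 w s)) by (unfold cdisc; lra).
    split; [|split].
    + apply H1; auto.
    + apply continuous_CC_iff. intros e He'. destruct (cts2_eps psi _ t (H2 _ t Ds Ht) e He') as [d' [Hd' K']].
      exists d'; split; auto. intros; apply K'; auto. rewrite Rminus_diag, Rabs_R0; auto.
    + apply Rlt_le, K; auto. lra.
  - apply ex_CInt_minus. apply ex_CInt_minus; auto. apply ex_CInt_scal; auto.
  - rewrite Rabs_pos_eq by lra. assert (P := Cmod_ge_0 (w - z0)).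
    replace (eps / (b - a + 1) * Cmod (w - z0) * (b - a)) with (eps * Cmod (w - z0) * ((b - a) / (b - a + 1))) by (field; lra).
    rewrite <- (Rmult_1_r (eps * Cmod (w - z0))) at 2. apply Rmult_le_compat_l. nra. apply Rle_div_l; lra.
Qed.

(** * Cauchy transforms and Cauchy's formula *)

Definition cis (t : R) : C := (cos t, sin t).

Lemma rder_pair (u v : R -> R) t lu lv : is_derive u t lu -> is_derive v t lv -> rder (fun s => (u s, v s) : C) t (lu, lv).
Proof.
  intros Hu Hv. apply rder_RtoC in Hu. apply rder_RtoC in Hv. rewrite rder_iff in *.
  intros eps He. assert (He2 : 0 < eps / 2) by lra.
  destruct (Hu _ He2) as [d1 [Hd1 K1]]. destruct (Hv _ He2) as [d2 [Hd2 K2]].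
  exists (Rmin d1 d2). split. apply Rmin_pos; auto. intros s Hs.
  specialize (K1 s (Rlt_le_trans _ _ _ Hs (Rmin_l _ _))). specialize (K2 s (Rlt_le_trans _ _ _ Hs (Rmin_r _ _))).
  match goal with |- Cmod ?z <= _ => replace z with ((RtoC (u s) - RtoC (u t) - RtoC lu * RtoC (s - t)) + Ci * (RtoC (v s) - RtoC (v t) - RtoC lv * RtoC (s - t)))%C end.
  2: { unfold RtoC, Ci, Cminus, Cplus, Cmult, Copp; simpl. f_equal; ring. }
  cmod_tri. rewrite Cmod_mult, Cmod_Ci. lra.
Qed.

Lemma rder_cis t : rder cis t (Ci * cis t)%C.
Proof.
  replace (Ci * cis t)%C with ((- sin t)%R, cos t).
  2: { unfold cis, Ci, Cmult; simpl. f_equal; ring. }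
  apply rder_pair. apply is_derive_cos. apply is_derive_sin.
Qed.

Lemma Cmod_cis t : Cmod (cis t) = 1.
Proof.
  unfold Cmod, cis; simpl. rewrite !Rmult_1_r. generalize (sin2_cos2 t). unfold Rsqr. rewrite Rplus_comm. intros ->. apply sqrt_1.
Qed.

Lemma cis_0 : cis 0 = 1%C. Proof. unfold cis. rewrite cos_0, sin_0. reflexivity. Qed.
Lemma cis_2PI : cis (2 * PI) = 1%C. Proof. unfold cis. rewrite cos_2PI, sin_2PI. reflexivity. Qed.

Definition circ (p : C) (r t : R) : C := (p + RtoC r * cis t)%C.

Lemma rder_circ p r t : rder (circ p r) t (Ci * (circ p r t - p))%C.
Proof.
  unfold circ. replace (Ci * (p + RtoC r * cis t - p))%C with (RtoC r * (Ci * cis t))%C by ring.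
  apply rder_iff. intros eps He.
  destruct (proj1 (rder_iff _ _ _) (rder_cis t) (eps / (Rabs r + 1))) as [d [Hd K]].
  { apply Rdiv_lt_0_compat; auto. generalize (Rabs_pos r); lra. }
  exists d; split; auto. intros s Hs. specialize (K s Hs).
  match goal with |- Cmod ?z <= _ => replace z with (RtoC r * (cis s - cis t - Ci * cis t * RtoC (s - t)))%C by ring end.
  rewrite Cmod_mult, Cmod_R. assert (P := Rabs_pos r). assert (P2 := Rabs_pos (s - t)).
  apply Rle_trans with (Rabs r * (eps / (Rabs r + 1) * Rabs (s - t))). apply Rmult_le_compat_l; auto.
  replace (Rabs r * (eps / (Rabs r + 1) * Rabs (s - t))) with (eps * Rabs (s - t) * (Rabs r / (Rabs r + 1))) by (field; lra).
  rewrite <- (Rmult_1_r (eps * Rabs (s - t))) at 2. apply Rmult_le_compat_l. nra. apply Rle_div_l; lra.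
Qed.

Lemma cts_circ p r t : ctsR (circ p r) t.
Proof. eapply cts_rder, rder_circ. Qed.

Lemma Cmod_circ p r t : 0 < r -> Cmod (circ p r t - p) = r.
Proof.
  intros Hr. unfold circ. replace (p + RtoC r * cis t - p)%C with (RtoC r * cis t)%C by ring.
  rewrite Cmod_mult, Cmod_R, Cmod_cis, Rabs_pos_eq; lra.
Qed.

Lemma circ_period p r : circ p r (2 * PI) = circ p r 0.
Proof. unfold circ. rewrite cis_0, cis_2PI. reflexivity. Qed.

Lemma circ_gap p r t z : 0 < r -> r - Cmod (z - p) <= Cmod (circ p r t - z).
Proof.
  intros Hr. assert (E := Cmod_circ p r t Hr).
  assert (Cmod (circ p r t - p) <= Cmod (circ p r t - z) + Cmod (z - p)).
  { replace (circ p r t - p)%C with ((circ p r t - z) + (z - p))%C by ring. apply Cmod_triangle. } lra.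
Qed.

Lemma circ_neq p r t z : 0 < r -> cdisc p r z -> (circ p r t - z)%C <> 0%C.
Proof.
  intros Hr Hz E. assert (G := circ_gap p r t z Hr). rewrite E, Cmod_0 in G. unfold cdisc in Hz. lra.
Qed.

Lemma cts_Cinv {U : UniformSpace} (f : U -> C) x : continuous (U := C_UniformSpace) f x -> f x <> 0%C ->
  continuous (U := C_UniformSpace) (fun y => / f y)%C x.
Proof. intros H Hx. apply (cts_comp f Cinv x H). eapply cder_cts, cder_inv; auto. Qed.

Lemma cts_Cpow {U : UniformSpace} (f : U -> C) x n : continuous (U := C_UniformSpace) f x ->
  continuous (U := C_UniformSpace) (fun y => f y ^ n)%C x.
Proof.
  intros H. induction n. apply cts_const. simpl. apply (cts_mult f (fun y => f y ^ n)%C); auto.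
Qed.

(** Differentiating in z only changes n, so that a function written as a Cauchy transform is
    infinitely differentiable. *)
Definition cauchy_tr (k : R -> C) (p : C) (r : R) (n : nat) (z : C) : C :=
  CInt (fun t => k t * / (circ p r t - z) ^ n)%C 0 (2 * PI).

Lemma cts_sub_circ p r z t : cts2 (fun (z : C) (t : R) => circ p r t - z)%C z t.
Proof. apply (cts_minus (U := CR_space)). apply cts2_of_snd, cts_circ. apply cts2_fst. Qed.

Lemma cts_ker (k : R -> C) p r n z t : (forall t, ctsR k t) -> 0 < r -> cdisc p r z ->
  cts2 (fun (z : C) (t : R) => k t * / (circ p r t - z) ^ n)%C z t.
Proof.
  intros Hk Hr Hz. apply (cts_mult (U := CR_space)). apply cts2_of_snd, Hk.
  apply (cts_Cinv (U := CR_space)). apply (cts_Cpow (U := CR_space)), cts_sub_circ. apply Cpow_nz, circ_neq; auto.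
Qed.

Lemma ex_ker (k : R -> C) p r n z : (forall t, ctsR k t) -> 0 < r -> cdisc p r z ->
  ex_CInt (fun t => k t * / (circ p r t - z) ^ n)%C 0 (2 * PI).
Proof.
  intros Hk Hr Hz. apply cts_ex_CInt_all. intros t. apply (cts2_snd _ z t (cts_ker k p r n z t Hk Hr Hz)).
Qed.

Lemma cdisc_inner p r z w : cdisc p r z -> cdisc z (r - Cmod (z - p)) w -> cdisc p r w.
Proof.
  unfold cdisc. intros Hz Hw. replace (w - p)%C with ((w - z) + (z - p))%C by ring.
  cmod_tri_lt. lra.
Qed.

Lemma cder_cauchy_tr (k : R -> C) p r n z : (forall t, ctsR k t) -> 0 < r -> cdisc p r z ->
  cder (cauchy_tr k p r n) z (RtoC (INR n) * cauchy_tr k p r (S n) z)%C.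
Proof.
  intros Hk Hr Hz. unfold cauchy_tr at 2. rewrite <- CInt_scal by (apply ex_ker; auto).
  apply (cder_CInt_param (fun z t => k t * / (circ p r t - z) ^ n)%C
     (fun z t => RtoC (INR n) * (k t * / (circ p r t - z) ^ S n))%C z (r - Cmod (z - p))).
  - unfold cdisc in Hz; lra.
  - generalize PI_RGT_0; lra.
  - intros w t Hw _. assert (Hw' := cdisc_inner _ _ _ _ Hz Hw). assert (Hn := circ_neq p r t w Hr Hw').
    eapply cder_eq. apply cder_scal.
    apply (cder_comp Cinv (fun w => (circ p r t - w) ^ n)%C). apply cder_inv. apply Cpow_nz; auto.
    apply cder_pow. apply cder_minus. apply cder_const. apply cder_id.
    eq_in_C. destruct n. simpl. field; auto. simpl pred. simpl Cpow. field. split; auto. apply Cpow_nz; auto.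
  - intros w t Hw _. assert (Hw' := cdisc_inner _ _ _ _ Hz Hw).
    apply (cts_mult (fun q : CR_space => RtoC (INR n)) (fun q : CR_space => k (snd q) * / (circ p r (snd q) - fst q) ^ S n)%C).
    apply cts_const. apply cts_ker; auto.
  - intros w Hw. assert (Hw' := cdisc_inner _ _ _ _ Hz Hw). apply ex_ker; auto.
Qed.

Lemma cts_circ_sub p r t : ctsR (fun t => circ p r t - p)%C t.
Proof. apply cts_minus. apply cts_circ. apply cts_const. Qed.

(** For z = p the integrand is 1; the derivative in z vanishes because its integrand has a
    periodic primitive. *)
Lemma cauchy_tr_const p r z : 0 < r -> cdisc p r z ->
  cauchy_tr (fun t => circ p r t - p)%C p r 1 z = RtoC (2 * PI).
Proof.
  intros Hr Hz. set (k := fun t => (circ p r t - p)%C).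
  assert (Hk : forall t, ctsR k t) by (intros; apply cts_circ_sub).
  rewrite (zero_der_const (cauchy_tr k p r 1) p z).
  - unfold cauchy_tr. rewrite (CInt_ext _ (fun _ => RtoC 1)).
    rewrite CInt_const, Rminus_0_r. ring.
    intros t. unfold k. assert (Hn := circ_neq p r t p Hr (cdisc_center p r Hr)). field; auto.
  - intros s Hs. assert (Ls := seg_disc p z s Hs). set (w := seg p z s) in *.
    assert (Hw : cdisc p r w) by (unfold cdisc in *; lra).
    eapply cder_eq. apply cder_cauchy_tr; auto.
    replace (cauchy_tr k p r 2 w) with (RtoC 0). ring.
    unfold cauchy_tr. symmetry.
    rewrite (CInt_derive (fun t => (- / Ci) * / (circ p r t - w))%C).
    + rewrite circ_period. ring.
    + intros t _. assert (Hn := circ_neq p r t w Hr Hw).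
      replace (k t * / (circ p r t - w) ^ 2)%C with ((- / Ci * - / ((circ p r t - w) * (circ p r t - w)))  * (Ci * (circ p r t - p)))%C.
      2: { unfold k. field. split; auto. apply Ci_nz. }
      apply (rder_comp (fun q => - / Ci * / (q - w))%C (circ p r)). 2: apply rder_circ.
      apply cder_scal. eapply cder_eq. apply (cder_comp Cinv (fun q => q - w)%C). apply cder_inv; auto.
      apply cder_minus. apply cder_id. apply cder_const. eq_in_C. field; auto.
    + intros t _. apply (cts2_snd (fun z t => k t * / (circ p r t - z) ^ 2)%C). apply cts_ker; auto.
Qed.

Lemma conv_comb_circ p r z s t : 0 < r -> cdisc p r z -> 0 <= s <= 1 ->
  Cmod (z + RtoC s * (circ p r t - z) - p) <= r.
Proof.
  intros Hr Hz Hs. replace (z + RtoC s * (circ p r t - z) - p)%C with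
    (RtoC (1 - s) * (z - p) + RtoC s * (circ p r t - p))%C by (rewrite RtoC_minus; ring).
  cmod_tri. rewrite !Cmod_mult, !Cmod_R, !Rabs_pos_eq, Cmod_circ by lra.
  unfold cdisc in Hz. nra.
Qed.

Lemma conv_comb_circ_near p r z t (s0 : R) (s : C) : 0 < r -> cdisc p r z -> 0 <= s0 <= 1 ->
  Cmod (z + s * (circ p r t - z) - p) <= r + Cmod (s - RtoC s0) * (2 * r).
Proof.
  intros Hr Hz Hs. replace (z + s * (circ p r t - z) - p)%C with
   ((z + RtoC s0 * (circ p r t - z) - p) + (s - RtoC s0) * (circ p r t - z))%C by ring.
  cmod_tri. rewrite Cmod_mult.
  apply Rplus_le_compat. apply conv_comb_circ; auto.
  apply Rmult_le_compat_l. apply Cmod_ge_0.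
  replace (circ p r t - z)%C with ((circ p r t - p) + - (z - p))%C by ring.
  cmod_tri. rewrite Cmod_opp, Cmod_circ by lra. unfold cdisc in Hz; lra.
Qed.

(** The integral of G(z + s(gamma - z)) (gamma - p) / (gamma - z) over the circle gamma is constant
    in s: its derivative has the integrand g(z + s(gamma - z)) gamma' / i, which has a periodic
    primitive.  It is the left-hand side for s = 1 and a multiple of G(z) for s = 0.  Continuity of
    g is used to differentiate under the integral sign. *)
Lemma cauchy_formula_C1 (G g : C -> C) p R r z : 0 < r < R ->
  (forall w, cdisc p R w -> cder G w (g w) /\ ctsC g w) -> cdisc p r z ->
  cauchy_tr (fun t => G (circ p r t) * (circ p r t - p))%C p r 1 z = (RtoC (2 * PI) * G z)%C.
Proof.
  intros HrR HG Hz. assert (Hr : 0 < r) by lra.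
  set (Phi := fun (s : C) (t : Rdefinitions.R) => (G (z + s * (circ p r t - z)) * ((circ p r t - p) / (circ p r t - z)))%C).
  set (Psi := fun (s : C) (t : Rdefinitions.R) => (g (z + s * (circ p r t - z)) * (circ p r t - p))%C).
  (* for |s - s0| < rho with s0 in [0, 1] the points z + s (gamma - z) stay in the disc of radius R,
     because |gamma - z| <= 2 r *)
  set (rho := (R - r) / (2 * r)). assert (Hrho : 0 < rho) by (apply Rdiv_lt_0_compat; lra).
  assert (Hin : forall (s0 : Rdefinitions.R) s t, 0 <= s0 <= 1 -> cdisc (RtoC s0) rho s -> cdisc p R (z + s * (circ p r t - z))%C).
  { intros s0 s t Hs0 Hs. unfold cdisc. eapply Rle_lt_trans. apply conv_comb_circ_near with (s0 := s0); auto.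
    unfold cdisc in Hs. apply Rmult_lt_compat_r with (r := 2 * r) in Hs; [|lra].
    unfold rho in Hs. replace ((R - r) / (2 * r) * (2 * r)) with (R - r) in Hs by (field; lra). lra. }
  assert (HD : forall s, 0 <= s <= 1 -> cder (fun s => CInt (Phi s) 0 (2 * PI)) (RtoC s) 0%C).
  { intros s Hs.
    assert (Hz0 : CInt (Psi (RtoC s)) 0 (2 * PI) = 0%C).
    { assert (CPsi : forall t, ctsR (Psi (RtoC s)) t).
      { intros t. unfold Psi. apply cts_mult. 2: apply cts_circ_sub.
        apply (cts_comp (fun t => z + RtoC s * (circ p r t - z))%C g).
        apply cts_plus. apply cts_const. apply cts_mult. apply cts_const. apply cts_minus. apply cts_circ. apply cts_const.
        apply HG. apply (Hin s); auto; apply cdisc_center; auto. }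
      (* the primitive G(z + s (gamma - z)) / (i s) only exists for s <> 0 *)
      destruct (Req_dec s 0) as [Hs0|Hs0].
      - rewrite (CInt_derive (fun t => (g z / Ci) * circ p r t)%C). rewrite circ_period. ring.
        intros t _. unfold Psi. rewrite Hs0.
        replace (z + 0 * (circ p r t - z))%C with z by ring.
        replace (g z * (circ p r t - p))%C with ((g z / Ci) * (Ci * (circ p r t - p)))%C by (field; apply Ci_nz).
        apply (rder_comp (fun w => g z / Ci * w)%C (circ p r)). 2: apply rder_circ.
        eapply cder_eq. apply cder_scal, cder_id. ring.
        intros; apply CPsi.
      - assert (Hsc : RtoC s <> 0%C) by (intros E; apply Hs0; injection E; auto).
        rewrite (CInt_derive (fun t => / (Ci * RtoC s) * G (z + RtoC s * (circ p r t - z)))%C). rewrite circ_period. ring.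
        2: intros; apply CPsi.
        intros t _. unfold Psi. set (gg := g _).
        replace (gg * (circ p r t - p))%C with ((/ (Ci * RtoC s) * (gg * RtoC s)) * (Ci * (circ p r t - p)))%C.
        2: { field. split; auto. apply Ci_nz. }
        apply (rder_comp (fun w => / (Ci * RtoC s) * G (z + RtoC s * (w - z)))%C (circ p r)). 2: apply rder_circ.
        apply cder_scal. eapply cder_eq. apply (cder_comp G (fun w => z + RtoC s * (w - z))%C).
        apply HG. apply (Hin s); auto; apply cdisc_center; auto.
        apply cder_plus. apply cder_const. apply cder_scal. apply cder_minus. apply cder_id. apply cder_const.
        unfold gg. ring. }
    rewrite <- Hz0.
    apply (cder_CInt_param Phi Psi (RtoC s) rho); auto.
    - generalize PI_RGT_0; lra.
    - intros w t Hw _. unfold Phi, Psi. assert (Hn := circ_neq p r t z Hr Hz).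
      eapply cder_eq. apply cder_mult. apply (cder_comp G (fun s => z + s * (circ p r t - z))%C).
      apply HG. apply (Hin s); auto. apply cder_plus. apply cder_const. apply cder_mult. apply cder_id. apply cder_const.
      apply cder_const. eq_in_C. cbv beta. field; auto.
    - intros w t Hw _. unfold Psi.
      pose (U := CR_space).
      assert (Cc := cts2_of_snd (circ p r) w t (cts_circ p r t)).
      apply (cts_mult (U := U)). 2: { apply (cts_minus (U := U)); auto. apply cts_const. }
      apply (cts_comp (U := U) (fun q => z + fst q * (circ p r (snd q) - z))%C g).
      apply (cts_plus (U := U)). apply cts_const. apply (cts_mult (U := U)).
      apply cts2_fst.
      apply (cts_minus (U := U)); auto. apply cts_const.
      apply HG. apply (Hin s); auto.
    - intros w Hw. apply cts_ex_CInt_all. intros t. unfold Phi.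
      apply cts_mult.
      + apply (cts_comp (fun t => z + w * (circ p r t - z))%C G).
        apply cts_plus. apply cts_const. apply cts_mult. apply cts_const. apply cts_minus. apply cts_circ. apply cts_const.
        eapply cder_cts. apply HG. apply (Hin s); auto.
      + apply cts_mult. apply cts_circ_sub. apply cts_Cinv. apply cts_minus. apply cts_circ. apply cts_const. apply circ_neq; auto. }
  assert (E : CInt (Phi 1%C) 0 (2 * PI) = CInt (Phi 0%C) 0 (2 * PI)).
  { apply (zero_der_const (fun s => CInt (Phi s) 0 (2 * PI)) 0%C 1%C). intros s Hs.
    replace (seg 0 1 s) with (RtoC s) by (unfold seg; ring). apply HD; auto. }
  unfold cauchy_tr. rewrite (CInt_ext _ (Phi 1%C)).
  2: { intros t. unfold Phi. replace (z + 1 * (circ p r t - z))%C with (circ p r t) by ring.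
       assert (Hn := circ_neq p r t z Hr Hz). field; auto. }
  rewrite E, (CInt_ext _ (fun t => G z * ((circ p r t - p) * / (circ p r t - z) ^ 1))%C).
  2: { intros t. unfold Phi. replace (z + 0 * (circ p r t - z))%C with z by ring.
       assert (Hn := circ_neq p r t z Hr Hz). field; auto. }
  rewrite CInt_scal by (apply (ex_ker (fun t => circ p r t - p)%C); auto; intros; apply cts_circ_sub).
  change (CInt _ 0 (2 * PI)) with (cauchy_tr (fun t => circ p r t - p)%C p r 1 z).
  rewrite cauchy_tr_const; auto. ring.
Qed.

Lemma two_PI_nz : RtoC (2 * PI) <> 0%C.
Proof. intros E. injection E. generalize PI_RGT_0; lra. Qed.

Lemma cdisc_open p r z : cdisc p r z -> locally (T := C_UniformSpace) z (cdisc p r).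
Proof.
  intros Hz. apply locally_C_iff. exists (r - Cmod (z - p)). split. unfold cdisc in Hz; lra.
  intros w Hw. apply cdisc_inner with z; auto.
Qed.

Lemma cdisc_le p r R z : r <= R -> cdisc p r z -> cdisc p R z.
Proof. unfold cdisc; lra. Qed.

(** Complex differentiability alone implies smoothness: the local primitive F of f is C^1, hence a
    Cauchy transform, hence so are f = F' and f'. *)
Lemma holo_derive p R f : holo (cdisc p R) f -> holo (cdisc p R) (C_derive f).
Proof.
  intros Hf z Hz. set (r := (Cmod (z - p) + R) / 2).
  assert (Hr : 0 < r < R /\ cdisc p r z). { unfold r, cdisc in *. generalize (Cmod_ge_0 (z - p)). lra. }
  destruct Hr as [Hr Hzr].
  destruct (local_primitive f p R Hf) as [F HF].
  set (k := fun t => (F (circ p r t) * (circ p r t - p))%C).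
  assert (Hcirc : forall t, cdisc p R (circ p r t)) by (intros t; unfold cdisc; rewrite Cmod_circ; lra).
  assert (Hk : forall t, ctsR k t).
  { intros t. apply cts_mult. 2: apply cts_circ_sub. apply (cts_comp (circ p r) F). apply cts_circ. eapply cder_cts, HF, Hcirc. }
  assert (EF : forall w, cdisc p r w -> F w = (/ RtoC (2 * PI) * cauchy_tr k p r 1 w)%C).
  { intros w Hw. unfold k. rewrite (cauchy_formula_C1 F f p R r w); auto. field. apply two_PI_nz.
    intros q Hq. split. apply HF; auto. destruct (Hf q Hq). eapply cder_cts; eauto. }
  assert (Ef : forall w, cdisc p r w -> f w = (/ RtoC (2 * PI) * cauchy_tr k p r 2 w)%C).
  { intros w Hw. apply cder_unique with F w. apply HF. apply cdisc_le with r; auto; lra.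
    apply cder_ext_loc with (fun w => / RtoC (2 * PI) * cauchy_tr k p r 1 w)%C.
    generalize (cdisc_open p r w Hw). apply filter_imp. intros q Hq. symmetry. auto.
    apply cder_scal. eapply cder_eq. apply cder_cauchy_tr; auto. lra. simpl. ring. }
  assert (Ed : forall w, cdisc p r w -> C_derive f w = (/ RtoC (2 * PI) * (RtoC (INR 2) * cauchy_tr k p r 3 w))%C).
  { intros w Hw. apply is_C_derive_unique.
    apply cder_ext_loc with (fun w => / RtoC (2 * PI) * cauchy_tr k p r 2 w)%C.
    generalize (cdisc_open p r w Hw). apply filter_imp. intros q Hq. symmetry. auto.
    apply cder_scal. apply cder_cauchy_tr; auto; lra. }
  eexists. apply cder_ext_loc with (fun w => / RtoC (2 * PI) * (RtoC (INR 2) * cauchy_tr k p r 3 w))%C.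
  generalize (cdisc_open p r z Hzr). apply filter_imp. intros q Hq. symmetry. auto.
  apply cder_scal, cder_scal, cder_cauchy_tr; auto; lra.
Qed.

Lemma holo_cder D f z : holo D f -> D z -> cder f z (C_derive f z).
Proof. intros H Hz. destruct (H z Hz). eapply cder_C_derive; eauto. Qed.

Lemma holo_cts D f z : holo D f -> D z -> ctsC f z.
Proof. intros H Hz. destruct (H z Hz). eapply cder_cts; eauto. Qed.

Lemma cts_neq_0 (q : C -> C) (p : C) : ctsC q p -> q p <> 0%C -> exists d, 0 < d /\ forall z, cdisc p d z -> q z <> 0%C.
Proof.
  intros Hc Hq. destruct (proj1 (continuous_CC_iff q p) Hc (Cmod (q p))) as [d [Hd K]]. apply Cmod_gt_0; auto.
  exists d; split; auto. intros z Hz E. specialize (K z Hz). rewrite E in K.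
  replace (0 - q p)%C with (- q p)%C in K by ring. rewrite Cmod_opp in K. lra.
Qed.

Lemma cauchy_formula f p R r z : 0 < r < R -> holo (cdisc p R) f -> cdisc p r z ->
  cauchy_tr (fun t => f (circ p r t) * (circ p r t - p))%C p r 1 z = (RtoC (2 * PI) * f z)%C.
Proof.
  intros Hr Hf Hz. apply cauchy_formula_C1 with (C_derive f) R; auto.
  intros w Hw. split. eapply holo_cder; eauto. eapply holo_cts; eauto. apply holo_derive; auto.
Qed.

(** * Order of vanishing *)

(** The m-th Taylor quotient of f at p, that is, f minus its Taylor polynomial of degree m - 1,
    divided by (z - p)^m, written as a Cauchy transform; its value at p is the m-th Taylor
    coefficient. *)
Definition taylor_quot (f : C -> C) (p : C) (r : R) (m : nat) (z : C) : C :=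
  (/ RtoC (2 * PI) * cauchy_tr (fun t => f (circ p r t) * (circ p r t - p) * / (circ p r t - p) ^ m)%C p r 1 z)%C.

Section TaylorQuotients.
Variables (f : C -> C) (p : C) (R r : R).
Hypothesis Hr : 0 < r < R.
Hypothesis Hf : holo (cdisc p R) f.

Lemma taylor_quot_ker_cts m t : ctsR (fun t => f (circ p r t) * (circ p r t - p) * / (circ p r t - p) ^ m)%C t.
Proof.
  apply cts_mult. apply cts_mult. apply (cts_comp (circ p r) f). apply cts_circ.
  eapply holo_cts; eauto. unfold cdisc. rewrite Cmod_circ; lra. apply cts_circ_sub.
  apply cts_Cinv. apply cts_Cpow, cts_circ_sub. apply Cpow_nz, circ_neq. lra. apply cdisc_center; lra.
Qed.

Lemma taylor_quot_holo m : holo (cdisc p r) (taylor_quot f p r m).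
Proof.
  intros z Hz. eexists. apply cder_scal. apply cder_cauchy_tr; auto. apply taylor_quot_ker_cts. lra.
Qed.

Lemma taylor_quot_0 z : cdisc p r z -> taylor_quot f p r 0 z = f z.
Proof.
  intros Hz. unfold taylor_quot.
  replace (cauchy_tr _ p r 1 z) with (RtoC (2 * PI) * f z)%C. field. apply two_PI_nz.
  rewrite <- (cauchy_formula f p R r z); auto. unfold cauchy_tr. apply CInt_ext. intros t. simpl.
  field. apply circ_neq; auto; lra.
Qed.

Lemma taylor_quot_S m z : cdisc p r z -> taylor_quot f p r m z = (taylor_quot f p r m p + (z - p) * taylor_quot f p r (S m) z)%C.
Proof.
  intros Hz. unfold taylor_quot. assert (Hr0 : 0 < r) by lra. assert (Hp := cdisc_center p r Hr0).
  set (km := fun t => (f (circ p r t) * (circ p r t - p) * / (circ p r t - p) ^ m)%C).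
  set (kS := fun t => (f (circ p r t) * (circ p r t - p) * / (circ p r t - p) ^ S m)%C).
  replace (cauchy_tr km p r 1 z) with (cauchy_tr km p r 1 p + (z - p) * cauchy_tr kS p r 1 z)%C. ring.
  unfold cauchy_tr.
  assert (X1 : ex_CInt (fun t => km t * / (circ p r t - p) ^ 1)%C 0 (2 * PI)) by (apply ex_ker; auto; intros; apply taylor_quot_ker_cts).
  assert (X2 : ex_CInt (fun t => kS t * / (circ p r t - z) ^ 1)%C 0 (2 * PI)) by (apply ex_ker; auto; intros; apply taylor_quot_ker_cts).
  rewrite <- CInt_scal by auto. rewrite <- CInt_plus; auto. 2: apply ex_CInt_scal; auto.
  apply CInt_ext. intros t. unfold km, kS. assert (N1 := circ_neq p r t p Hr0 Hp). assert (N2 := circ_neq p r t z Hr0 Hz).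
  simpl. field. split; auto. split; auto. apply Cpow_nz; auto.
Qed.

Lemma taylor_quot_bound : exists M, 0 <= M /\ forall m z, cdisc p r z ->
  Cmod (taylor_quot f p r m z) <= M * (/ r) ^ m * / (r - Cmod (z - p)).
Proof.
  destruct (continuity_ab_maj (fun t => Cmod (f (circ p r t))) 0 (2 * PI)) as [tm [Hm _]].
  { generalize PI_RGT_0; lra. }
  { intros t _. apply continuity_pt_filterlim.
    apply (continuous_comp (U := R_UniformSpace) (V := C_UniformSpace) (W := R_UniformSpace) (fun t => f (circ p r t)) Cmod).
    - apply (cts_comp (circ p r) f). apply cts_circ. eapply holo_cts; eauto. unfold cdisc. rewrite Cmod_circ; lra.
    - apply (filterlim_norm (K := C_AbsRing) (V := C_NormedModule)). }
  set (M := Cmod (f (circ p r tm))) in *. assert (HM : 0 <= M) by apply Cmod_ge_0.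
  exists (M * r). split. apply Rmult_le_pos; lra. intros m z Hz.
  assert (HP := PI_RGT_0). assert (Hr0 : 0 < r) by lra.
  assert (Hg : 0 < r - Cmod (z - p)) by (unfold cdisc in Hz; lra).
  assert (Hpow : 0 < r ^ m) by (apply pow_lt; lra).
  unfold taylor_quot. rewrite Cmod_mult, Cmod_inv by apply two_PI_nz. rewrite Cmod_R, Rabs_pos_eq by lra.
  apply Rmult_le_reg_l with (2 * PI). lra. rewrite <- Rmult_assoc, Rinv_r, Rmult_1_l by lra.
  eapply Rle_trans. apply Cmod_CInt_le with (M := M * r * (/ r) ^ m * / (r - Cmod (z - p))).
  - intros t Ht. rewrite Rmin_left, Rmax_right in Ht by lra.
    assert (N1 := circ_neq p r t p Hr0 (cdisc_center p r Hr0)). assert (N2 := circ_neq p r t z Hr0 Hz).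
    rewrite !Cmod_mult, !Cmod_inv, !Cmod_pow, !Cmod_circ, pow_1 by (auto using Cpow_nz).
    rewrite pow_inv.
    apply Rmult_le_compat.
    + repeat apply Rmult_le_pos; try apply Cmod_ge_0; try lra. apply Rlt_le, Rinv_0_lt_compat; auto.
    + apply Rlt_le, Rinv_0_lt_compat. apply Cmod_gt_0; auto.
    + apply Rmult_le_compat_r. apply Rlt_le, Rinv_0_lt_compat; auto. apply Rmult_le_compat_r. lra. apply Hm; lra.
    + apply Rinv_le_contravar; auto. apply circ_gap; auto.
  - apply ex_ker; auto. intros; apply taylor_quot_ker_cts.
  - rewrite Rminus_0_r, Rabs_pos_eq by lra. lra.
Qed.

(** A function with vanishing Taylor coefficients is (z - p)^m times a quotient of size r^(-m), for
    every m. *)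
Lemma taylor_quot_zero_order : (forall m, taylor_quot f p r m p = 0%C) -> forall z, cdisc p r z -> f z = 0%C.
Proof.
  intros H0 z Hz.
  assert (E : forall m, f z = ((z - p) ^ m * taylor_quot f p r m z)%C).
  { induction m. rewrite taylor_quot_0; auto. simpl; ring. rewrite IHm, taylor_quot_S, H0; auto. simpl; ring. }
  destruct taylor_quot_bound as [M [HM HB]].
  assert (Hg : 0 < r - Cmod (z - p)) by (unfold cdisc in Hz; lra).
  set (q := Cmod (z - p) / r).
  assert (Hq : 0 <= q < 1). { unfold q. split. apply Rdiv_le_0_compat. apply Cmod_ge_0. lra. apply Rlt_div_l; lra. }
  set (M' := M * / (r - Cmod (z - p))). assert (HM' : 0 <= M').
  { apply Rmult_le_pos; auto. apply Rlt_le, Rinv_0_lt_compat; auto. }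
  apply Cmod_eq_0. apply Rle_antisym. 2: apply Cmod_ge_0.
  apply le_epsilon. intros eps He. rewrite Rplus_0_l.
  destruct (pow_lt_1_zero q) with (y := eps / (M' + 1)) as [N HN]. rewrite Rabs_pos_eq; lra. apply Rdiv_lt_0_compat; lra.
  specialize (HN N (le_n N)). rewrite Rabs_pos_eq in HN by (apply pow_le; lra).
  rewrite (E N), Cmod_mult, Cmod_pow.
  eapply Rle_trans. apply Rmult_le_compat_l. apply pow_le, Cmod_ge_0. apply HB; auto.
  replace (Cmod (z - p) ^ N * (M * (/ r) ^ N * / (r - Cmod (z - p)))) with (q ^ N * M').
  2: { unfold q, M', Rdiv. rewrite Rpow_mult_distr. ring. }
  apply Rlt_le in HN. apply Rle_trans with (eps / (M' + 1) * M'). apply Rmult_le_compat_r; auto.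
  replace (eps / (M' + 1) * M') with (eps * (M' / (M' + 1))) by (field; lra).
  rewrite <- (Rmult_1_r eps) at 2. apply Rmult_le_compat_l. lra. apply Rle_div_l; lra.
Qed.

Lemma taylor_quot_order m : (forall j, (j < m)%nat -> taylor_quot f p r j p = 0%C) -> forall z, cdisc p r z -> f z = ((z - p) ^ m * taylor_quot f p r m z)%C.
Proof.
  intros H0 z Hz. induction m. rewrite taylor_quot_0; auto. simpl; ring.
  rewrite IHm. 2: { intros; apply H0; lia. } rewrite taylor_quot_S, H0; auto. simpl; ring.
Qed.
End TaylorQuotients.

(** What is used of Riemann's theorem on removable singularities: the difference quotient extends
    over p. *)
Lemma holo_factor f p R : 0 < R -> holo (cdisc p R) f ->
  exists r q, 0 < r /\ holo (cdisc p r) q /\ forall z, cdisc p r z -> f z = (f p + (z - p) * q z)%C.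
Proof.
  intros HR Hf. assert (Hr : 0 < R / 2 < R) by lra. exists (R / 2), (taylor_quot f p (R / 2) 1).
  split. lra. split. eapply taylor_quot_holo; eauto. intros z Hz.
  rewrite <- (taylor_quot_0 f p R (R/2) Hr Hf z Hz), (taylor_quot_S f p R) at 1 by auto.
  rewrite (taylor_quot_0 f p R (R/2) Hr Hf p); auto. apply cdisc_center; lra.
Qed.

(** The alternative is decided by the first nonzero Taylor coefficient, if there is one. *)
Lemma holo_order f p R : 0 < R -> holo (cdisc p R) f ->
  (exists r, 0 < r /\ forall z, cdisc p r z -> f z = 0%C) \/
  (exists r m q, 0 < r /\ holo (cdisc p r) q /\ q p <> 0%C /\ forall z, cdisc p r z -> f z = ((z - p) ^ m * q z)%C).
Proof.
  intros HR Hf. assert (Hr : 0 < R / 2 < R) by lra. set (r := R / 2) in *.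
  destruct (classic (forall m, taylor_quot f p r m p = 0%C)) as [H|H].
  - left. exists r. split. lra. eapply taylor_quot_zero_order; eauto.
  - right. apply not_all_ex_not in H.
    destruct (dec_inh_nat_subset_has_unique_least_element (fun m => taylor_quot f p r m p <> 0%C)) as [m [[H1 H2] _]]; auto.
    { intros; apply classic. }
    exists r, m, (taylor_quot f p r m). split. lra. split. eapply taylor_quot_holo; eauto. split; auto.
    apply taylor_quot_order with R; auto. intros j Hj. apply NNPP. intros N. specialize (H2 j N). lia.
Qed.

(** * Meromorphic functions and the identity theorem *)

Local Notation near' p P := (locally' (T := C_UniformSpace) (p : C) P).

Definition holo_near (h : C -> C) (p : C) : Prop := exists r, 0 < r /\ holo (cdisc p r) h.

Definition mero_at (f : C -> C) (p : C) : Prop :=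
  exists (n : nat) (h : C -> C), holo_near h p /\ near' p (fun z => (z - p) ^ n * f z = h z)%C.

Definition reg_at (f : C -> C) (p : C) : Prop :=
  exists h : C -> C, holo_near h p /\ near' p (fun z => f z = h z).

Lemma holomorphic_at_iff h p : holomorphic_at h p <-> holo_near h p.
Proof.
  unfold holomorphic_at. rewrite locally_C_iff. reflexivity.
Qed.

Lemma meromorphic_iff f : meromorphic f <-> forall p, mero_at f p.
Proof.
  unfold meromorphic, mero_at. split; intros H p; destruct (H p) as [n [h [H1 H2]]]; exists n, h; split; auto;
  apply holomorphic_at_iff; auto.
Qed.

Lemma pole_iff f p : pole f p <-> ~ reg_at f p.
Proof.
  unfold pole, reg_at. split; intros H N; apply H; destruct N as [h [H1 H2]]; exists h; split; auto; apply holomorphic_at_iff; auto.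
Qed.

Lemma not_pole_iff f p : ~ pole f p <-> reg_at f p.
Proof. rewrite pole_iff. split; [apply NNPP | tauto]. Qed.

Lemma near'_and (p : C) (P Q : C -> Prop) : near' p P -> near' p Q -> near' p (fun z => P z /\ Q z).
Proof. apply (filter_and (F := locally' (T := C_UniformSpace) p)). Qed.

Lemma near'_imp (p : C) (P Q : C -> Prop) : (forall z, P z -> Q z) -> near' p P -> near' p Q.
Proof. apply (filter_imp (F := locally' (T := C_UniformSpace) p)). Qed.

Lemma near'_all (p : C) (P : C -> Prop) : (forall z, P z) -> near' p P.
Proof. intros H. apply locally'_C_iff. exists 1; split; auto. lra. Qed.

Lemma near'_neq (p : C) : near' p (fun z => z <> p).
Proof. apply locally'_C_iff. exists 1; split; auto. lra. Qed.

Lemma near'_neq_any (p q : C) : near' p (fun z => z <> q).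
Proof.
  destruct (classic (p = q)) as [->|N]. apply near'_neq.
  apply locally'_C_iff. exists (Cmod (q - p)). split.
  - apply Cmod_gt_0. intros E. apply N. replace q with (p + (q - p))%C by ring. rewrite E. ring.
  - intros w Hw _ ->. lra.
Qed.

Lemma near'_disc (p : C) r : 0 < r -> near' p (cdisc p r).
Proof. intros Hr. apply locally'_C_iff. exists r; split; auto. Qed.

Lemma near'_shift (p a : C) (P : C -> Prop) : near' (p + a)%C P -> near' p (fun z => P (z + a)%C).
Proof.
  rewrite !locally'_C_iff. intros [d [Hd H]]. exists d; split; auto. intros w Hw Hn. apply H.
  replace (w + a - (p + a))%C with (w - p)%C by ring. auto.
  intros E. apply Hn. replace w with (w + a - a)%C by ring. rewrite E. ring.
Qed.

Lemma near'_exists (p : C) (P : C -> Prop) : near' p P -> exists z, P z.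
Proof.
  rewrite locally'_C_iff. intros [d [Hd H]]. exists (p + RtoC (d / 2))%C. apply H.
  replace (p + RtoC (d / 2) - p)%C with (RtoC (d / 2)) by ring. rewrite Cmod_R, Rabs_pos_eq; lra.
  intros E. assert (E2 : RtoC (d / 2) = 0%C). { replace (RtoC (d / 2)) with (p + RtoC (d / 2) - p)%C by ring. rewrite E. ring. }
  injection E2. lra.
Qed.

(** Around a nearby point other than p there is a full neighbourhood that avoids p. *)
Lemma near'_near (p : C) (P : C -> Prop) : near' p P -> near' p (fun z => locally (T := C_UniformSpace) z P).
Proof.
  rewrite !locally'_C_iff. intros [d [Hd H]]. exists d; split; auto. intros w Hw Hn.
  assert (Hpos : 0 < Cmod (w - p)). { apply Cmod_gt_0. intros E. apply Hn. replace w with (p + (w - p))%C by ring. rewrite E; ring. }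
  apply locally_C_iff. exists (Rmin (d - Cmod (w - p)) (Cmod (w - p))). split. apply Rmin_pos; lra.
  intros q Hq. destruct (Rmin_Rgt_l _ _ _ Hq) as [Q1 Q2].
  apply H.
  - replace (q - p)%C with ((q - w) + (w - p))%C by ring. cmod_tri_lt. lra.
  - intros ->. rewrite Cmod_sub_sym in Q2. lra.
Qed.

Lemma near_near' (p : C) (P : C -> Prop) : locally (T := C_UniformSpace) p P -> near' p P.
Proof. rewrite locally_C_iff, locally'_C_iff. intros [d [Hd H]]. exists d; split; auto. Qed.

Lemma cts_near'_eq (f g : C -> C) p : ctsC f p -> ctsC g p -> near' p (fun z => f z = g z) -> f p = g p.
Proof.
  intros Hf Hg H. apply NNPP. intros N.
  assert (Hpos : 0 < Cmod (f p - g p)). { apply Cmod_gt_0. intros E. apply N. replace (f p) with (g p + (f p - g p))%C by ring. rewrite E; ring. }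
  destruct (proj1 (continuous_CC_iff f p) Hf (Cmod (f p - g p) / 2)) as [d1 [Hd1 K1]]. lra.
  destruct (proj1 (continuous_CC_iff g p) Hg (Cmod (f p - g p) / 2)) as [d2 [Hd2 K2]]. lra.
  destruct (near'_exists p _ (near'_and _ _ _ H (near'_and _ _ _ (near'_disc p d1 Hd1) (near'_disc p d2 Hd2)))) as [z [E [Z1 Z2]]].
  specialize (K1 z Z1). specialize (K2 z Z2).
  assert (Cmod (f p - g p) <= Cmod (f z - f p) + Cmod (g z - g p)).
  { replace (f p - g p)%C with (- (f z - f p) + (g z - g p))%C by (rewrite E; ring).
    cmod_tri. rewrite Cmod_opp. lra. }
  lra.
Qed.

Lemma holo_sub (D D' : C -> Prop) f : (forall z, D' z -> D z) -> holo D f -> holo D' f.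
Proof. intros H Hf z Hz. apply Hf; auto. Qed.

Lemma holo_plus D f g : holo D f -> holo D g -> holo D (fun z => f z + g z)%C.
Proof. intros Hf Hg z Hz. destruct (Hf z Hz), (Hg z Hz). eexists; apply cder_plus; eauto. Qed.

Lemma holo_mult D f g : holo D f -> holo D g -> holo D (fun z => f z * g z)%C.
Proof. intros Hf Hg z Hz. destruct (Hf z Hz), (Hg z Hz). eexists; apply cder_mult; eauto. Qed.

Lemma holo_const D c : holo D (fun _ => c).
Proof. intros z Hz. eexists; apply cder_const. Qed.

Lemma holo_pow_sub D p n : holo D (fun z => (z - p) ^ n)%C.
Proof. intros z Hz. eexists. apply cder_pow, cder_minus. apply cder_id. apply cder_const. Qed.

Lemma cder_translate (f : C -> C) a z l : cder f (z + a)%C l -> cder (fun w => f (w + a)%C) z l.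
Proof.
  intros H. eapply cder_eq. apply (cder_comp f (fun w => w + a)%C). exact H. apply cder_plus. apply cder_id. apply cder_const. ring.
Qed.

Lemma holo_near_ex (f g : C -> C) p : holo_near f p -> holo_near g p ->
  exists r, 0 < r /\ holo (cdisc p r) f /\ holo (cdisc p r) g.
Proof.
  intros [r1 [H1 K1]] [r2 [H2 K2]]. exists (Rmin r1 r2). split. apply Rmin_pos; auto. split.
  eapply holo_sub; [|exact K1]. intros z. apply cdisc_le, Rmin_l.
  eapply holo_sub; [|exact K2]. intros z. apply cdisc_le, Rmin_r.
Qed.

Lemma mero_at_ext f g p : near' p (fun z => f z = g z) -> mero_at f p -> mero_at g p.
Proof.
  intros H [n [h [H1 H2]]]. exists n, h; split; auto.
  generalize (near'_and _ _ _ H H2). apply near'_imp. intros z [<- E]; auto.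
Qed.

Lemma reg_mero f p : reg_at f p -> mero_at f p.
Proof. intros [h [H1 H2]]. exists 0%nat, h; split; auto. eapply near'_imp; [|exact H2]. intros z <-. simpl. ring. Qed.

Lemma holo_reg f p r : 0 < r -> holo (cdisc p r) f -> reg_at f p.
Proof. intros Hr Hf. exists f. split. exists r; auto. apply near'_all; auto. Qed.

Lemma mero_at_const c p : mero_at (fun _ => c) p.
Proof. apply reg_mero, holo_reg with 1. lra. apply holo_const. Qed.

Lemma mero_at_plus f g p : mero_at f p -> mero_at g p -> mero_at (fun z => f z + g z)%C p.
Proof.
  intros [n [h [H1 H2]]] [m [k [K1 K2]]].
  exists (n + m)%nat, (fun z => (z - p) ^ m * h z + (z - p) ^ n * k z)%C. split.
  - destruct (holo_near_ex _ _ _ H1 K1) as [r [Hr [A B]]]. exists r; split; auto.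
    apply holo_plus; apply holo_mult; auto; apply holo_pow_sub.
  - generalize (near'_and _ _ _ H2 K2). apply near'_imp. intros z [<- <-]. rewrite Cpow_add_r. ring.
Qed.

Lemma mero_at_scal c f p : mero_at f p -> mero_at (fun z => c * f z)%C p.
Proof.
  intros [n [h [[r [Hr H1]] H2]]]. exists n, (fun z => c * h z)%C. split.
  exists r; split; auto. apply holo_mult; auto. apply holo_const.
  eapply near'_imp; [|exact H2]. intros z <-. ring.
Qed.

Lemma holo_translate_disc h p a r : holo (cdisc (p + a)%C r) h -> holo (cdisc p r) (fun z => h (z + a)%C).
Proof.
  intros H z Hz. destruct (H (z + a)%C) as [l Hl]. unfold cdisc in *. replace (z + a - (p + a))%C with (z - p)%C by ring; auto.
  exists l. apply cder_translate; auto.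
Qed.

Lemma mero_at_translate f p a : mero_at f (p + a)%C -> mero_at (fun z => f (z + a)%C) p.
Proof.
  intros [n [h [[r [Hr H1]] H2]]]. exists n, (fun z => h (z + a)%C). split.
  exists r; split; auto. apply holo_translate_disc; auto.
  apply near'_shift in H2. eapply near'_imp; [|exact H2]. intros z <-. f_equal. f_equal. ring.
Qed.

Lemma sub_neq_0 z p : z <> p -> (z - p)%C <> 0%C.
Proof. intros N E. apply N. replace z with (p + (z - p))%C by ring. rewrite E. ring. Qed.

Lemma mero_at_quot f p n h : near' p (fun z => (z - p) ^ n * f z = h z)%C -> near' p (fun z => f z = h z * / (z - p) ^ n)%C.
Proof.
  intros H. generalize (near'_and _ _ _ H (near'_neq p)). apply near'_imp. intros z [<- N]. field. apply Cpow_nz, sub_neq_0, N.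
Qed.

Lemma mero_at_punct f p : mero_at f p -> near' p (fun z => exists l, cder f z l).
Proof.
  intros [n [h [[r [Hr H1]] H2]]]. apply mero_at_quot, near'_near in H2.
  generalize (near'_and _ _ _ H2 (near'_and _ _ _ (near'_neq p) (near'_disc p r Hr))). apply near'_imp.
  intros z [E [N D]]. destruct (H1 z D) as [l Hl]. eexists. apply cder_ext_loc with (fun z => h z * / (z - p) ^ n)%C.
  - eapply filter_imp; [|exact E]. intros w Hw; auto.
  - apply cder_mult. exact Hl. apply (cder_comp Cinv (fun z => (z - p) ^ n)%C). apply cder_inv. apply Cpow_nz, sub_neq_0, N.
    apply cder_pow, cder_minus. apply cder_id. apply cder_const.
Qed.

Lemma cder_near_reg f p : locally (T := C_UniformSpace) p (fun z => exists l, cder f z l) -> reg_at f p.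
Proof. rewrite locally_C_iff. intros [r [Hr H]]. apply holo_reg with r; auto. Qed.

(** From [holo_order], after clearing the pole. *)
Lemma mero_dichotomy f p : mero_at f p -> near' p (fun z => f z = 0%C) \/ near' p (fun z => f z <> 0%C).
Proof.
  intros [n [h [[r [Hr H1]] H2]]].
  destruct (holo_order h p r Hr H1) as [[r' [Hr' H0]]|[r' [m [q [Hr' [Hq [Hqp Hh]]]]]]].
  - left. apply mero_at_quot in H2. generalize (near'_and _ _ _ H2 (near'_disc p r' Hr')). apply near'_imp.
    intros z [-> D]. rewrite H0; auto. ring.
  - right.
    assert (Cq : ctsC q p) by (eapply holo_cts; eauto; apply cdisc_center; auto).
    destruct (cts_neq_0 q p Cq Hqp) as [d [Hd K]].
    generalize (near'_and _ _ _ H2 (near'_and _ _ _ (near'_neq p) (near'_and _ _ _ (near'_disc p r' Hr') (near'_disc p d Hd)))).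
    apply near'_imp. intros z [E [N [D1 D2]]] F0. rewrite F0, Hh, Cmult_0_r in E; auto.
    specialize (K z D2). symmetry in E. apply Cmult_neq_0 in E; auto. apply Cpow_nz, sub_neq_0, N.
Qed.

(** The points near which f vanishes form an open and closed set, by [mero_dichotomy]; along a
    segment [cousin] applies. *)
Lemma mero_identity f p0 : (forall p, mero_at f p) -> near' p0 (fun z => f z = 0%C) -> forall p, near' p (fun z => f z = 0%C).
Proof.
  intros Hf H0 p. set (A := fun q => near' q (fun z => f z = 0%C)).
  assert (Hloc : forall q, locally (T := C_UniformSpace) q (fun w => A w <-> A q)).
  { intros q. destruct (mero_dichotomy f q (Hf q)) as [H|H].
    - assert (Aq : A q) by exact H. apply near'_near in H. apply locally'_C_iff in H. destruct H as [d [Hd H]].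
      apply locally_C_iff. exists d; split; auto. intros w Hw. split; auto. intros _.
      destruct (classic (w = q)) as [->|N]; auto. apply near_near'. apply H; auto.
    - assert (Nq : forall w, locally (T := C_UniformSpace) w (fun z => f z <> 0%C) \/ near' w (fun z => f z <> 0%C) -> ~ A w).
      { intros w Hw Aw. assert (Hw' : near' w (fun z => f z <> 0%C)) by (destruct Hw; auto; apply near_near'; auto).
        destruct (near'_exists _ _ (near'_and _ _ _ Hw' Aw)) as [z [Z1 Z2]]; auto. }
      generalize (near'_near _ _ H). intros H'. apply locally'_C_iff in H'. destruct H' as [d [Hd H']].
      apply locally_C_iff. exists d; split; auto. intros w Hw.
      assert (N1 : ~ A q) by (apply Nq; auto). assert (N2 : ~ A w).
      { destruct (classic (w = q)) as [->|N]; auto. } tauto. }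
  assert (X : A (seg p0 p 0) <-> A (seg p0 p 1)).
  { apply (cousin (fun u v => A (seg p0 p u) <-> A (seg p0 p v)) 0 1). lra. intros; tauto.
    intros t _. specialize (Hloc (seg p0 p t)).
    assert (Cs : ctsR (seg p0 p) t) by (eapply cts_rder, rder_seg).
    apply Cs in Hloc. destruct Hloc as [d Hloc]. exists d; split. apply cond_pos.
    intros u v Hu Hv _ _. assert (A1 := Hloc u). assert (A2 := Hloc v).
    rewrite A1, A2. tauto.
    change (Rabs (v - t) < d). apply Rabs_def1; lra. change (Rabs (u - t) < d). apply Rabs_def1; lra. }
  rewrite seg_0, seg_1 in X. apply X. exact H0.
Qed.

Lemma mero_eq_sym f g : mero_eq f g -> mero_eq g f.
Proof. intros H p. eapply near'_imp; [|exact (H p)]. auto. Qed.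

Lemma mero_eq_trans f g h : mero_eq f g -> mero_eq g h -> mero_eq f h.
Proof. intros H K p. generalize (near'_and _ _ _ (H p) (K p)). apply near'_imp. intros z [-> ->]; auto. Qed.

Lemma mero_eq_ext f g : (forall z, f z = g z) -> mero_eq f g.
Proof. intros H p. apply near'_all; auto. Qed.

Lemma meromorphic_ext f g : mero_eq f g -> meromorphic f -> meromorphic g.
Proof. rewrite !meromorphic_iff. intros H Hf p. apply mero_at_ext with f; auto. Qed.

Lemma meromorphic_plus f g : meromorphic f -> meromorphic g -> meromorphic (fun z => f z + g z)%C.
Proof. rewrite !meromorphic_iff. intros Hf Hg p. apply mero_at_plus; auto. Qed.

Lemma meromorphic_scal c f : meromorphic f -> meromorphic (fun z => c * f z)%C.
Proof. rewrite !meromorphic_iff. intros Hf p. apply mero_at_scal; auto. Qed.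

Lemma meromorphic_minus f g : meromorphic f -> meromorphic g -> meromorphic (fun z => f z - g z)%C.
Proof.
  intros Hf Hg. apply meromorphic_ext with (fun z => f z + (- (1)) * g z)%C. apply mero_eq_ext. intros; ring.
  apply meromorphic_plus; auto. apply meromorphic_scal; auto.
Qed.

Theorem identity_theorem f g p0 r : 0 < r -> meromorphic f -> meromorphic g -> (forall z, cdisc p0 r z -> f z = g z) -> mero_eq f g.
Proof.
  intros Hr Hf Hg H p.
  assert (K := mero_identity (fun z => f z - g z)%C p0).
  eapply near'_imp; [|apply K].
  - intros z E. replace (f z) with (g z + (f z - g z))%C by ring. rewrite E. ring.
  - apply meromorphic_iff, meromorphic_minus; auto.
  - eapply near'_imp; [|apply near'_disc; exact Hr]. intros z Hz. rewrite H; auto. ring.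
Qed.

Local Notation em := excluded_middle_informative.

Lemma iter_S (A : Type) (f : A -> A) n x : Nat.iter (S n) f x = Nat.iter n f (f x).
Proof. induction n. reflexivity. simpl in *. f_equal. exact IHn. Qed.

(** * Functions with poles in the lattice *)

Section Lattice.
Variable tau : C.
Hypothesis Htau : 0 < Im tau.
Notation Lam := (lattice tau).

Lemma lattice_re_im p : Lam p <-> exists m n : Z, Re p = IZR m + IZR n * Re tau /\ Im p = IZR n * Im tau.
Proof.
  split; intros [m [n H]]; exists m, n.
  - rewrite H. rewrite Re_plus, Im_plus, re_scal_l, im_scal_l, Re_RtoC, Im_RtoC. split; ring.
  - destruct H as [H1 H2]. apply C_eq; rewrite ?Re_plus, ?Im_plus, ?re_scal_l, ?im_scal_l, ?Re_RtoC, ?Im_RtoC, ?H1, ?H2; ring.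
Qed.

Lemma lattice_shift p (m n : Z) : Lam p <-> Lam (p + (RtoC (IZR m) + RtoC (IZR n) * tau))%C.
Proof.
  split; intros [m' [n' H]].
  - exists (m' + m)%Z, (n' + n)%Z. rewrite H, !plus_IZR, !RtoC_plus. ring.
  - exists (m' - m)%Z, (n' - n)%Z. rewrite !minus_IZR, !RtoC_minus.
    replace p with (p + (RtoC (IZR m) + RtoC (IZR n) * tau) - (RtoC (IZR m) + RtoC (IZR n) * tau))%C by ring. rewrite H. ring.
Qed.

Lemma lattice_1 p : Lam p <-> Lam (p + 1)%C.
Proof. rewrite (lattice_shift p 1 0). replace (p + (RtoC (IZR 1) + RtoC (IZR 0) * tau))%C with (p + 1)%C by ring. tauto. Qed.

Lemma lattice_tau p : Lam p <-> Lam (p + tau)%C.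
Proof. rewrite (lattice_shift p 0 1). replace (p + (RtoC (IZR 0) + RtoC (IZR 1) * tau))%C with (p + tau)%C by ring. tauto. Qed.

Lemma lattice_ntau p (n : Z) : Lam p <-> Lam (p + RtoC (IZR n) * tau)%C.
Proof. rewrite (lattice_shift p 0 n). replace (p + (RtoC (IZR 0) + RtoC (IZR n) * tau))%C with (p + RtoC (IZR n) * tau)%C by ring. tauto. Qed.

Lemma lattice_band p : Lam p -> - Im tau < Im p < Im tau -> exists m : Z, p = RtoC (IZR m).
Proof.
  intros H Hb. apply lattice_re_im in H. destruct H as [m [n [H1 H2]]]. exists m. rewrite H2 in Hb.
  assert (n = 0)%Z. {
    assert (-1 < n)%Z. { apply lt_IZR. apply Rmult_lt_reg_r with (Im tau); auto. lra. }
    assert (n < 1)%Z. { apply lt_IZR. apply Rmult_lt_reg_r with (Im tau); auto. lra. } lia. }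
  subst n. apply C_eq; rewrite ?Re_RtoC, ?Im_RtoC, ?H1, ?H2; ring.
Qed.

(** The strip that carries all contours below is free of poles. *)
Lemma lattice_strip p : 0 < Im p < Im tau -> ~ Lam p.
Proof. intros H L. destruct (lattice_band p L) as [m E]. lra. rewrite E, Im_RtoC in H. lra. Qed.

Lemma lattice_sep p q : Lam p -> Lam q -> Cmod (p - q) < Rmin 1 (Im tau) -> p = q.
Proof.
  intros Hp Hq H. destruct (Rmin_Rgt_l _ _ _ H) as [H1 H2].
  assert (L : Lam (p - q)%C).
  { destruct Hp as [m [n ->]], Hq as [m' [n' ->]]. exists (m - m')%Z, (n - n')%Z. rewrite !minus_IZR, !RtoC_minus. ring. }
  destruct (lattice_band _ L) as [m E].
  { assert (K := im_le_Cmod (p - q)). assert (K2 := Rle_lt_trans _ _ _ K H2). apply Rabs_def2 in K2. lra. }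
  rewrite E, Cmod_R, <- abs_IZR in H1. apply lt_IZR in H1. assert (m = 0)%Z by lia. subst m.
  replace p with (q + (p - q))%C by ring. rewrite E. ring.
Qed.

Lemma lattice_discrete p : near' p (fun z => ~ Lam z).
Proof.
  assert (Hm : 0 < Rmin 1 (Im tau)) by (apply Rmin_pos; lra).
  destruct (classic (exists q, Lam q /\ q <> p /\ Cmod (q - p) < Rmin 1 (Im tau) / 2)) as [[q [Lq [Nq Dq]]]|N].
  - generalize (near'_and _ _ _ (near'_neq_any p q) (near'_disc p (Rmin 1 (Im tau) / 2) ltac:(lra))).
    apply near'_imp. intros z [Zq Dz] Lz. apply Zq. apply lattice_sep; auto. unfold cdisc in Dz.
    replace (z - q)%C with ((z - p) + - (q - p))%C by ring. cmod_tri_lt. rewrite Cmod_opp. lra.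
  - generalize (near'_and _ _ _ (near'_neq p) (near'_disc p (Rmin 1 (Im tau) / 2) ltac:(lra))).
    apply near'_imp. intros z [Zp Dz] Lz. apply N. exists z. auto.
Qed.

Lemma lattice_locally p : ~ Lam p -> locally (T := C_UniformSpace) p (fun z => ~ Lam z).
Proof.
  intros Hp. generalize (lattice_discrete p). intros K. apply locally'_C_iff in K. destruct K as [d [Hd K]].
  apply locally_C_iff. exists d; split; auto. intros w Hw. destruct (classic (w = p)) as [->|N]; auto.
Qed.

(** Representatives for which equality of meromorphic functions becomes pointwise equality: the
    removable singularities are removed, and the value on the lattice is 0, poles or not, which is
    stable under translation by the lattice, sums and derivatives. *)
Record normalized (f : C -> C) : Prop := {
  normalized_diff : forall z, ~ Lam z -> exists l, cder f z l;
  normalized_zero : forall z, Lam z -> f z = 0%C;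
  normalized_per : forall z, f (z + 1)%C = f z;
  normalized_mero : forall p, Lam p -> mero_at f p }.

Lemma normalized_cts f z : normalized f -> ~ Lam z -> ctsC f z.
Proof. intros Hf Hz. destruct (normalized_diff f Hf z Hz). eapply cder_cts; eauto. Qed.

Lemma normalized_reg f p : normalized f -> ~ Lam p -> reg_at f p.
Proof.
  intros Hf Hp. apply cder_near_reg. eapply filter_imp; [|apply lattice_locally; exact Hp]. intros z Hz. apply normalized_diff; auto.
Qed.

Lemma normalized_meromorphic f : normalized f -> meromorphic f.
Proof.
  intros Hf. apply meromorphic_iff. intros p. destruct (classic (Lam p)). apply normalized_mero; auto. apply reg_mero, normalized_reg; auto.
Qed.

Lemma normalized_poles f p : normalized f -> pole f p -> Lam p.
Proof. intros Hf Hp. apply NNPP. intros N. apply pole_iff in Hp. apply Hp, normalized_reg; auto. Qed.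

Lemma normalized_eq f g : normalized f -> normalized g -> mero_eq f g -> forall z, f z = g z.
Proof.
  intros Hf Hg H z. destruct (classic (Lam z)) as [L|L]. rewrite (normalized_zero f Hf z L), (normalized_zero g Hg z L); auto.
  apply cts_near'_eq. apply normalized_cts; auto. apply normalized_cts; auto. apply H.
Qed.

(** SK without the difference equation. *)
Definition qmero (f : C -> C) : Prop := meromorphic f /\ one_periodic f /\ forall p, pole f p -> Lam p.

Lemma normalized_qmero f : normalized f -> qmero f.
Proof.
  intros Hf. split. apply normalized_meromorphic; auto. split. apply mero_eq_ext, normalized_per; auto. intros p. apply normalized_poles; auto.
Qed.

Definition reg_val (f : C -> C) (p v : C) : Prop :=
  exists h : C -> C, holo_near h p /\ near' p (fun z => f z = h z) /\ v = h p.

Lemma reg_val_unique f p v w : reg_val f p v -> reg_val f p w -> v = w.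
Proof.
  intros [h [[r [Hr H1]] [H2 ->]]] [k [[s [Hs K1]] [K2 ->]]]. apply cts_near'_eq.
  eapply holo_cts; eauto. apply cdisc_center; auto. eapply holo_cts; eauto. apply cdisc_center; auto.
  generalize (near'_and _ _ _ H2 K2). apply near'_imp. intros z [<- <-]; auto.
Qed.

Definition normalize (f : C -> C) (p : C) : C :=
  if em (Lam p) then 0%C else epsilon (inhabits (RtoC 0)) (reg_val f p).

Lemma normalize_val f p v : ~ Lam p -> reg_val f p v -> normalize f p = v.
Proof.
  intros Hp Hv. unfold normalize. destruct (em (Lam p)); [tauto|].
  apply reg_val_unique with f p; auto. apply epsilon_spec. exists v; auto.
Qed.

Lemma normalize_holo f p : ~ Lam p -> locally (T := C_UniformSpace) p (fun z => exists l, cder f z l) -> normalize f p = f p.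
Proof.
  intros Hp H. apply normalize_val; auto. apply locally_C_iff in H. exists f. split; auto. split; auto. apply near'_all; auto.
Qed.

Lemma normalize_eq f : meromorphic f -> mero_eq (normalize f) f.
Proof.
  rewrite meromorphic_iff. intros Hf p. generalize (near'_and _ _ _ (lattice_discrete p) (near'_near _ _ (mero_at_punct f p (Hf p)))).
  apply near'_imp. intros z [N H]. apply normalize_holo; auto.
Qed.

Lemma normalize_diff f p : meromorphic f -> ~ Lam p -> reg_at f p -> exists l, cder (normalize f) p l.
Proof.
  intros Hm Hp [h [[r [Hr H1]] H2]].
  destruct (H1 p (cdisc_center p r Hr)) as [l Hl]. exists l. apply cder_ext_loc with h; auto.
  assert (K := near'_and _ _ _ (normalize_eq f Hm p) H2). apply locally'_C_iff in K. destruct K as [d [Hd K]].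
  apply locally_C_iff. exists d; split; auto. intros w Hw. destruct (classic (w = p)) as [->|N].
  - symmetry. apply normalize_val; auto. exists h. split; [exists r|]; auto.
  - destruct (K w Hw N) as [-> ->]; auto.
Qed.

Lemma mero_eq_shift f g a : mero_eq f g -> mero_eq (fun z => f (z + a)%C) (fun z => g (z + a)%C).
Proof. intros H p. apply (near'_shift p a (fun z => f z = g z)). apply H. Qed.

Lemma normalize_normalized f : qmero f -> normalized (normalize f).
Proof.
  intros [Hm [Hp Hpole]].
  assert (D : forall z, ~ Lam z -> exists l, cder (normalize f) z l).
  { intros z Hz. apply normalize_diff; auto. apply not_pole_iff. intros P. apply Hz, Hpole, P. }
  split; auto.
  - intros z Hz. unfold normalize. destruct (em (Lam z)); tauto.
  - intros z. destruct (classic (Lam z)) as [L|L].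
    + unfold normalize. assert (L1 : Lam (z + 1)%C) by (apply lattice_1 in L; auto).
      destruct (em (Lam z)); [|tauto]. destruct (em (Lam (z + 1)%C)); [|tauto]. auto.
    + assert (L1 : ~ Lam (z + 1)%C) by (rewrite <- lattice_1; auto).
      apply (cts_near'_eq (fun z => normalize f (z + 1)%C) (normalize f)).
      * destruct (D _ L1) as [l Hl]. eapply cder_cts. apply cder_translate; eauto.
      * destruct (D _ L) as [l Hl]. eapply cder_cts; eauto.
      * assert (K := near'_and _ _ _ (mero_eq_shift _ _ 1%C (normalize_eq f Hm) z) (near'_and _ _ _ (Hp z) (normalize_eq f Hm z))).
        eapply near'_imp; [|exact K]. cbv beta. intros w [E1 [E2 E3]]. rewrite E1, E2, E3; auto.
  - intros p _. apply mero_at_ext with f. 2: apply meromorphic_iff; auto. apply mero_eq_sym, normalize_eq; auto.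
Qed.

Lemma normalized_ext f g : (forall z, f z = g z) -> normalized f -> normalized g.
Proof. intros H Hf. replace g with f; auto. apply functional_extensionality; auto. Qed.

Lemma normalized_0 : normalized (fun _ => 0%C).
Proof. split; auto. intros; eexists; apply cder_const. intros; apply mero_at_const. Qed.

Lemma normalized_plus f g : normalized f -> normalized g -> normalized (fun z => f z + g z)%C.
Proof.
  intros Hf Hg. split.
  - intros z Hz. destruct (normalized_diff f Hf z Hz), (normalized_diff g Hg z Hz). eexists; apply cder_plus; eauto.
  - intros z Hz. rewrite (normalized_zero f Hf z Hz), (normalized_zero g Hg z Hz). ring.
  - intros z. rewrite (normalized_per f Hf), (normalized_per g Hg). auto.
  - intros p Hp. apply mero_at_plus; apply normalized_mero; auto.
Qed.

Lemma normalized_scal c f : normalized f -> normalized (fun z => c * f z)%C.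
Proof.
  intros Hf. split.
  - intros z Hz. destruct (normalized_diff f Hf z Hz). eexists; apply cder_scal; eauto.
  - intros z Hz. rewrite (normalized_zero f Hf z Hz). ring.
  - intros z. rewrite (normalized_per f Hf). auto.
  - intros p Hp. apply mero_at_scal; apply normalized_mero; auto.
Qed.

Lemma normalized_minus f g : normalized f -> normalized g -> normalized (fun z => f z - g z)%C.
Proof.
  intros Hf Hg. apply normalized_ext with (fun z => f z + (- (1)) * g z)%C. intros; ring. apply normalized_plus; auto. apply normalized_scal; auto.
Qed.

Lemma normalized_translate f (n : Z) : normalized f -> normalized (fun z => f (z + RtoC (IZR n) * tau)%C).
Proof.
  intros Hf. split.
  - intros z Hz. rewrite (lattice_ntau z n) in Hz. destruct (normalized_diff f Hf _ Hz). eexists; apply cder_translate; eauto.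
  - intros z Hz. apply normalized_zero; auto. apply lattice_ntau; auto.
  - intros z. rewrite <- (normalized_per f Hf (z + _)%C). f_equal. ring.
  - intros p Hp. apply (mero_at_translate f). apply normalized_mero; auto. apply lattice_ntau; auto.
Qed.

Lemma normalized_tau f : normalized f -> normalized (fun z => f (z + tau)%C).
Proof. intros Hf. apply normalized_ext with (fun z => f (z + RtoC (IZR 1) * tau)%C). intros; f_equal; ring. apply normalized_translate; auto. Qed.

Lemma normalized_Delta f : normalized f -> normalized (Defs.Delta tau f).
Proof. intros Hf. apply normalized_minus; auto. apply normalized_tau; auto. Qed.

Lemma normalized_iter_Delta f k : normalized f -> normalized (Nat.iter k (Defs.Delta tau) f).
Proof. intros Hf. induction k; simpl; auto. apply normalized_Delta; auto. Qed.

Lemma mero_eq_Delta f g : mero_eq f g -> mero_eq (Defs.Delta tau f) (Defs.Delta tau g).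
Proof.
  intros H p. generalize (near'_and _ _ _ (H p) (mero_eq_shift _ _ tau H p)). apply near'_imp. cbv beta. unfold Defs.Delta. intros z [-> ->]; auto.
Qed.

Lemma mero_eq_iter_Delta f g k : mero_eq f g -> mero_eq (Nat.iter k (Defs.Delta tau) f) (Nat.iter k (Defs.Delta tau) g).
Proof. intros H. induction k; simpl; auto. apply mero_eq_Delta; auto. Qed.

Definition normalized_SK (k : nat) (f : C -> C) : Prop := normalized f /\ forall z, Nat.iter k (Defs.Delta tau) f z = 0%C.

Lemma SK_normalize k f : SK tau k f -> normalized_SK k (normalize f) /\ mero_eq (normalize f) f.
Proof.
  intros [H1 [H2 [H3 H4]]]. assert (Hq : qmero f) by (split; auto). assert (HL := normalize_normalized f Hq). assert (HE := normalize_eq f H1).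
  split; auto. split; auto. intros z.
  apply (normalized_eq (Nat.iter k (Defs.Delta tau) (normalize f)) (fun _ => 0%C)). apply normalized_iter_Delta; auto. apply normalized_0.
  eapply mero_eq_trans; [|exact H4]. apply mero_eq_iter_Delta; auto.
Qed.

Lemma normalized_SK_SK k f : normalized_SK k f -> SK tau k f.
Proof.
  intros [H1 H2]. destruct (normalized_qmero f H1) as [A [B D]]. split; auto. split; auto. split; auto. apply mero_eq_ext; auto.
Qed.

Lemma iter_Delta_plus k f g z : Nat.iter k (Defs.Delta tau) (fun z => f z + g z)%C z = (Nat.iter k (Defs.Delta tau) f z + Nat.iter k (Defs.Delta tau) g z)%C.
Proof. revert z. induction k; simpl; intros z; auto. unfold Defs.Delta at 1. rewrite !IHk. unfold Defs.Delta. ring. Qed.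

Lemma iter_Delta_scal k c f z : Nat.iter k (Defs.Delta tau) (fun z => c * f z)%C z = (c * Nat.iter k (Defs.Delta tau) f z)%C.
Proof. revert z. induction k; simpl; intros z; auto. unfold Defs.Delta at 1. rewrite !IHk. unfold Defs.Delta. ring. Qed.

Lemma iter_Delta_0 k z : Nat.iter k (Defs.Delta tau) (fun _ => 0%C) z = 0%C.
Proof. revert z. induction k; simpl; intros z; auto. unfold Defs.Delta. rewrite !IHk. ring. Qed.

Lemma iter_Delta_le j k f : (j <= k)%nat -> (forall z, Nat.iter j (Defs.Delta tau) f z = 0%C) -> forall z, Nat.iter k (Defs.Delta tau) f z = 0%C.
Proof. intros H H0. induction H; auto. intros z. simpl. unfold Defs.Delta. rewrite !IHle. ring. Qed.

Lemma normalized_SK_plus k f g : normalized_SK k f -> normalized_SK k g -> normalized_SK k (fun z => f z + g z)%C.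
Proof. intros [A B] [A' B']. split. apply normalized_plus; auto. intros z. rewrite iter_Delta_plus, B, B'. ring. Qed.

Lemma normalized_SK_scal k c f : normalized_SK k f -> normalized_SK k (fun z => c * f z)%C.
Proof. intros [A B]. split. apply normalized_scal; auto. intros z. rewrite iter_Delta_scal, B. ring. Qed.

Lemma normalized_SK_le j k f : (j <= k)%nat -> normalized_SK j f -> normalized_SK k f.
Proof. intros H [A B]. split; auto. eapply iter_Delta_le; eauto. Qed.

Lemma normalized_SK_0 k : normalized_SK k (fun _ => 0%C).
Proof. split. apply normalized_0. apply iter_Delta_0. Qed.

(** The derivative, normalized in the same way as the function. *)
Definition lat_derive (f : C -> C) (z : C) : C := if em (Lam z) then 0%C else C_derive f z.

Lemma lat_derive_cder f z : normalized f -> ~ Lam z -> cder f z (lat_derive f z).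
Proof.
  intros Hf Hz. unfold lat_derive. destruct (em (Lam z)); [tauto|].
  destruct (normalized_diff f Hf z Hz). eapply cder_C_derive; eauto.
Qed.

Lemma lat_derive_val f z l : ~ Lam z -> cder f z l -> lat_derive f z = l.
Proof. intros Hz H. unfold lat_derive. destruct (em (Lam z)); [tauto|]. apply is_C_derive_unique, H. Qed.

Lemma lat_derive_zero f z : Lam z -> lat_derive f z = 0%C.
Proof. intros Hz. unfold lat_derive. destruct (em (Lam z)); tauto. Qed.

(** At a lattice point, (z - p)^n f = h gives (z - p)^(n+1) f' = (z - p) h' - n h. *)
Lemma normalized_lat_derive f : normalized f -> normalized (lat_derive f).
Proof.
  intros Hf. split.
  - intros z Hz. assert (K := lattice_locally z Hz). assert (K' := K). apply locally_C_iff in K. destruct K as [r [Hr K]].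
    destruct (holo_derive z r f) with z as [l Hl].
    + intros w Hw. apply normalized_diff; auto.
    + apply cdisc_center; auto.
    + exists l. apply cder_ext_loc with (C_derive f); auto. eapply filter_imp; [|exact K'].
      intros w Hw. unfold lat_derive. destruct (em (Lam w)); [elim Hw; assumption|auto].
  - intros; apply lat_derive_zero; auto.
  - intros z. destruct (classic (Lam z)) as [L|L]. rewrite !lat_derive_zero; auto. apply lattice_1 in L; auto.
    assert (L1 : ~ Lam (z + 1)%C) by (rewrite <- lattice_1; auto).
    symmetry. apply lat_derive_val; auto.
    replace f with (fun w => f (w + 1)%C) at 1. 2: apply functional_extensionality, normalized_per; auto.
    apply cder_translate. apply lat_derive_cder; auto.
  - intros p Hp. destruct (normalized_mero f Hf p Hp) as [n [h [[r [Hr H1]] H2]]].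
    exists (S n), (fun z => (z - p) * C_derive h z - RtoC (INR n) * h z)%C. split.
    + exists r; split; auto. intros z Hz. destruct (holo_derive p r h H1 z Hz) as [l Hl]. destruct (H1 z Hz) as [l' Hl'].
      eexists. apply cder_minus. apply cder_mult. apply cder_minus. apply cder_id. apply cder_const. exact Hl. apply cder_scal; exact Hl'.
    + assert (H2' := near'_near _ _ (mero_at_quot _ _ _ _ H2)).
      generalize (near'_and _ _ _ H2' (near'_and _ _ _ (near'_neq p) (near'_and _ _ _ (near'_disc p r Hr) (lattice_discrete p)))).
      apply near'_imp. intros z [E [N [D L]]].
      assert (NN := sub_neq_0 _ _ N).
      erewrite (lat_derive_val f z); auto.
      2: { apply cder_ext_loc with (fun w => h w * / (w - p) ^ n)%C. eapply filter_imp; [|exact E]. intros w Hw; auto.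
           apply cder_mult. eapply holo_cder; eauto. apply (cder_comp Cinv (fun z => (z - p) ^ n)%C). apply cder_inv. apply Cpow_nz, NN.
           apply cder_pow, cder_minus. apply cder_id. apply cder_const. }
      cbv beta. destruct n. simpl. field. simpl Init.Nat.pred. simpl Cpow. field. split; auto. apply Cpow_nz, NN.
Qed.

Lemma lat_derive_Delta f : normalized f -> forall z, lat_derive (Defs.Delta tau f) z = Defs.Delta tau (lat_derive f) z.
Proof.
  intros Hf z. destruct (classic (Lam z)) as [L|L].
  - unfold Defs.Delta. rewrite !lat_derive_zero; auto. ring. apply lattice_tau in L; auto.
  - assert (L1 : ~ Lam (z + tau)%C) by (rewrite <- lattice_tau; auto). apply lat_derive_val; auto. unfold Defs.Delta.
    apply cder_minus. apply cder_translate. apply lat_derive_cder; auto. apply lat_derive_cder; auto.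
Qed.

Lemma normalized_SK_lat_derive k f : normalized_SK k f -> normalized_SK k (lat_derive f).
Proof.
  intros [A B]. split. apply normalized_lat_derive; auto.
  assert (E : forall j z, Nat.iter j (Defs.Delta tau) (lat_derive f) z = lat_derive (Nat.iter j (Defs.Delta tau) f) z).
  { induction j; simpl; intros z; auto. rewrite lat_derive_Delta. unfold Defs.Delta. rewrite !IHj. auto. apply normalized_iter_Delta; auto. }
  intros z. rewrite E. destruct (classic (Lam z)). apply lat_derive_zero; auto. apply lat_derive_val; auto.
  apply cder_ext_loc with (fun _ => 0%C). apply filter_forall. intros; symmetry; apply B. apply cder_const.
Qed.
End Lattice.

(** * Periodic functions on horizontal strips *)

Definition strip (a b : R) (z : C) : Prop := a < Im z < b.

Lemma strip_disc a b z : strip a b z -> forall w, cdisc z (Rmin (Im z - a) (b - Im z)) w -> strip a b w.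
Proof.
  unfold strip, cdisc. intros Hz w Hw. assert (K := im_le_Cmod (w - z)). rewrite Im_minus in K.
  destruct (Rmin_Rgt_l _ _ _ Hw) as [H1 H2].
  assert (A := Rle_lt_trans _ _ _ K H1). assert (B := Rle_lt_trans _ _ _ K H2). apply Rabs_def2 in A, B. lra.
Qed.

Lemma strip_radius a b z : strip a b z -> 0 < Rmin (Im z - a) (b - Im z).
Proof. unfold strip. intros H. apply Rmin_pos; lra. Qed.

Lemma strip_holo_derive a b f : holo (strip a b) f -> holo (strip a b) (C_derive f).
Proof.
  intros Hf z Hz. apply (holo_derive z (Rmin (Im z - a) (b - Im z))).
  intros w Hw. apply Hf. eapply strip_disc; eauto. apply cdisc_center, strip_radius, Hz.
Qed.

Lemma strip_real a b z (t : R) : strip a b z -> strip a b (z + RtoC t)%C.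
Proof. unfold strip. rewrite Im_plus, Im_RtoC. intros; lra. Qed.

Lemma strip_seg a b z w s : strip a b z -> strip a b w -> 0 <= s <= 1 -> strip a b (seg z w s).
Proof. unfold strip, seg. intros Hz Hw Hs. rewrite Im_plus, im_scal_l, Im_minus.
  replace (Im z + s * (Im w - Im z)) with ((1 - s) * Im z + s * Im w) by ring.
  destruct (Req_dec s 0) as [->|Hs0]. lra.
  assert (0 < s * (Im w - a)) by (apply Rmult_lt_0_compat; lra). assert (0 < s * (b - Im w)) by (apply Rmult_lt_0_compat; lra).
  assert (0 <= (1 - s) * (Im z - a)) by (apply Rmult_le_pos; lra). assert (0 <= (1 - s) * (b - Im z)) by (apply Rmult_le_pos; lra).
  split; nra.
Qed.

(** The period is only required inside the strip, so that functions defined by cases elsewhere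
    qualify. *)
Definition pstrip (a b : R) (f : C -> C) : Prop :=
  holo (strip a b) f /\ forall z, strip a b z -> f (z + 1)%C = f z.

Lemma cts_line (w : C) t : ctsR (fun t : R => w + RtoC t)%C t.
Proof. apply cts_plus. apply cts_const. apply cts_RtoC. apply continuous_id. Qed.

Lemma cts2_line z t : cts2 (fun (z : C) (t : R) => z + RtoC t)%C z t.
Proof.
  apply (cts_plus (U := CR_space)). apply cts2_fst.
  apply (cts2_of_snd RtoC). apply cts_RtoC, continuous_id.
Qed.

Lemma ex_line a b (F : C -> C) w : holo (strip a b) F -> strip a b w -> ex_CInt (fun t => F (w + RtoC t)%C) 0 1.
Proof.
  intros HF Hw. apply cts_ex_CInt_all. intros t. apply (cts_comp (fun t : R => w + RtoC t)%C F). apply cts_line.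
  eapply holo_cts; eauto. apply strip_real; auto.
Qed.

Lemma periodic_Z (P : C -> Prop) (f : C -> C) :
  (forall z (t : R), P z -> P (z + RtoC t)%C) -> (forall z, P z -> f (z + 1)%C = f z) ->
  forall (m : Z) z, P z -> f (z + RtoC (IZR m))%C = f z.
Proof.
  intros HP Hf. assert (N : forall n z, P z -> f (z + RtoC (INR n))%C = f z).
  { induction n; intros y Hy. simpl. f_equal; ring. rewrite S_INR, RtoC_plus.
    replace (y + (RtoC (INR n) + 1))%C with ((y + RtoC (INR n)) + 1)%C by ring. rewrite Hf; auto. }
  intros m z Hz. destruct (Z.le_gt_cases 0 m).
  - rewrite <- (Z2Nat.id m), <- INR_IZR_INZ by auto. auto.
  - rewrite <- (N (Z.to_nat (- m)) (z + RtoC (IZR m))%C) by auto. f_equal.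
    rewrite INR_IZR_INZ, Z2Nat.id, opp_IZR, RtoC_opp by lia. ring.
Qed.

Definition off_integers (p z : C) : Prop := forall m : Z, z <> (p + RtoC (IZR m))%C.

Lemma off_integers_Im p z : Im z <> Im p -> off_integers p z.
Proof. intros H m E. apply H. rewrite E, Im_plus, Im_RtoC. ring. Qed.

Lemma off_integers_1 p z : off_integers p (z + 1)%C <-> off_integers p z.
Proof.
  split; intros H m E.
  - apply (H (m + 1)%Z). rewrite E, plus_IZR, RtoC_plus. ring.
  - apply (H (m - 1)%Z). rewrite minus_IZR, RtoC_minus. replace z with (z + 1 - 1)%C by ring. rewrite E. ring.
Qed.

Lemma off_integers_near p z : near' z (off_integers p).
Proof.
  assert (HC : 0 < Im Ci) by (simpl; lra).
  eapply near'_imp; [|apply (near'_shift z (- p)%C _ (lattice_discrete Ci HC (z + - p)%C))].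
  intros y Hy m E. apply Hy. exists m, 0%Z. rewrite E. ring.
Qed.

(** The singularities form the single orbit p + Z, so one local extension at p serves at all of
    them by periodicity. *)
Lemma remove_periodic_singularity a b u p : strip a b p ->
  (forall z, strip a b z -> off_integers p z -> exists l, cder u z l) ->
  (forall z, strip a b z -> u (z + 1)%C = u z) -> reg_at u p ->
  exists v, pstrip a b v /\ forall z, off_integers p z -> v z = u z.
Proof.
  intros Hp Hd Hu [h [[r [Hr Hh]] H]].
  set (v := fun z => if em (off_integers p z) then u z else h p).
  assert (Hv : forall z, off_integers p z -> v z = u z).
  { intros z Hz. unfold v. destruct (em (off_integers p z)); tauto. }
  assert (Hv1 : forall z, strip a b z -> v (z + 1)%C = v z).
  { intros z Hz. unfold v. destruct (em (off_integers p (z + 1)%C)) as [O|O];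
      rewrite off_integers_1 in O; destruct (em (off_integers p z)); tauto || auto. }
  exists v. split; [split; auto | exact Hv]. intros z Hz.
  destruct (classic (off_integers p z)) as [O|O].
  - destruct (Hd z Hz O) as [l Hl]. exists l. apply cder_ext_loc with u; auto.
    assert (K := off_integers_near p z). apply locally'_C_iff in K. destruct K as [d [Hd' K]].
    apply locally_C_iff. exists d; split; auto. intros y Hy. symmetry. apply Hv.
    destruct (classic (y = z)) as [->|Ny]; auto.
  - (* z = p + m : near z the function v is y |-> h (y - m), by periodicity *)
    apply not_all_not_ex in O. destruct O as [m Em].
    apply locally'_C_iff in H. destruct H as [d [Hd' H]].
    assert (Hrp := strip_radius a b p Hp).
    destruct (Hh p (cdisc_center p r Hr)) as [l Hl]. exists l.
    apply cder_ext_loc with (fun y => h (y + - RtoC (IZR m))%C).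
    2: { apply (cder_translate h). replace (z + - RtoC (IZR m))%C with p by (rewrite Em; ring). exact Hl. }
    apply locally_C_iff. exists (Rmin (Rmin (Im p - a) (b - Im p)) (Rmin 1 d)). split. repeat apply Rmin_pos; unfold strip in *; auto; lra.
    intros y Hy. apply Rmin_Rgt_l in Hy as [Y0 [Y1 Y2]%Rmin_Rgt_l].
    set (q := (y + - RtoC (IZR m))%C). assert (Eq : (y - z)%C = (q - p)%C) by (unfold q; rewrite Em; ring). rewrite Eq in *.
    replace (v y) with (v q).
    2: { replace y with (q + RtoC (IZR m))%C by (unfold q; ring). symmetry.
         apply (periodic_Z (strip a b)); auto. intros; apply strip_real; auto. apply (strip_disc a b p); auto. }
    unfold v. destruct (em (off_integers p q)) as [O|O].
    + symmetry. apply H; auto. intros E. apply (O 0%Z). rewrite E. ring.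
    + f_equal. apply not_all_not_ex in O. destruct O as [m' O]. rewrite O in *.
      replace (p + RtoC (IZR m') - p)%C with (RtoC (IZR m')) in * by ring.
      rewrite Cmod_R, <- abs_IZR in Y1. apply lt_IZR in Y1. replace m' with 0%Z by lia. ring.
Qed.

(** The derivative in w is the integral of F' over a period, which is zero. *)
Lemma period_integral_const a b F w w' : pstrip a b F -> strip a b w -> strip a b w' ->
  CInt (fun t => F (w + RtoC t)%C) 0 1 = CInt (fun t => F (w' + RtoC t)%C) 0 1.
Proof.
  intros [HF HP] Hw Hw'. symmetry.
  apply (zero_der_const (fun w => CInt (fun t => F (w + RtoC t)%C) 0 1) w w').
  intros s Hs. assert (Hz := strip_seg a b w w' s Hw Hw' Hs). set (z := seg w w' s) in *.
  replace (RtoC 0) with (CInt (fun t => C_derive F (z + RtoC t)%C) 0 1).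
  2: { rewrite (CInt_derive (fun t => F (z + RtoC t)%C)).
       - rewrite HP; auto. replace (z + 0)%C with z by ring. ring.
       - intros t _. rewrite <- (Cmult_1_r (C_derive F _)). apply (rder_comp F (fun t : R => z + RtoC t)%C).
         eapply holo_cder; eauto. apply strip_real; auto.
         assert (K := rder_affine z 1%C t). eapply is_derive_ext; [|exact K]. intros u. cbv beta. eq_in_C. ring.
       - intros t _. apply (cts_comp (fun t : R => z + RtoC t)%C (C_derive F)). apply cts_line.
         eapply holo_cts. apply strip_holo_derive; eauto. apply strip_real; auto. }
  apply (cder_CInt_param (fun z t => F (z + RtoC t)%C) (fun z t => C_derive F (z + RtoC t)%C) z (Rmin (Im z - a) (b - Im z))).
  - apply strip_radius; auto.
  - lra.
  - intros y t Hy _. apply cder_translate. eapply holo_cder; eauto. apply strip_real. eapply strip_disc; eauto.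
  - intros y t Hy _. apply (cts_comp (U := CR_space) (fun p : C * R => fst p + RtoC (snd p))%C (C_derive F)).
    apply cts2_line. eapply holo_cts. apply strip_holo_derive; eauto. apply strip_real. eapply strip_disc; eauto.
  - intros y Hy. eapply ex_line; eauto. eapply strip_disc; eauto.
Qed.

(** * Convolution along a horizontal line *)

(** The contour is kept as a parameter w; moving it is the main tool, and only w = (i/2) Im x occurs
    in the convolution integral. *)
Definition line_conv (w : C) (f g : C -> C) (x : C) : C :=
  CInt (fun t => f (x - (w + RtoC t)) * g (w + RtoC t))%C 0 1.

Definition conv_integrand (f g : C -> C) (x z : C) : C := (f (x - z) * g z)%C.

Lemma cder_reflect (f : C -> C) x z l : cder f (x - z)%C l -> cder (fun w => f (x - w)%C) z (- l)%C.
Proof.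
  intros H. eapply cder_eq. apply (cder_comp f (fun w => x - w)%C). exact H. apply cder_minus. apply cder_const. apply cder_id. ring.
Qed.

Lemma conv_integrand_pstrip a1 b1 a2 b2 f g x lo hi : pstrip a1 b1 f -> pstrip a2 b2 g ->
  a2 <= lo -> hi <= b2 -> a1 <= Im x - hi -> Im x - lo <= b1 -> pstrip lo hi (conv_integrand f g x).
Proof.
  intros [Hf Pf] [Hg Pg] H1 H2 H3 H4. split.
  - intros z Hz. unfold strip in Hz. destruct (Hf (x - z)%C) as [l Hl]. unfold strip; rewrite Im_minus; lra.
    destruct (Hg z) as [m Hm]. unfold strip; lra. eexists. apply cder_mult. apply cder_reflect; eauto. exact Hm.
  - intros z Hz. unfold strip in Hz. unfold conv_integrand. rewrite Pg by (unfold strip; lra). f_equal.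
    rewrite <- (Pf (x - (z + 1))%C). f_equal. ring. unfold strip; rewrite Im_minus, Im_plus, Im_RtoC; lra.
Qed.

(** As a function of z the integrand is holomorphic and periodic between the two lines, so
    [period_integral_const] applies. *)
Lemma conv_height a1 b1 a2 b2 f g x w w' : pstrip a1 b1 f -> pstrip a2 b2 g ->
  strip a2 b2 w -> strip a2 b2 w' -> strip a1 b1 (x - w) -> strip a1 b1 (x - w') -> line_conv w f g x = line_conv w' f g x.
Proof.
  intros Hf Hg H1 H2 H3 H4. unfold strip in *. rewrite Im_minus in *.
  apply (period_integral_const (Rmax a2 (Im x - b1)) (Rmin b2 (Im x - a1)) (conv_integrand f g x)).
  - eapply conv_integrand_pstrip; eauto. apply Rmax_l. apply Rmin_l.
    assert (K := Rmin_r b2 (Im x - a1)). lra. assert (K := Rmax_r a2 (Im x - b1)). lra.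
  - split. apply Rmax_lub_lt; lra. apply Rmin_glb_lt; lra.
  - split. apply Rmax_lub_lt; lra. apply Rmin_glb_lt; lra.
Qed.

Lemma line_conv_integrand_cts a1 b1 a2 b2 f g x w t : holo (strip a1 b1) f -> holo (strip a2 b2) g ->
  strip a2 b2 w -> strip a1 b1 (x - w) -> ctsR (fun t => f (x - (w + RtoC t)) * g (w + RtoC t))%C t.
Proof.
  intros Hf Hg H1 H2. apply cts_mult.
  - apply (cts_comp (fun t : R => x - (w + RtoC t))%C f). apply cts_minus. apply cts_const. apply cts_line.
    eapply holo_cts; eauto. unfold strip in *. rewrite Im_minus in *. rewrite Im_plus, Im_RtoC. lra.
  - apply (cts_comp (fun t : R => w + RtoC t)%C g). apply cts_line. eapply holo_cts; eauto. apply strip_real; auto.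
Qed.

Lemma ex_line_conv a1 b1 a2 b2 f g x w : holo (strip a1 b1) f -> holo (strip a2 b2) g ->
  strip a2 b2 w -> strip a1 b1 (x - w) -> ex_CInt (fun t => f (x - (w + RtoC t)) * g (w + RtoC t))%C 0 1.
Proof. intros. apply cts_ex_CInt_all. intros. eapply line_conv_integrand_cts; eauto. Qed.

Lemma line_conv_cder a1 b1 a2 b2 f g x w : holo (strip a1 b1) f -> holo (strip a2 b2) g ->
  strip a2 b2 w -> strip a1 b1 (x - w) -> cder (line_conv w f g) x (line_conv w (C_derive f) g x).
Proof.
  intros Hf Hg Hw Hxw.
  assert (Hr := strip_radius _ _ _ Hxw). set (r := Rmin _ _) in Hr.
  assert (Hd : forall y, cdisc x r y -> strip a1 b1 (y - w)).
  { intros y Hy. apply (strip_disc a1 b1 (x - w)%C Hxw). unfold cdisc in *. replace (y - w - (x - w))%C with (y - x)%C by ring. exact Hy. }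
  assert (Hd' : forall y t, cdisc x r y -> strip a1 b1 (y - (w + RtoC t))).
  { intros y t Hy. specialize (Hd y Hy). unfold strip in *. rewrite Im_minus in *. rewrite Im_plus, Im_RtoC. lra. }
  assert (Hf' := strip_holo_derive _ _ _ Hf).
  apply (cder_CInt_param (fun x t => f (x - (w + RtoC t)) * g (w + RtoC t))%C (fun x t => C_derive f (x - (w + RtoC t)) * g (w + RtoC t))%C x r); auto.
  - lra.
  - intros y t Hy _. eapply cder_eq. apply cder_mult. 2: apply cder_const.
    apply (cder_translate f (- (w + RtoC t))%C y). eapply holo_cder. exact Hf. apply Hd'; auto. eq_in_C. cbv beta. unfold Cminus. ring.
  - intros y t Hy _. pose (U := CR_space).
    assert (Cs := cts2_of_snd (fun t => w + RtoC t)%C y t (cts_line w t)).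
    apply (cts_mult (U := U)).
    + apply (cts_comp (U := U) (fun p => fst p - (w + RtoC (snd p)))%C (C_derive f)).
      apply (cts_minus (U := U)); auto. apply cts2_fst.
      eapply holo_cts. exact Hf'. apply Hd'; auto.
    + apply (cts_comp (U := U) (fun p => w + RtoC (snd p))%C g); auto. eapply holo_cts; eauto. apply strip_real; auto.
  - intros y Hy. eapply ex_line_conv; eauto.
Qed.

Lemma line_conv_ext f f' g g' x w : (forall t : R, f (x - (w + RtoC t))%C = f' (x - (w + RtoC t))%C) ->
  (forall t : R, g (w + RtoC t)%C = g' (w + RtoC t)%C) -> line_conv w f g x = line_conv w f' g' x.
Proof. intros H1 H2. apply CInt_ext. intros t. rewrite H1, H2. auto. Qed.

Lemma conv_integral_line f g x : conv_integral f g x = line_conv (0, Im x / 2)%R f g x.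
Proof.
  unfold conv_integral. apply CInt_ext. intros t.
  replace ((0, Im x / 2)%R + RtoC t)%C with ((t, Im x / 2)%R : C). reflexivity.
  unfold RtoC, Cplus; simpl. f_equal; ring.
Qed.

(** * The exponential of period 1 *)

(** exp(2 i pi z). *)
Definition qexp (z : C) : C := (RtoC (exp (- (2 * PI * Im z))) * cis (2 * PI * Re z))%C.

Lemma cis_plus s t : cis (s + t) = (cis s * cis t)%C.
Proof. unfold cis, Cmult; simpl. rewrite cos_plus, sin_plus. f_equal; ring. Qed.

Lemma qexp_plus z w : qexp (z + w) = (qexp z * qexp w)%C.
Proof.
  unfold qexp. rewrite Re_plus, Im_plus, !Rmult_plus_distr_l, cis_plus, Ropp_plus_distr, exp_plus, RtoC_mult. ring.
Qed.

Lemma qexp_0 : qexp 0 = 1%C.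
Proof. unfold qexp. rewrite Im_RtoC, Re_RtoC, !Rmult_0_r, Ropp_0, exp_0, cis_0. ring. Qed.

Lemma qexp_1 : qexp 1 = 1%C.
Proof. unfold qexp. rewrite Im_RtoC, Re_RtoC, Rmult_0_r, Ropp_0, exp_0, Rmult_1_r, cis_2PI. ring. Qed.

Lemma qexp_per z : qexp (z + 1) = qexp z.
Proof. rewrite qexp_plus, qexp_1. ring. Qed.

Lemma qexp_eq_1 z : qexp z = 1%C -> exists m : Z, z = RtoC (IZR m).
Proof.
  intros H. assert (P := PI_RGT_0).
  assert (Hm : exp (- (2 * PI * Im z)) = 1).
  { assert (E : Cmod (qexp z) = 1) by (rewrite H; apply Cmod_1). unfold qexp in E. rewrite Cmod_mult, Cmod_cis, Rmult_1_r, Cmod_R in E.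
    rewrite Rabs_pos_eq in E; auto. apply Rlt_le, exp_pos. }
  assert (HI : Im z = 0).
  { rewrite <- exp_0 in Hm. apply exp_inv in Hm. assert (E : 2 * PI * Im z = 0) by lra. apply Rmult_integral in E. lra. }
  unfold qexp in H. rewrite Hm, Cmult_1_l in H. injection H. intros Hs Hc.
  destruct (sin_eq_0_0 (PI * Re z)) as [k Hk].
  { (* cos(2u) = 1 - 2 sin^2 u *)
    assert (E := cos_2a_sin (PI * Re z)). replace (2 * (PI * Re z)) with (2 * PI * Re z) in E by ring. rewrite Hc in E.
    assert (E2 : sin (PI * Re z) * sin (PI * Re z) = 0) by lra. apply Rmult_integral in E2. tauto. }
  exists k. apply C_eq; rewrite ?Re_RtoC, ?Im_RtoC; auto.
  apply Rmult_eq_reg_l with PI. lra. lra.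
Qed.

(** From the real derivatives at 0 along the two axes, combined by
    qexp (x + i y) = qexp x * qexp (i y). *)
Lemma cder_qexp_0 : cder qexp 0%C (RtoC (2 * PI) * Ci)%C.
Proof.
  assert (D1 : rder (fun x : R => cis (2 * PI * x)) 0 (RtoC (2 * PI) * Ci)%C).
  { replace (RtoC (2 * PI) * Ci)%C with (((- sin (2 * PI * 0)) * (2 * PI))%R, (cos (2 * PI * 0) * (2 * PI))%R).
    2: { rewrite Rmult_0_r, sin_0, cos_0. unfold RtoC, Ci, Cmult; simpl. f_equal; ring. }
    apply rder_pair.
    - auto_derive; auto. ring.
    - auto_derive; auto. ring. }
  assert (D2 : rder (fun y : R => RtoC (exp (- (2 * PI * y)))) 0 (RtoC (- (2 * PI)))%C).
  { apply rder_RtoC. auto_derive; auto. rewrite Rmult_0_r, Ropp_0, exp_0. ring. }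
  apply cder_iff. intros eps He.
  assert (P := PI_RGT_0).
  set (A := fun y : R => RtoC (exp (- (2 * PI * y)))). set (B := fun x : R => cis (2 * PI * x)).
  assert (A0 : A 0 = 1%C) by (unfold A; rewrite Rmult_0_r, Ropp_0, exp_0; auto).
  assert (B0 : B 0 = 1%C) by (unfold B; rewrite Rmult_0_r, cis_0; auto).
  set (e := Rmin 1 (eps / (3 + 2 * PI))). assert (Hpos : 0 < eps / (3 + 2 * PI)) by (apply Rdiv_lt_0_compat; lra).
  assert (He' : 0 < e) by (apply Rmin_pos; lra).
  destruct (proj1 (rder_iff _ _ _) D1 e He') as [d1 [Hd1 K1]].
  destruct (proj1 (rder_iff _ _ _) D2 e He') as [d2 [Hd2 K2]].
  assert (CA : ctsR A 0) by (eapply cts_rder; exact D2).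
  destruct (proj1 (continuous_RC_iff A 0) CA e He') as [d3 [Hd3 K3]].
  exists (Rmin d1 (Rmin d2 d3)). split. repeat apply Rmin_pos; auto.
  intros w Hw. replace (w - 0)%C with w in * by ring.
  apply Rmin_Rgt_l in Hw as [W1 [W2 W3]%Rmin_Rgt_l].
  assert (Hx := re_le_Cmod w). assert (Hy := im_le_Cmod w). set (x := Re w) in *. set (y := Im w) in *. set (N := Cmod w) in *.
  specialize (K1 x). specialize (K2 y). specialize (K3 y). rewrite Rminus_0_r in K1, K2, K3.
  specialize (K1 (Rle_lt_trans _ _ _ Hx W1)). specialize (K2 (Rle_lt_trans _ _ _ Hy W2)). specialize (K3 (Rle_lt_trans _ _ _ Hy W3)).
  fold (A y) in K2. fold (A 0) in K2. fold (B x) in K1. fold (B 0) in K1. rewrite A0 in K2, K3. rewrite B0 in K1.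
  replace (qexp w) with (A y * B x)%C by reflexivity. rewrite qexp_0.
  assert (Ew : w = (RtoC x + Ci * RtoC y)%C) by (apply C_eq; unfold x, y; destruct w; simpl; ring).
  assert (EI : (Ci * Ci = - (1))%C) by (unfold Ci, Cmult, Copp, RtoC; simpl; f_equal; ring).
  rewrite RtoC_opp in K2. set (p := RtoC (2 * PI)) in *.
  replace (A y * B x - 1 - p * Ci * w)%C with
   ((A y - 1) * (p * Ci * RtoC x) + A y * (B x - 1 - p * Ci * RtoC x) + (A y - 1 - - p * RtoC y))%C.
  2: { rewrite Ew. transitivity (A y * B x - 1 - p * Ci * RtoC x + p * RtoC y)%C. ring.
       replace (p * Ci * (RtoC x + Ci * RtoC y))%C with (p * Ci * RtoC x + p * (Ci * Ci) * RtoC y)%C by ring. rewrite EI. ring. }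
  assert (N0 : 0 <= N) by apply Cmod_ge_0.
  assert (E1 : e <= 1) by apply Rmin_l. assert (E2 : e * (3 + 2 * PI) <= eps).
  { assert (K := Rmin_r 1 (eps / (3 + 2 * PI))). fold e in K. apply Rmult_le_compat_r with (r := 3 + 2 * PI) in K; [|lra].
    replace (eps / (3 + 2 * PI) * (3 + 2 * PI)) with eps in K by (field; lra). exact K. }
  assert (Ay : Cmod (A y) <= 2). { replace (A y) with ((A y - 1) + 1)%C by ring. cmod_tri. rewrite Cmod_1. lra. }
  assert (PP : Cmod p = 2 * PI) by (unfold p; rewrite Cmod_R, Rabs_pos_eq; lra).
  cmod_tri. eapply Rle_trans. apply Rplus_le_compat_r, Cmod_triangle.
  rewrite !Cmod_mult, PP, Cmod_Ci, Cmod_R.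
  assert (T1 : Cmod (A y - 1) * (2 * PI * 1 * Rabs x) <= e * (2 * PI * N)).
  { apply Rmult_le_compat; try lra. apply Cmod_ge_0. generalize (Rabs_pos x); nra. nra. }
  assert (T2 : Cmod (A y) * Cmod (B x - 1 - p * Ci * RtoC x) <= 2 * (e * N)).
  { apply Rmult_le_compat; try apply Cmod_ge_0; auto. eapply Rle_trans. exact K1. apply Rmult_le_compat_l; lra. }
  assert (T3 : Cmod (A y - 1 - - p * RtoC y) <= e * N) by (eapply Rle_trans; [exact K2 | apply Rmult_le_compat_l; lra]).
  apply Rle_trans with (e * (3 + 2 * PI) * N). lra. apply Rmult_le_compat_r; auto.
Qed.

Lemma cder_qexp z : cder qexp z (RtoC (2 * PI) * Ci * qexp z)%C.
Proof.
  apply cder_ext_loc with (fun w => qexp z * qexp (w + - z))%C.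
  - apply filter_forall. intros w. rewrite <- qexp_plus. f_equal. ring.
  - eapply cder_eq. apply cder_scal. apply (cder_translate qexp (- z)%C z). replace (z + - z)%C with (RtoC 0) by ring. apply cder_qexp_0.
    ring.
Qed.

(** * Moving the contour across a pole *)

(** The simplest function of period 1 with a simple pole at the integers; it satisfies the
    differential equation of [cder_pole_kernel], which expresses its powers by its derivatives. *)
Definition pole_kernel (z : C) : C := (/ (qexp z - 1))%C.

Lemma pole_kernel_denom z : off_integers 0 z -> (qexp z - 1)%C <> 0%C.
Proof. intros H E. destruct (qexp_eq_1 z) as [m Hm]. 2: { apply (H m). rewrite Hm. ring. } replace (qexp z) with ((qexp z - 1) + 1)%C by ring. rewrite E; ring. Qed.

Lemma cder_pole_kernel z : off_integers 0 z -> cder pole_kernel z (- (RtoC (2 * PI) * Ci * (pole_kernel z + pole_kernel z * pole_kernel z)))%C.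
Proof.
  intros H. assert (N := pole_kernel_denom z H). unfold pole_kernel at 1. eapply cder_eq.
  apply (cder_comp Cinv (fun z => qexp z - 1)%C). apply cder_inv; auto. apply cder_minus. apply cder_qexp. apply cder_const.
  unfold pole_kernel. field; auto.
Qed.

Lemma pole_kernel_per z : pole_kernel (z + 1) = pole_kernel z.
Proof. unfold pole_kernel. rewrite qexp_per. auto. Qed.

(** The factor k = z u(z) is kept explicit: with it a pole of any order is lowered by subtracting a
    multiple of a power of u. *)
Lemma pole_kernel_simple_pole : exists k, holo_near k 0 /\ k 0%C <> 0%C /\ near' 0%C (fun z => z * pole_kernel z = k z)%C.
Proof.
  destruct (holo_factor qexp 0%C 1) as [r [q [Hr [Hq H]]]]. lra. intros z _. eexists; apply cder_qexp.
  assert (Hc := cdisc_center (RtoC 0) r Hr).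
  assert (Q0 : q 0%C <> 0%C).
  { destruct (Hq 0%C Hc) as [l Hl]. replace (q 0%C) with (RtoC (2 * PI) * Ci)%C.
    apply Cmult_neq_0. apply two_PI_nz. apply Ci_nz.
    apply cder_unique with qexp (RtoC 0). apply cder_qexp_0.
    apply cder_ext_loc with (fun z => qexp 0 + (z - 0) * q z)%C.
    - eapply filter_imp; [|apply (cdisc_open (RtoC 0) r (RtoC 0) Hc)]. intros w Hw. symmetry. auto.
    - eapply cder_eq. apply cder_plus. apply cder_const. apply cder_mult. apply cder_minus. apply cder_id. apply cder_const. exact Hl. cbv beta. ring. }
  destruct (cts_neq_0 q 0%C (holo_cts _ _ _ Hq Hc) Q0) as [d [Hd Hn]].
  assert (Hm : 0 < Rmin r d) by (apply Rmin_pos; auto).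
  exists (fun z => / q z)%C. split; [exists (Rmin r d); split; auto|split].
  - intros z Hz. apply Rmin_Rgt_l in Hz as [Z1 Z2]. destruct (Hq z Z1) as [l Hl]. eexists. apply (cder_comp Cinv q). apply cder_inv; auto. exact Hl.
  - intros E. apply C1_nz. rewrite <- (Cinv_r (q 0%C)) by auto. rewrite E. ring.
  - generalize (near'_and _ _ _ (near'_disc 0%C _ Hm) (near'_neq 0%C)). apply near'_imp. intros z [Hz N].
    apply Rmin_Rgt_l in Hz as [Z1 Z2]. specialize (Hn z Z2). unfold pole_kernel. rewrite (H z Z1), qexp_0.
    field. split. auto. replace (1 + z * q z - 1)%C with (z * q z)%C by ring. apply Cmult_neq_0; auto.
Qed.

Section Jumps.
Variable tau : C.
Hypothesis Htau : 0 < Im tau.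
Notation T := (Im tau).
Notation Lam := (lattice tau).
Notation DD := (Defs.Delta tau).

Lemma strip_nonlat z : strip 0 T z -> ~ Lam z.
Proof. intros H. apply lattice_strip; auto. Qed.

Lemma normalized_pstrip f : normalized tau f -> pstrip 0 T f.
Proof. intros Hf. split. intros z Hz. apply (normalized_diff tau f Hf). apply strip_nonlat; auto. intros; apply (normalized_per tau f Hf). Qed.

Definition holo_off_R (u : C -> C) : Prop := holo (strip (- T) 0) u /\ holo (strip 0 T) u.

(** The residue at the pole z = x of u(x - z) g(z), without naming it: it is the difference of the
    integrals above and below the pole, and all that matters is that as a function of x it is
    normalized and killed by Delta^s whenever g is. *)
Definition jump_normalized (u : C -> C) : Prop :=
  forall g, normalized tau g -> exists E, normalized tau E /\
    (forall s, (forall z, Nat.iter s DD g z = 0%C) -> forall z, Nat.iter s DD E z = 0%C) /\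
    forall x w w', 0 < Im x < T -> strip 0 (Im x) w' -> strip (Im x) T w -> line_conv w u g x = (line_conv w' u g x + E x)%C.

Lemma jump_ext u v : (forall z, - T < Im z < T -> Im z <> 0 -> u z = v z) -> jump_normalized u -> jump_normalized v.
Proof.
  intros H Hu g Hg. destruct (Hu g Hg) as [E [E1 [E2 E3]]]. exists E; split; auto; split; auto.
  intros x w w' Hx Hw' Hw. unfold strip in *.
  rewrite <- (line_conv_ext u v g g x w), <- (line_conv_ext u v g g x w'); auto;
  intros t; apply H; rewrite Im_minus, Im_plus, Im_RtoC; lra.
Qed.

Lemma ex_CInt_above u g x w : holo_off_R u -> normalized tau g -> 0 < Im x < T -> strip (Im x) T w -> ex_CInt (fun t => u (x - (w + RtoC t)) * g (w + RtoC t))%C 0 1.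
Proof.
  intros [H1 H2] Hg Hx Hw. unfold strip in Hw. eapply ex_line_conv. exact H1. apply normalized_pstrip; auto. unfold strip; lra. unfold strip; rewrite Im_minus; lra.
Qed.

Lemma ex_CInt_below u g x w : holo_off_R u -> normalized tau g -> 0 < Im x < T -> strip 0 (Im x) w -> ex_CInt (fun t => u (x - (w + RtoC t)) * g (w + RtoC t))%C 0 1.
Proof.
  intros [H1 H2] Hg Hx Hw. unfold strip in Hw. eapply ex_line_conv. exact H2. apply normalized_pstrip; auto. unfold strip; lra. unfold strip; rewrite Im_minus; lra.
Qed.

Lemma line_conv_lin a u v g x w :
  ex_CInt (fun t => u (x - (w + RtoC t)) * g (w + RtoC t))%C 0 1 -> ex_CInt (fun t => v (x - (w + RtoC t)) * g (w + RtoC t))%C 0 1 ->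
  line_conv w (fun z => a * u z + v z)%C g x = (a * line_conv w u g x + line_conv w v g x)%C.
Proof.
  intros H1 H2. unfold line_conv. rewrite <- CInt_scal, <- CInt_plus; auto. apply CInt_ext. intros; ring. apply ex_CInt_scal; auto.
Qed.

Lemma jump_lin a u v : holo_off_R u -> holo_off_R v -> jump_normalized u -> jump_normalized v -> jump_normalized (fun z => a * u z + v z)%C.
Proof.
  intros Hu Hv Ju Jv g Hg. destruct (Ju g Hg) as [E [E1 [E2 E3]]]. destruct (Jv g Hg) as [G [G1 [G2 G3]]].
  exists (fun z => a * E z + G z)%C. split. apply normalized_plus. apply normalized_scal; auto. auto. split.
  - intros s Hs z. rewrite (iter_Delta_plus tau s (fun z => a * E z)%C G), iter_Delta_scal, E2, G2 by auto. ring.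
  - intros x w w' Hx Hw' Hw. rewrite !line_conv_lin by (auto using ex_CInt_above, ex_CInt_below). rewrite (E3 x w w'), (G3 x w w') by auto. ring.
Qed.

Lemma jump_holo u : pstrip (- T) T u -> jump_normalized u.
Proof.
  intros Hu g Hg. exists (fun _ => 0%C). split. apply normalized_0. split. intros; apply iter_Delta_0.
  intros x w w' Hx Hw' Hw. rewrite Cplus_0_r. unfold strip in *. eapply conv_height. exact Hu. apply normalized_pstrip; auto.
  all: unfold strip; rewrite ?Im_minus; lra.
Qed.

Lemma holo_off_R_derive u : holo_off_R u -> holo_off_R (C_derive u).
Proof. intros [A B]. split; apply strip_holo_derive; auto. Qed.

Lemma holo_off_R_pole_kernel_pow j : holo_off_R (fun z => pole_kernel z ^ j)%C.
Proof.
  split; intros z Hz; eexists; apply cder_pow, cder_pole_kernel, off_integers_Im; simpl; unfold strip in Hz; lra.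
Qed.

(** Differentiating in x under both integrals differentiates the jump. *)
Lemma jump_derive u : holo_off_R u -> jump_normalized u -> jump_normalized (C_derive u).
Proof.
  intros Hu Ju g Hg. destruct (Ju g Hg) as [E [E1 [E2 E3]]]. exists (lat_derive tau E). split. apply normalized_lat_derive; auto. split.
  - intros s Hs. apply (normalized_SK_lat_derive tau Htau s E). split; auto.
  - intros x w w' Hx Hw' Hw. unfold strip in Hw, Hw'. destruct Hu as [U1 U2]. destruct (normalized_pstrip g Hg) as [G1 _].
    apply cder_unique with (line_conv w u g) x.
    { apply (line_conv_cder (- T) 0 0 T); auto; unfold strip; rewrite ?Im_minus; lra. }
    apply cder_ext_loc with (fun x => line_conv w' u g x + E x)%C.
    + apply locally_C_iff. exists (Rmin (Im x - Im w') (Im w - Im x)). split. apply Rmin_pos; lra.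
      intros y Hy. apply (strip_disc (Im w') (Im w) x) in Hy. 2: unfold strip; lra. unfold strip in Hy.
      symmetry. apply E3; unfold strip; lra.
    + apply cder_plus. apply (line_conv_cder 0 T 0 T); auto; unfold strip; rewrite ?Im_minus; lra. apply lat_derive_cder; auto. apply strip_nonlat. unfold strip; lra.
Qed.

(** Subtracting g(x) from g(z) makes the pole z = x removable, so only g(x) times the jump of the
    integral of u over a period remains; that jump is a constant. *)
Lemma jump_pole_kernel : jump_normalized pole_kernel.
Proof.
  intros g Hg.
  set (F := fun z => pole_kernel (- z)%C).
  assert (DF : forall z, Im z <> 0 -> exists l, cder F z l).
  { intros z Hz. eexists. apply (cder_comp pole_kernel (fun z => - z)%C). apply cder_pole_kernel, off_integers_Im. change (- Im z <> 0). lra.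
    apply cder_opp, cder_id. }
  assert (PF : forall z, F (z + 1)%C = F z).
  { intros z. unfold F. rewrite <- (pole_kernel_per (- (z + 1))%C). f_equal. ring. }
  assert (P1 : pstrip 0 T F) by (split; auto; intros z Hz; apply DF; unfold strip in Hz; lra).
  assert (P2 : pstrip (- T) 0 F) by (split; auto; intros z Hz; apply DF; unfold strip in Hz; lra).
  set (cp := CInt (fun t => F ((0, T / 2)%R + RtoC t)%C) 0 1). set (cm := CInt (fun t => F ((0, (- T / 2))%R + RtoC t)%C) 0 1).
  exists (fun z => (cp - cm) * g z)%C. split. apply normalized_scal; auto. split.
  { intros s Hs z. rewrite iter_Delta_scal, Hs. ring. }
  intros x w w' Hx Hw' Hw. unfold strip in Hw, Hw'.
  destruct (remove_periodic_singularity 0 T (fun z => pole_kernel (x - z) * (g z - g x))%C x) as [G [PG HG]].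
  { exact Hx. }
  { intros z Hz Oz. destruct (proj1 (normalized_pstrip g Hg) z Hz) as [l Hl]. eexists. apply cder_mult. apply cder_reflect, cder_pole_kernel.
    intros m E. apply (Oz (- m)%Z). rewrite opp_IZR, RtoC_opp. replace z with (x - (x - z))%C by ring. rewrite E. ring.
    apply cder_minus. exact Hl. apply cder_const. }
  { intros z Hz. rewrite (normalized_per tau g Hg). f_equal. rewrite <- (pole_kernel_per (x - (z + 1))%C). f_equal. ring. }
  { destruct pole_kernel_simple_pole as [k [[r [Hr Hk]] [_ Huk]]].
    assert (Hsx := strip_radius 0 T x Hx).
    destruct (holo_factor g x _ Hsx) as [r2 [q [Hr2 [Hq Hgq]]]].
    { intros y Hy. apply (normalized_pstrip g Hg). apply (strip_disc 0 T x); auto. }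
    exists (fun y => - k (x - y) * q y)%C. split.
    - exists (Rmin r r2). split. apply Rmin_pos; auto. intros y Hy. apply Rmin_Rgt_l in Hy as [Y1 Y2].
      destruct (Hk (x - y)%C) as [l Hl]. { unfold cdisc. replace (x - y - 0)%C with (x - y)%C by ring. rewrite Cmod_sub_sym. exact Y1. }
      destruct (Hq y Y2) as [l' Hl']. eexists. apply cder_mult. apply cder_opp, cder_reflect, Hl. exact Hl'.
    - apply locally'_C_iff in Huk. destruct Huk as [d [Hd Huk]].
      generalize (near'_and _ _ _ (near'_neq x) (near'_and _ _ _ (near'_disc x d Hd) (near'_disc x r2 Hr2))).
      apply near'_imp. intros y [Ny [Y1 Y2]]. rewrite <- Huk, (Hgq y Y2). ring.
      replace (x - y - 0)%C with (x - y)%C by ring. rewrite Cmod_sub_sym. exact Y1. apply sub_neq_0; auto. }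
  assert (EG := period_integral_const 0 T G w w' PG ltac:(unfold strip; lra) ltac:(unfold strip; lra)).
  assert (H2 : holo_off_R pole_kernel) by (split; intros z Hz; eexists; apply cder_pole_kernel, off_integers_Im; unfold strip in Hz; simpl; lra).
  assert (X : forall v, 0 < Im v < T -> Im v <> Im x -> CInt (fun t => G (v + RtoC t)%C) 0 1 = (line_conv v pole_kernel g x - g x * CInt (fun t => F ((v - x) + RtoC t)%C) 0 1)%C).
  { intros v Hv Hne.
    assert (XF : ex_CInt (fun t => F ((v - x) + RtoC t)%C) 0 1).
    { destruct (Rlt_le_dec (Im v) (Im x)). apply (ex_line (- T) 0). apply P2. unfold strip; rewrite Im_minus; lra.
      apply (ex_line 0 T). apply P1. unfold strip; rewrite Im_minus; lra. }
    rewrite <- CInt_scal by auto. unfold line_conv. rewrite <- CInt_minus.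
    - apply CInt_ext. intros t. rewrite HG. 2: { apply off_integers_Im. rewrite Im_plus, Im_RtoC; lra. }
      unfold F. replace (- (v - x + RtoC t))%C with (x - (v + RtoC t))%C by ring. ring.
    - destruct (Rlt_le_dec (Im v) (Im x)). apply ex_CInt_below; auto. unfold strip; lra. apply ex_CInt_above; auto. unfold strip; lra.
    - apply ex_CInt_scal; auto. }
  rewrite (X w), (X w') in EG by lra.
  replace (CInt (fun t => F ((w - x) + RtoC t)%C) 0 1) with cp in EG.
  2: { apply (period_integral_const 0 T); auto; unfold strip; rewrite ?Im_minus; simpl; lra. }
  replace (CInt (fun t => F ((w' - x) + RtoC t)%C) 0 1) with cm in EG.
  2: { apply (period_integral_const (- T) 0); auto; unfold strip; rewrite ?Im_minus; simpl; lra. }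
  replace (line_conv w pole_kernel g x) with ((line_conv w pole_kernel g x - g x * cp) + g x * cp)%C by ring. rewrite EG. ring.
Qed.

(** u^(j+1) = - u^j - (u^j)' / (2 i pi j). *)
Lemma jump_pole_kernel_pow j : jump_normalized (fun z => pole_kernel z ^ S j)%C.
Proof.
  induction j.
  - apply jump_ext with pole_kernel. intros; simpl; ring. apply jump_pole_kernel.
  - assert (Hj : RtoC (INR (S j)) <> 0%C). { intros E. apply RtoC_inj in E. revert E. apply not_0_INR. lia. }
    assert (H2 := two_PI_nz). assert (H3 := Ci_nz).
    set (c := (- / (RtoC (2 * PI) * Ci * RtoC (INR (S j))))%C).
    apply jump_ext with (fun z => c * C_derive (fun z => pole_kernel z ^ S j) z + (- (1) * (pole_kernel z ^ S j) + 0))%C.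
    + intros z _ Hz. replace (C_derive (fun z => pole_kernel z ^ S j)%C z) with (RtoC (INR (S j)) * pole_kernel z ^ j * (- (RtoC (2 * PI) * Ci * (pole_kernel z + pole_kernel z * pole_kernel z))))%C.
      2: { symmetry. apply is_C_derive_unique. apply (cder_pow pole_kernel z _ (S j)). apply cder_pole_kernel, off_integers_Im, Hz. }
      unfold c. simpl. simpl in Hj. field. auto.
    + apply jump_lin. apply holo_off_R_derive, holo_off_R_pole_kernel_pow.
      * destruct (holo_off_R_pole_kernel_pow (S j)) as [A B]. split; (apply holo_plus; [apply holo_mult; auto; apply holo_const | apply holo_const]).
      * apply jump_derive; auto. apply holo_off_R_pole_kernel_pow.
      * apply jump_lin; auto. apply holo_off_R_pole_kernel_pow. split; apply holo_const. apply jump_holo. split. apply holo_const. auto.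
Qed.

(** The part of the behaviour of a normalized function that matters for the jump: its pole at 0, of
    order at most n, and the translates of this pole. *)
Definition integer_pole (n : nat) (u : C -> C) : Prop :=
  (forall z, strip (- T) T z -> off_integers 0 z -> exists l, cder u z l) /\
  (forall z, strip (- T) T z -> u (z + 1)%C = u z) /\
  exists h, holo_near h 0 /\ near' 0%C (fun z => z ^ n * u z = h z)%C.

Lemma integer_pole_holo_off_R n u : integer_pole n u -> holo_off_R u.
Proof. intros [H _]. split; intros z Hz; unfold strip in Hz; apply H; try (unfold strip; lra); apply off_integers_Im; simpl; lra. Qed.

(** Induction on the order of the pole: subtracting a multiple of u^n lowers the order, and a
    function with removable singularities has no jump by [jump_holo]. *)
Lemma jump_integer_pole n : forall u, integer_pole n u -> jump_normalized u.
Proof.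
  induction n; intros u Hu; assert (H2 := integer_pole_holo_off_R _ _ Hu); destruct Hu as [Hd [Hp [h [Hh Hu]]]].
  - destruct (remove_periodic_singularity (- T) T u 0%C) as [v [Pv Hv]]; auto.
    { unfold strip. simpl. lra. }
    { exists h. split; auto. eapply near'_imp; [|exact Hu]. intros z <-. simpl. ring. }
    apply jump_ext with v. intros z _ Hz. apply Hv, off_integers_Im, Hz. apply jump_holo; auto.
  - destruct pole_kernel_simple_pole as [k [Hk [Hk0 Huk]]].
    (* al is chosen to make h - al k^(n+1) vanish at 0 *)
    set (al := (h 0 / k 0 ^ S n)%C).
    (* h1 = z^(n+1) (u - al u1^(n+1)) with u1 the kernel *)
    set (h1 := fun z => (h z - al * k z ^ S n)%C).
    destruct (holo_near_ex _ _ _ Hh Hk) as [r [Hr [Dh Dk]]].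
    assert (Hh1 : holo (cdisc 0 r) h1).
    { intros z Hz. destruct (Dh z Hz) as [l Hl]. destruct (Dk z Hz) as [l' Hl'].
      eexists. apply cder_minus. exact Hl. apply cder_scal, cder_pow, Hl'. }
    assert (h10 : h1 0%C = 0%C). { unfold h1, al. field. apply (Cpow_nz (k 0%C) (S n)); auto. }
    destruct (holo_factor h1 0%C _ Hr Hh1) as [r2 [q [Hr2 [Hq Hq']]]].
    assert (Hc : integer_pole n (fun z => u z - al * pole_kernel z ^ S n)%C).
    { split; [|split].
      - intros z Hz Nz. destruct (Hd z Hz Nz) as [l Hl]. eexists. apply cder_minus. exact Hl. apply cder_scal, cder_pow, cder_pole_kernel, Nz.
      - intros z Hz. rewrite Hp, pole_kernel_per; auto.
      - exists q. split. exists r2; auto.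
        generalize (near'_and _ _ _ (near'_and _ _ _ Hu Huk) (near'_and _ _ _ (near'_neq 0%C) (near'_disc 0%C r2 Hr2))).
        apply near'_imp. intros z [[Zu Zk] [Nz Z3]].
        assert (E : (z * (z ^ n * (u z - al * pole_kernel z ^ S n)))%C = (z * q z)%C).
        { transitivity (h1 z). 2: { rewrite (Hq' z Z3), h10. ring. }
          unfold h1. rewrite <- Zu, <- Zk, Cpow_mult_l. simpl. ring. }
        apply (f_equal (fun y => / z * y)%C) in E. rewrite !Cmult_assoc, Cinv_l, !Cmult_1_l in E by auto. exact E. }
    apply jump_ext with (fun z => al * (pole_kernel z ^ S n) + (u z - al * pole_kernel z ^ S n))%C. intros; ring.
    apply jump_lin. apply holo_off_R_pole_kernel_pow. eapply integer_pole_holo_off_R; exact Hc. apply jump_pole_kernel_pow. apply IHn, Hc.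
Qed.

Lemma normalized_integer_pole f : normalized tau f -> exists n, integer_pole n f.
Proof.
  intros Hf. destruct (normalized_mero tau f Hf 0%C) as [n [h [Hh H]]]. { exists 0%Z, 0%Z. ring. }
  exists n. split; [|split].
  - intros z Hz Nz. apply (normalized_diff tau f Hf). intros L. destruct (lattice_band tau Htau z L Hz) as [m E]. apply (Nz m). rewrite E. ring.
  - intros; apply (normalized_per tau f Hf).
  - exists h. split; auto. eapply near'_imp; [|exact H]. intros z <-. f_equal. f_equal. ring.
Qed.

Lemma normalized_jump f : normalized tau f -> jump_normalized f.
Proof. intros Hf. destruct (normalized_integer_pole f Hf) as [n Hn]. eapply jump_integer_pole; eauto. Qed.
End Jumps.

(** * Analytic continuation of the convolution *)

Section Continuation.
Variable tau : C.
Hypothesis Htau : 0 < Im tau.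
Notation T := (Im tau).
Notation Lam := (lattice tau).
Notation DD := (Defs.Delta tau).

Lemma half_strip x : 0 < Im x < 2 * T -> strip 0 T (0, Im x / 2) /\ strip 0 T (x - (0, Im x / 2)%R).
Proof. intros H. unfold strip. rewrite Im_minus. simpl. lra. Qed.

Lemma conv_eq_line_conv f g x w : pstrip 0 T f -> pstrip 0 T g -> 0 < Im x < 2 * T -> strip 0 T w -> strip 0 T (x - w) ->
  conv_integral f g x = line_conv w f g x.
Proof.
  intros Hf Hg Hx H1 H2. destruct (half_strip x Hx). rewrite conv_integral_line. apply (conv_height 0 T 0 T); auto.
Qed.

Lemma conv_diff f g x : pstrip 0 T f -> pstrip 0 T g -> 0 < Im x < 2 * T -> exists l, cder (conv_integral f g) x l.
Proof.
  intros Hf Hg Hx. destruct (half_strip x Hx) as [H1 H2]. set (w := (0, Im x / 2)%R : C) in *.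
  exists (line_conv w (C_derive f) g x). apply cder_ext_loc with (line_conv w f g).
  - apply locally_C_iff. exists (Rmin (Im x - Im w) (Im w + T - Im x)). unfold strip in *. rewrite Im_minus in *.
    split. apply Rmin_pos; lra. intros y Hy. apply (strip_disc (Im w) (Im w + T) x) in Hy. 2: unfold strip; lra.
    unfold strip in Hy. symmetry. apply conv_eq_line_conv; auto; unfold strip; rewrite ?Im_minus; lra.
  - apply (line_conv_cder 0 T 0 T); auto. apply Hf. apply Hg.
Qed.

Lemma conv_per f g x : pstrip 0 T f -> 0 < Im x < 2 * T -> conv_integral f g (x + 1) = conv_integral f g x.
Proof.
  intros Hf Hx. rewrite !conv_integral_line. rewrite Im_plus, Im_RtoC, Rplus_0_r. apply CInt_ext. intros t. f_equal.
  rewrite <- (proj2 Hf (x - _)%C). f_equal. ring. unfold strip. rewrite Im_minus, Im_plus, Im_RtoC. simpl. lra.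
Qed.

Lemma line_conv_plus_l f f' g x w :
  ex_CInt (fun t => f (x - (w + RtoC t)) * g (w + RtoC t))%C 0 1 -> ex_CInt (fun t => f' (x - (w + RtoC t)) * g (w + RtoC t))%C 0 1 ->
  line_conv w (fun z => f z + f' z)%C g x = (line_conv w f g x + line_conv w f' g x)%C.
Proof. intros H1 H2. unfold line_conv. rewrite <- CInt_plus; auto. apply CInt_ext. intros; ring. Qed.

(** The line lies above x for the argument x + tau; the jump of f(. + tau) brings it below x, where
    f(. + tau) = f + Delta f can be split into two convolutions. *)
Lemma conv_Delta_step f g : normalized tau f -> normalized tau g -> exists E, normalized tau E /\
  (forall s, (forall z, Nat.iter s DD g z = 0%C) -> forall z, Nat.iter s DD E z = 0%C) /\
  forall x, 0 < Im x < T -> conv_integral f g (x + tau) = (conv_integral f g x + (conv_integral (DD f) g x + E x))%C.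
Proof.
  intros Hf Hg. assert (Hf1 := normalized_tau tau f Hf). assert (HDf := normalized_Delta tau f Hf).
  destruct (normalized_jump tau Htau _ Hf1 g Hg) as [E [E1 [E2 E3]]]. exists E; split; auto; split; auto.
  intros x Hx. assert (Pf := normalized_pstrip tau Htau f Hf). assert (Pg := normalized_pstrip tau Htau g Hg). assert (PD := normalized_pstrip tau Htau _ HDf).
  set (w := (0, (Im x + T) / 2)%R : C). set (w' := (0, Im x / 2)%R : C).
  assert (Hw : Im w = (Im x + T) / 2) by reflexivity. assert (Hw' : Im w' = Im x / 2) by reflexivity.
  rewrite (conv_eq_line_conv f g (x + tau) w), (conv_eq_line_conv f g x w'), (conv_eq_line_conv (DD f) g x w') by
    (auto; unfold strip; rewrite ?Im_minus, ?Im_plus; lra).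
  replace (line_conv w f g (x + tau)) with (line_conv w (fun z => f (z + tau)%C) g x).
  2: { unfold line_conv. apply CInt_ext. intros t. f_equal. f_equal. ring. }
  rewrite (E3 x w w') by (auto; unfold strip; lra).
  rewrite Cplus_assoc. f_equal. rewrite <- line_conv_plus_l.
  - apply CInt_ext. intros t. f_equal. unfold Defs.Delta. ring.
  - apply (ex_line_conv 0 T 0 T); auto; unfold strip; rewrite ?Im_minus; try lra. apply Pf. apply Pg.
  - apply (ex_line_conv 0 T 0 T); auto; unfold strip; rewrite ?Im_minus; try lra. apply PD. apply Pg.
Qed.

Fixpoint tau_sum (phi : C -> C) (n : nat) (y : C) : C :=
  match n with O => 0%C | S k => (tau_sum phi k y + phi (y + RtoC (INR k) * tau))%C end.

Lemma tau_sum_shift phi n y : tau_sum phi (S n) y = (phi y + tau_sum phi n (y + tau))%C.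
Proof.
  induction n. simpl. replace (y + 0 * tau)%C with y by ring. ring.
  change (tau_sum phi (S (S n)) y) with (tau_sum phi (S n) y + phi (y + RtoC (INR (S n)) * tau))%C. rewrite IHn. simpl tau_sum.
  rewrite S_INR, RtoC_plus. replace (y + (INR n + 1) * tau)%C with (y + tau + INR n * tau)%C by ring. ring.
Qed.

(** The solution of Phi_(n+1)(y) = Phi_n(y) + phi(y + n tau) with Phi_0 = 0, for all integers n: if
    Delta H = phi then H(y + n tau) = H(y) + Phi_n(y). *)
Definition tau_sumZ (phi : C -> C) (n : Z) (y : C) : C :=
  if Z_le_dec 0 n then tau_sum phi (Z.to_nat n) y else (- tau_sum phi (Z.to_nat (- n)) (y + RtoC (IZR n) * tau))%C.

Lemma tau_sumZ_S phi n y : tau_sumZ phi (n + 1) y = (tau_sumZ phi n y + phi (y + RtoC (IZR n) * tau))%C.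
Proof.
  unfold tau_sumZ. destruct (Z_le_dec 0 n), (Z_le_dec 0 (n + 1)); try lia.
  - replace (Z.to_nat (n + 1)) with (S (Z.to_nat n)) by lia. simpl. rewrite INR_IZR_INZ, Z2Nat.id by auto. auto.
  - replace n with (-1)%Z by lia. simpl. replace (y + -1 * tau + 0 * tau)%C with (y + -1 * tau)%C by ring. ring.
  - replace (Z.to_nat (- n)) with (S (Z.to_nat (- (n + 1)))) by lia. rewrite tau_sum_shift, plus_IZR, RtoC_plus.
    replace (y + (IZR n + 1) * tau)%C with (y + IZR n * tau + tau)%C by ring. ring.
Qed.

Lemma tau_sumZ_shift phi n y : tau_sumZ phi (n + 1) y = (phi y + tau_sumZ phi n (y + tau))%C.
Proof.
  unfold tau_sumZ. destruct (Z_le_dec 0 n), (Z_le_dec 0 (n + 1)); try lia.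
  - replace (Z.to_nat (n + 1)) with (S (Z.to_nat n)) by lia. apply tau_sum_shift.
  - replace n with (-1)%Z by lia. simpl. replace (y + tau + -1 * tau + 0 * tau)%C with y by ring. ring.
  - replace (Z.to_nat (- n)) with (S (Z.to_nat (- (n + 1)))) by lia. simpl tau_sum. rewrite INR_IZR_INZ, Z2Nat.id by lia.
    rewrite opp_IZR, plus_IZR, RtoC_opp, RtoC_plus.
    replace (y + tau + IZR n * tau)%C with (y + (IZR n + 1) * tau)%C by ring.
    replace (y + (IZR n + 1) * tau + - (IZR n + 1) * tau)%C with y by ring. ring.
Qed.

Lemma normalized_tau_sum phi n : normalized tau phi -> normalized tau (tau_sum phi n).
Proof.
  intros H. induction n. apply normalized_0. simpl. apply normalized_plus; auto.
  apply normalized_ext with (fun z => phi (z + RtoC (IZR (Z.of_nat n)) * tau)%C). intros z. rewrite <- INR_IZR_INZ. auto. apply normalized_translate; auto.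
Qed.

Lemma normalized_tau_sumZ phi n : normalized tau phi -> normalized tau (tau_sumZ phi n).
Proof.
  intros H. destruct (Z_le_dec 0 n) as [L|L] eqn:E.
  - apply normalized_ext with (tau_sum phi (Z.to_nat n)). intros z; unfold tau_sumZ; rewrite E; auto. apply normalized_tau_sum; auto.
  - apply normalized_ext with (fun z => - (1) * tau_sum phi (Z.to_nat (- n)) (z + RtoC (IZR n) * tau))%C. intros z; unfold tau_sumZ; rewrite E; ring.
    apply (normalized_scal tau (- (1))%C (fun z => tau_sum phi (Z.to_nat (- n)) (z + RtoC (IZR n) * tau)%C)). apply normalized_translate. apply normalized_tau_sum; auto.
Qed.

(** On the strip translated by n tau, H is h0 translated by n tau plus the sum of the n
    intermediate increments; consecutive definitions agree on the overlap by the functional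
    equation of h0, so H is holomorphic wherever h0 and the increments are. *)
Lemma glue (h0 phi : C -> C) : normalized tau phi ->
  (forall x, 0 < Im x < 2 * T -> (exists l, cder h0 x l) /\ h0 (x + 1)%C = h0 x) ->
  (forall x, 0 < Im x < T -> h0 (x + tau)%C = (h0 x + phi x)%C) ->
  exists H, normalized tau H /\ (forall x, 0 < Im x < 2 * T -> ~ Lam x -> H x = h0 x) /\ forall z, DD H z = phi z.
Proof.
  intros Hphi Hh0 Hstep.
  set (W := fun (n : Z) (x : C) => (h0 (x - RtoC (IZR n) * tau) + tau_sumZ phi n (x - RtoC (IZR n) * tau))%C).
  (* nn x is the index n with T/2 <= Im x - n T < 3T/2: a window of length T well inside the strip of
     width 2T, so that the same index still serves near x *)
  set (nn := fun x : C => Int_part (Im x / T - / 2)).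
  assert (Hnn : forall x, T / 2 <= Im x - IZR (nn x) * T < 3 * T / 2).
  { intros x. unfold nn. destruct (base_Int_part (Im x / T - / 2)) as [A B]. set (n := IZR (Int_part (Im x / T - / 2))) in *.
    assert (E : Im x = Im x / T * T) by (field; lra). rewrite E at 1 2.
    replace (Im x / T * T - n * T) with ((Im x / T - n) * T) by ring.
    assert (A' : / 2 <= Im x / T - n) by lra. assert (B' : Im x / T - n < 3 / 2) by lra.
    apply Rmult_le_compat_r with (r := T) in A'; [|lra]. apply Rmult_lt_compat_r with (r := T) in B'; lra. }
  set (H := fun x : C => if em (Lam x) then RtoC 0 else W (nn x) x).
  assert (HW1 : forall n x, IZR n * T + T < Im x < IZR n * T + 2 * T -> W n x = W (n + 1)%Z x).
  { intros n x Hx. unfold W. set (y := (x - RtoC (IZR (n + 1)) * tau)%C).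
    assert (E : (x - RtoC (IZR n) * tau)%C = (y + tau)%C) by (unfold y; rewrite plus_IZR, RtoC_plus; ring).
    rewrite E. rewrite Hstep. rewrite tau_sumZ_shift. ring. unfold y. rewrite Im_minus, im_scal_l, plus_IZR. lra. }
  assert (HW : forall n x, 0 < Im x - IZR n * T < 2 * T -> W (nn x) x = W n x).
  { intros n x Hx. assert (Hn := Hnn x). set (m := nn x) in *.
    assert (C : (m = n \/ n = m + 1 \/ m = n + 1)%Z).
    { assert (A1 : (n < m + 2)%Z). { apply lt_IZR. rewrite plus_IZR. apply Rmult_lt_reg_r with T; lra. }
      assert (A2 : (m < n + 2)%Z). { apply lt_IZR. rewrite plus_IZR. apply Rmult_lt_reg_r with T; lra. } lia. }
    destruct C as [->|[->| ->]]; auto.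
    - apply HW1. rewrite plus_IZR in Hx. lra.
    - symmetry. apply HW1. rewrite plus_IZR in Hn. lra. }
  assert (HH : forall n x, ~ Lam x -> 0 < Im x - IZR n * T < 2 * T -> H x = W n x).
  { intros n x Hx Hn. unfold H. destruct (em (Lam x)); [contradiction|]. apply HW; auto. }
  assert (Hband : forall n x, 0 < Im x - IZR n * T < 2 * T -> locally (T := C_UniformSpace) x (fun y => 0 < Im y - IZR n * T < 2 * T)).
  { intros n x Hx. apply locally_C_iff. exists (Rmin (Im x - IZR n * T) (IZR n * T + 2 * T - Im x)). split. apply Rmin_pos; lra.
    intros y Hy. apply (strip_disc (IZR n * T) (IZR n * T + 2 * T) x) in Hy. unfold strip in Hy; lra. unfold strip; lra. }
  assert (Hh0n : forall n x, 0 < Im x - IZR n * T < 2 * T -> exists l, cder (fun x => h0 (x - RtoC (IZR n) * tau)%C) x l).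
  { intros n x Hx. destruct (Hh0 (x - RtoC (IZR n) * tau)%C) as [[l Hl] _]. rewrite Im_minus, im_scal_l; auto.
    exists l. apply (cder_translate h0 (- (RtoC (IZR n) * tau))%C). exact Hl. }
  assert (HnnB : forall x, 0 < Im x - IZR (nn x) * T < 2 * T) by (intros x; generalize (Hnn x); lra).
  assert (Hz : forall n, normalized tau (fun x => tau_sumZ phi n (x - RtoC (IZR n) * tau)%C)).
  { intros n. apply normalized_ext with (fun x => tau_sumZ phi n (x + RtoC (IZR (- n)) * tau)%C).
    intros z. f_equal. rewrite opp_IZR, RtoC_opp. ring. apply (normalized_translate tau (tau_sumZ phi n) (- n)). apply normalized_tau_sumZ; auto. }
  exists H. split; [split|split].
  - intros z Hz1. destruct (Hh0n (nn z) z (HnnB z)) as [l Hl]. destruct (normalized_diff tau _ (Hz (nn z)) z Hz1) as [l' Hl'].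
    eexists. apply cder_ext_loc with (W (nn z)). 2: { apply cder_plus. exact Hl. exact Hl'. }
    assert (K := filter_and _ _ (lattice_locally tau Htau z Hz1) (Hband (nn z) z (HnnB z))).
    eapply filter_imp; [|exact K]. cbv beta. intros y [Y1 Y2]. symmetry. apply HH; auto.
  - intros z L. unfold H. destruct (em (Lam z)); auto. contradiction.
  - intros z. destruct (classic (Lam z)) as [L|L].
    + unfold H. destruct (em (Lam z)); [|contradiction]. destruct (em (Lam (z + 1)%C)) as [L'|L']; auto.
      exfalso. apply L'. apply (proj1 (lattice_1 tau z)); auto.
    + assert (L' : ~ Lam (z + 1)%C) by (rewrite <- lattice_1; auto). assert (B := HnnB z). set (n := nn z) in *.
      rewrite (HH n (z + 1)%C), (HH n z); auto. 2: { rewrite Im_plus, Im_RtoC. lra. }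
      unfold W. replace (z + 1 - RtoC (IZR n) * tau)%C with (z - RtoC (IZR n) * tau + 1)%C by ring.
      rewrite (normalized_per tau _ (normalized_tau_sumZ phi n Hphi)). f_equal. apply Hh0. rewrite Im_minus, im_scal_l; auto.
  - intros p Hp. assert (B := HnnB p). set (n := nn p) in *.
    apply mero_at_ext with (W n).
    + assert (K := near'_and _ _ _ (lattice_discrete tau Htau p) (near_near' _ _ (Hband n p B))).
      eapply near'_imp; [|exact K]. cbv beta. intros y [Y1 Y2]. symmetry. apply HH; auto.
    + apply (mero_at_plus (fun x => h0 (x - RtoC (IZR n) * tau)%C)).
      * apply reg_mero, cder_near_reg. eapply filter_imp; [|exact (Hband n p B)]. apply Hh0n.
      * apply (normalized_mero tau _ (Hz n)); auto.
  - intros x Hx Lx. rewrite (HH 0%Z x); auto. 2: lra. unfold W. replace (x - 0 * tau)%C with x by ring. unfold tau_sumZ. simpl. ring.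
  - intros z. destruct (classic (Lam z)) as [L|L].
    + unfold Defs.Delta. rewrite (normalized_zero tau phi Hphi z L). unfold H.
      destruct (em (Lam z)); [|contradiction]. destruct (em (Lam (z + tau)%C)) as [L'|L']; [ring|].
      exfalso. apply L'. apply (proj1 (lattice_tau tau z)); auto.
    + assert (L' : ~ Lam (z + tau)%C) by (rewrite <- lattice_tau; auto). assert (B := HnnB z). set (n := nn z) in *.
      unfold Defs.Delta. rewrite (HH (n + 1)%Z (z + tau)%C), (HH n z); auto. 2: { rewrite Im_plus, plus_IZR. lra. }
      unfold W. replace (z + tau - RtoC (IZR (n + 1)) * tau)%C with (z - RtoC (IZR n) * tau)%C by (rewrite plus_IZR, RtoC_plus; ring).
      rewrite tau_sumZ_S. replace (z - RtoC (IZR n) * tau + RtoC (IZR n) * tau)%C with z by ring. ring.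
Qed.

(** Induction on r through [conv_Delta_step] and [glue]: Delta H is the continuation of (Delta f) * g
    plus a jump, and both are killed by Delta^(r-1+s). *)
Theorem conv_continuation r : forall s f g, normalized_SK tau r f -> normalized_SK tau s g ->
  exists H, normalized_SK tau (r + s) H /\ forall x, 0 < Im x < 2 * T -> ~ Lam x -> H x = conv_integral f g x.
Proof.
  induction r; intros s f g [Hf Hf0] [Hg Hg0].
  - exists (fun _ => 0%C). split. apply normalized_SK_0. intros x _ _. rewrite conv_integral_line. unfold line_conv.
    rewrite (CInt_ext _ (fun _ => 0%C)). rewrite CInt_const. ring. intros t. simpl in Hf0. rewrite Hf0. ring.
  - destruct (IHr s (DD f) g) as [H1 [HH1 HH1']].
    { split. apply normalized_Delta; auto. intros z. rewrite <- iter_S. apply Hf0. } { split; auto. }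
    destruct (conv_Delta_step f g Hf Hg) as [E [E1 [E2 E3]]].
    assert (Hphi : normalized_SK tau (r + s) (fun z => H1 z + E z)%C).
    { apply normalized_SK_plus; auto. apply normalized_SK_le with s. lia. split; auto. }
    assert (Pf := normalized_pstrip tau Htau f Hf). assert (Pg := normalized_pstrip tau Htau g Hg).
    destruct (glue (conv_integral f g) (fun z => H1 z + E z)%C) as [H [HL [HC HD]]].
    + apply Hphi.
    + intros x Hx. split. apply conv_diff; auto. apply conv_per; auto.
    + intros x Hx. rewrite E3 by auto. rewrite HH1'; auto. lra. apply strip_nonlat; auto.
    + exists H. split; auto. split; auto. intros z. change (S r + s)%nat with (S (r + s)). rewrite iter_S.
      replace (DD H) with (fun z => H1 z + E z)%C. apply Hphi. apply functional_extensionality. intros; symmetry; apply HD.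
Qed.
End Continuation.

(** * Fubini's theorem on the unit square *)

Definition jointly_cts (k : R -> R -> C) : Prop :=
  forall s t eps, 0 < eps -> exists d, 0 < d /\ forall s' t', Rabs (s' - s) < d -> Rabs (t' - t) < d -> Cmod (k s' t' - k s t) < eps.

Lemma jointly_cts_of_continuous (k : R -> R -> C) :
  (forall s t, continuous (T := prod_UniformSpace R_UniformSpace R_UniformSpace) (U := C_UniformSpace) (fun q : R * R => k (fst q) (snd q)) (s, t)) -> jointly_cts k.
Proof.
  intros H s t eps He.
  assert (K : locally (T := C_UniformSpace) (k s t) (fun y => Cmod (y - k s t) < eps)).
  { apply locally_C_iff. exists eps; split; auto. }
  apply H in K. destruct K as [d K]. exists d; split. apply cond_pos.
  intros s' t' Hs Ht. apply (K (s', t')). split; assumption.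
Qed.

Lemma jointly_cts_swap k : jointly_cts k -> jointly_cts (fun s t => k t s).
Proof. intros H s t eps He. destruct (H t s eps He) as [d [Hd K]]. exists d; split; auto. Qed.

Lemma jointly_cts_fst k t s : jointly_cts k -> ctsR (fun s => k s t) s.
Proof.
  intros H. apply continuous_RC_iff. intros eps He. destruct (H s t eps He) as [d [Hd K]]. exists d; split; auto.
  intros s' Hs. apply K; auto. rewrite Rminus_diag, Rabs_R0; auto.
Qed.

Lemma jointly_cts_snd k s t : jointly_cts k -> ctsR (k s) t.
Proof. intros H. apply (jointly_cts_fst (fun t s => k s t)). apply jointly_cts_swap; auto. Qed.

Lemma jointly_cts_unif k s a b : jointly_cts k -> a <= b -> forall eps, 0 < eps ->
  exists d, 0 < d /\ forall s' t, Rabs (s' - s) < d -> a <= t <= b -> Cmod (k s' t - k s t) < eps.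
Proof.
  intros H Hab eps He.
  destruct (cts_unif (fun w t => k (Re w) t) (RtoC s) a b Hab) with (eps := eps) as [d [Hd K]]; auto.
  - intros t _ P HP. simpl in HP. apply locally_C_iff in HP. destruct HP as [e [He' HP]].
    destruct (H s t e He') as [d [Hd K]]. exists (mkposreal _ Hd). intros [w t'] [[Hw _] Ht]. apply HP, K. exact Hw. exact Ht.
  - exists d; split; auto. intros s' t Hs Ht. apply (K (RtoC s') t); auto. rewrite <- RtoC_minus, Cmod_R. auto.
Qed.

Lemma cts_CInt_jointly k a b s : jointly_cts k -> ctsR (fun s => CInt (k s) a b) s.
Proof.
  intros H. apply continuous_RC_iff. intros eps He. set (L := Rabs (b - a)). assert (HL : 0 <= L) by apply Rabs_pos.
  destruct (jointly_cts_unif k s (Rmin a b) (Rmax a b) H (Rminmax a b) (eps / (L + 1))) as [d [Hd K]]. apply Rdiv_lt_0_compat; lra.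
  assert (X : forall s, ex_CInt (k s) a b) by (intros; apply cts_ex_CInt_all; intros; apply jointly_cts_snd; auto).
  exists d; split; auto. intros s' Hs. rewrite <- CInt_minus by auto.
  apply Rle_lt_trans with (eps / (L + 1) * L).
  - apply Cmod_CInt_le. intros t Ht. apply Rlt_le, K; auto. apply ex_CInt_minus; auto.
  - replace (eps / (L + 1) * L) with (eps * (L / (L + 1))) by (field; lra). rewrite <- (Rmult_1_r eps) at 2.
    apply Rmult_lt_compat_l; auto. apply Rlt_div_l; lra.
Qed.

(** As functions of the upper bound u of the variable s, the difference of the two iterated integrals
    has derivative zero, by uniform continuity in t. *)
Lemma CInt_fubini k : jointly_cts k -> CInt (fun s => CInt (k s) 0 1) 0 1 = CInt (fun t => CInt (fun s => k s t) 0 1) 0 1.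
Proof.
  intros H. assert (H' := jointly_cts_swap k H).
  set (A := fun u => CInt (fun s => CInt (k s) 0 1) 0 u). set (B := fun u => CInt (fun t => CInt (fun s => k s t) 0 u) 0 1).
  assert (X1 : forall s a b, ex_CInt (k s) a b) by (intros; apply cts_ex_CInt_all; intros; apply jointly_cts_snd; auto).
  assert (X2 : forall t a b, ex_CInt (fun s => k s t) a b) by (intros; apply cts_ex_CInt_all; intros; apply jointly_cts_fst; auto).
  assert (X3 : forall a b, ex_CInt (fun s => CInt (k s) 0 1) a b) by (intros; apply cts_ex_CInt_all; intros; apply cts_CInt_jointly; auto).
  assert (X4 : forall a b, ex_CInt (fun t => CInt (fun s => k s t) a b) 0 1).
  { intros; apply cts_ex_CInt_all; intros; apply (cts_CInt_jointly (fun t s => k s t)); auto. }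
  assert (Xc : forall (c : C) a b, ex_CInt (fun _ => c) a b) by (intros; apply cts_ex_CInt_all; intros; apply cts_const).
  assert (D : forall u : R, rder (fun u : R => (A u - B u)%C) u (RtoC 0)).
  { intros u. apply rder_iff. intros eps He.
    destruct (jointly_cts_unif k u 0 1 H Rle_0_1 (eps / 2)) as [d [Hd K]]. lra.
    exists d; split; auto. intros u' Hu'.
    assert (K' : forall s t, Rmin u u' <= s <= Rmax u u' -> 0 <= t <= 1 -> Cmod (k s t - k u t) <= eps / 2).
    { intros s t Hs Ht. apply Rlt_le, K; auto. apply Rle_lt_trans with (2 := Hu').
      unfold Rmin, Rmax in Hs. destruct (Rle_dec u u'). rewrite !Rabs_pos_eq; lra. rewrite !Rabs_left1; lra. }
    replace (A u' - B u' - (A u - B u) - 0 * RtoC (u' - u))%C with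
     (CInt (fun s => CInt (fun t => k s t - k u t)%C 0 1) u u' - CInt (fun t => CInt (fun s => k s t - k u t)%C u u') 0 1)%C.
    2: { assert (EA : A u' = (A u + CInt (fun s => CInt (k s) 0 1) u u')%C) by (symmetry; apply CInt_Chasles; auto).
         assert (EB : B u' = (B u + CInt (fun t => CInt (fun s => k s t) u u') 0 1)%C).
         { unfold B. rewrite <- CInt_plus by auto. apply CInt_ext. intros t. symmetry. apply CInt_Chasles; auto. }
         rewrite EA, EB.
         rewrite (CInt_ext (fun s => CInt (fun t => k s t - k u t)%C 0 1) (fun s => CInt (k s) 0 1 - CInt (k u) 0 1)%C) by (intros; apply CInt_minus; auto).
         rewrite (CInt_ext (fun t => CInt (fun s => k s t - k u t)%C u u') (fun t => CInt (fun s => k s t) u u' - RtoC (u' - u) * k u t)%C).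
         2: { intros t. rewrite CInt_minus by auto. rewrite CInt_const. auto. }
         rewrite !CInt_minus; auto. rewrite CInt_const, CInt_scal by auto. ring. apply ex_CInt_scal; auto. }
    cmod_tri. rewrite Cmod_opp.
    apply Rle_trans with (eps / 2 * Rabs (u' - u) + eps / 2 * Rabs (u' - u)). 2: lra.
    apply Rplus_le_compat.
    - apply Cmod_CInt_le.
      + intros s Hs. replace (eps / 2) with (eps / 2 * Rabs (1 - 0)) by (rewrite Rminus_0_r, Rabs_R1; ring).
        apply Cmod_CInt_le. rewrite Rmin_left, Rmax_right by lra. intros; apply K'; auto. apply ex_CInt_minus; auto.
      + apply (cts_ex_CInt_all). intros s. apply (continuous_ext (fun s => CInt (k s) 0 1 - CInt (k u) 0 1)%C).
        intros y. symmetry. apply CInt_minus; auto. apply cts_minus. apply cts_CInt_jointly; auto. apply cts_const.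
    - replace (eps / 2 * Rabs (u' - u)) with (eps / 2 * Rabs (u' - u) * Rabs (1 - 0)) by (rewrite Rminus_0_r, Rabs_R1; ring).
      apply Cmod_CInt_le.
      + rewrite Rmin_left, Rmax_right by lra. intros t Ht. apply Cmod_CInt_le. intros; apply K'; auto. apply ex_CInt_minus; auto.
      + apply (cts_ex_CInt_all). intros t. apply (continuous_ext (fun t => CInt (fun s => k s t) u u' - RtoC (u' - u) * k u t)%C).
        intros y. symmetry. rewrite CInt_minus, CInt_const by auto. auto. apply cts_minus. apply (cts_CInt_jointly (fun t s => k s t)); auto.
        apply cts_mult. apply cts_const. apply jointly_cts_snd; auto. }
  assert (E := CInt_derive (fun u => A u - B u)%C (fun _ => RtoC 0) 0 1 (fun u _ => D u) (fun u _ => cts_const (RtoC 0) u)).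
  rewrite CInt_const in E.
  assert (A0 : A 0 = 0%C). { unfold A. apply is_CInt_unique. apply (is_RInt_point (V := C_R_NormedModule)). }
  assert (B0 : B 0 = 0%C). { unfold B. rewrite (CInt_ext _ (fun _ => 0%C)). rewrite CInt_const. ring. intros t. apply is_CInt_unique. apply (is_RInt_point (V := C_R_NormedModule)). }
  rewrite A0, B0 in E. change (A 1 = B 1). replace (A 1) with ((A 1 - B 1 - (0 - 0)) + B 1)%C by ring. rewrite <- E. ring.
Qed.

(** * Convolution of classes modulo constants *)

(** A closed discrete set meets [0, 1] in finitely many points, which do not affect the integral;
    [cousin] avoids counting them. *)
Lemma CInt_near_eq (phi psi : R -> C) : (forall t, ctsR psi t) ->
  (forall t, exists d, 0 < d /\ forall s, Rabs (s - t) < d -> s <> t -> phi s = psi s) -> is_CInt phi 0 1 (CInt psi 0 1).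
Proof.
  intros Hc H.
  assert (X : forall a b, is_CInt psi a b (CInt psi a b)) by (intros; apply CInt_correct, cts_ex_CInt_all; auto).
  apply (cousin (fun u v => is_CInt phi u v (CInt psi u v)) 0 1 Rle_0_1).
  - intros u v w _ H1 H2. rewrite <- (CInt_Chasles psi u v w) by (apply cts_ex_CInt_all; auto).
    apply (is_RInt_Chasles (V := C_R_NormedModule) phi u v w _ _ H1 H2).
  - intros t _. destruct (H t) as [d [Hd K]]. exists d; split; auto. intros u v Hu Hv _ _.
    rewrite <- (CInt_Chasles psi u t v) by (apply cts_ex_CInt_all; auto).
    apply (is_RInt_Chasles (V := C_R_NormedModule) phi u t v).
    + apply (is_RInt_ext (V := C_R_NormedModule) psi); auto. rewrite Rmin_left, Rmax_right by lra. intros s Hs. symmetry. apply K. apply Rabs_def1; lra. lra.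
    + apply (is_RInt_ext (V := C_R_NormedModule) psi); auto. rewrite Rmin_left, Rmax_right by lra. intros s Hs. symmetry. apply K. apply Rabs_def1; lra. lra.
Qed.

Section Classes.
Variable tau : C.
Hypothesis Htau : 0 < Im tau.
Notation T := (Im tau).
Notation Lam := (lattice tau).
Notation DD := (Defs.Delta tau).
Notation SKm := (SK_mod tau).

(** Splits membership in a class into data that hold pointwise and one equality up to a discrete
    set, so that the values of f at exceptional points are met only once. *)
Lemma SK_mod_iff k f : SKm k f <-> exists f1 c, normalized_SK tau k f1 /\ mero_eq f (fun z => f1 z + c)%C.
Proof.
  split.
  - intros [f0 [H0 [c Hc]]]. destruct (SK_normalize tau Htau k f0 H0) as [HL HE]. exists (normalize tau f0), c. split; auto.
    intros p. generalize (near'_and _ _ _ (Hc p) (HE p)). apply near'_imp. unfold sub_fun. intros z [E ->].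
    replace (f z) with (f0 z + (f z - f0 z))%C by ring. rewrite E. auto.
  - intros [f1 [c [HL HE]]]. exists f1. split. apply normalized_SK_SK; auto. exists c. intros p. eapply near'_imp; [|exact (HE p)].
    unfold sub_fun. intros z ->. ring.
Qed.

Lemma pstrip_add_const a b f c : pstrip a b f -> pstrip a b (fun z => f z + c)%C.
Proof. intros [A B]. split. apply holo_plus; auto. apply holo_const. intros z Hz. rewrite B; auto. Qed.

Lemma is_conv_integral f g F G x : mero_eq f F -> mero_eq g G -> pstrip 0 T F -> pstrip 0 T G -> 0 < Im x < 2 * T ->
  is_CInt (fun t => f (x - ((0, Im x / 2)%R + RtoC t)) * g ((0, Im x / 2)%R + RtoC t))%C 0 1 (conv_integral F G x).
Proof.
  intros Ef Eg PF PG Hx. destruct (half_strip tau x Hx) as [H1 H2]. rewrite conv_integral_line. set (w := (0, Im x / 2)%R : C) in *.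
  apply CInt_near_eq.
  - intros t. apply (line_conv_integrand_cts 0 T 0 T F G); auto. apply PF. apply PG.
  - intros t. assert (A := Ef (x - (w + RtoC t))%C). assert (B := Eg (w + RtoC t)%C).
    apply locally'_C_iff in A, B. destruct A as [d1 [Hd1 A]]. destruct B as [d2 [Hd2 B]].
    exists (Rmin d1 d2). split. apply Rmin_pos; auto. intros s Hs Ns. apply Rmin_Rgt_l in Hs as [S1 S2].
    assert (NN : RtoC (s - t) <> 0%C) by (intros E; apply RtoC_inj in E; lra).
    assert (E1 : (w + RtoC s - (w + RtoC t))%C = RtoC (s - t)) by (rewrite RtoC_minus; ring).
    assert (E2 : (x - (w + RtoC s) - (x - (w + RtoC t)))%C = (- RtoC (s - t))%C) by (rewrite RtoC_minus; ring).
    rewrite A, B; auto.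
    + rewrite E1, Cmod_R. exact S2.
    + intros E. apply NN. rewrite <- E1, E. ring.
    + rewrite E2, Cmod_opp, Cmod_R. exact S1.
    + intros E. apply NN. replace (RtoC (s - t)) with (- (- RtoC (s - t)))%C by ring. rewrite <- E2, E. ring.
Qed.

Lemma conv_integral_mero_eq f g F G x : mero_eq f F -> mero_eq g G -> pstrip 0 T F -> pstrip 0 T G -> 0 < Im x < 2 * T ->
  conv_integral f g x = conv_integral F G x.
Proof. intros. rewrite conv_integral_line. apply is_CInt_unique, is_conv_integral; auto. Qed.

(** The cross terms are constants times integrals over one period, which depend neither on x nor on
    the height. *)
Lemma conv_integral_classes f1 g1 a b : normalized tau f1 -> normalized tau g1 -> exists K, forall f g,
  mero_eq f (fun z => f1 z + a)%C -> mero_eq g (fun z => g1 z + b)%C ->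
  forall x, 0 < Im x < 2 * T -> conv_integral f g x = (conv_integral f1 g1 x + K)%C.
Proof.
  intros Hf Hg. assert (Pf := normalized_pstrip tau Htau f1 Hf). assert (Pg := normalized_pstrip tau Htau g1 Hg).
  set (w0 := (0, T / 2)%R : C). assert (W0 : strip 0 T w0) by (unfold strip, w0; simpl; lra).
  (* reflected, so that the integral of f1 (x - z) over z is a period integral based at w - x *)
  set (F0 := fun z => f1 (- z)%C).
  assert (PF0 : pstrip (- T) 0 F0).
  { split. intros z Hz. destruct (proj1 Pf (- z)%C) as [l Hl]. unfold strip in *. change (Im (- z)) with (- Im z). lra.
    eexists. apply (cder_comp f1 (fun z => - z)%C). exact Hl. apply cder_opp, cder_id.
    intros z Hz. unfold F0. rewrite <- (normalized_per tau f1 Hf (- (z + 1))%C). f_equal. ring. }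
  exists (b * CInt (fun t => F0 (- w0 + RtoC t)%C) 0 1 + a * CInt (fun t => g1 (w0 + RtoC t)%C) 0 1 + a * b)%C.
  intros f g Ef Eg x Hx. rewrite (conv_integral_mero_eq f g _ _ x Ef Eg) by (auto; apply pstrip_add_const; auto).
  destruct (half_strip tau x Hx) as [H1 H2]. rewrite !conv_integral_line. set (w := (0, Im x / 2)%R : C) in *.
  assert (Cf : forall t, ctsR (fun t => f1 (x - (w + RtoC t))%C) t).
  { intros t. apply (cts_comp (fun t : R => x - (w + RtoC t))%C f1). apply cts_minus. apply cts_const. apply cts_line.
    eapply holo_cts. apply Pf. unfold strip in *. rewrite Im_minus in *. rewrite Im_plus, Im_RtoC. lra. }
  assert (Cg : forall t, ctsR (fun t => g1 (w + RtoC t)%C) t).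
  { intros t. apply (cts_comp (fun t : R => w + RtoC t)%C g1). apply cts_line. eapply holo_cts. apply Pg. apply strip_real; auto. }
  assert (Xf : ex_CInt (fun t => f1 (x - (w + RtoC t))%C) 0 1) by (apply cts_ex_CInt_all; auto).
  assert (Xg : ex_CInt (fun t => g1 (w + RtoC t)%C) 0 1) by (apply cts_ex_CInt_all; auto).
  assert (Xfg : ex_CInt (fun t => f1 (x - (w + RtoC t)) * g1 (w + RtoC t))%C 0 1) by (apply (ex_line_conv 0 T 0 T); auto; [apply Pf | apply Pg]).
  assert (Xc : ex_CInt (fun _ => a * b)%C 0 1) by (apply cts_ex_CInt_all; intros; apply cts_const).
  replace (CInt (fun t => F0 (- w0 + RtoC t)%C) 0 1) with (CInt (fun t => f1 (x - (w + RtoC t))%C) 0 1).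
  2: { rewrite (CInt_ext _ (fun t => F0 ((w - x) + RtoC t)%C)). 2: { intros t. unfold F0. f_equal. ring. }
       apply (period_integral_const (- T) 0 F0); auto. unfold strip in *. rewrite Im_minus in *. lra.
       unfold strip in *. change (Im (- w0)) with (- Im w0). lra. }
  replace (CInt (fun t => g1 (w0 + RtoC t)%C) 0 1) with (CInt (fun t => g1 (w + RtoC t)%C) 0 1).
  2: { apply (period_integral_const 0 T g1); auto. }
  unfold line_conv. set (A := fun t : R => (f1 (x - (w + RtoC t)) * g1 (w + RtoC t))%C) in *.
  set (F := fun t : R => f1 (x - (w + RtoC t))%C) in *. set (G := fun t : R => g1 (w + RtoC t)%C) in *.
  assert (XF := ex_CInt_scal b F 0 1 Xf). assert (XG := ex_CInt_scal a G 0 1 Xg).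
  transitivity (CInt (fun t => (A t + b * F t) + (a * G t + a * b))%C 0 1).
  { apply CInt_ext. intros t. unfold A, F, G. ring. }
  rewrite (CInt_plus (fun t => A t + b * F t)%C (fun t => a * G t + a * b)%C 0 1 (ex_CInt_plus _ _ _ _ Xfg XF) (ex_CInt_plus _ _ _ _ XG Xc)).
  rewrite (CInt_plus A _ 0 1 Xfg XF), (CInt_plus _ _ 0 1 XG Xc), (CInt_scal b F 0 1 Xf), (CInt_scal a G 0 1 Xg), CInt_const.
  rewrite Rminus_0_r. ring.
Qed.

(** The continuation of [conv_continuation] may differ from the integral at the lattice points on
    the line Im x = Im tau, where it is normalized to 0; the integral is kept on the whole strip. *)
Lemma conv_exists r s f g : SKm r f -> SKm s g -> exists h, is_conv tau f g h /\ SKm (r + s) h.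
Proof.
  intros Hf Hg. apply SK_mod_iff in Hf, Hg. destruct Hf as [f1 [a [Lf Ef]]]. destruct Hg as [g1 [b [Lg Eg]]].
  destruct (conv_integral_classes f1 g1 a b (proj1 Lf) (proj1 Lg)) as [K HK]. specialize (HK f g Ef Eg).
  destruct (conv_continuation tau Htau r s f1 g1 Lf Lg) as [H [LH HH]].
  set (inS := fun x : C => 0 < Im x < 2 * T).
  set (h := fun x => if em (inS x) then conv_integral f g x else (H x + K)%C).
  assert (Eh : mero_eq h (fun z => H z + K)%C).
  { intros p. eapply near'_imp; [|exact (lattice_discrete tau Htau p)]. cbv beta. intros z Hz. unfold h.
    destruct (em (inS z)) as [Z|Z]; auto. rewrite HK, HH; auto. }
  assert (Hq := normalized_qmero tau Htau H (proj1 LH)). destruct Hq as [Q1 [Q2 Q3]].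
  exists h. split. split; [|split].
  - apply meromorphic_ext with (fun z => H z + K)%C. apply mero_eq_sym; auto.
    apply meromorphic_plus; auto. apply meromorphic_iff. intros; apply mero_at_const.
  - intros p. generalize (near'_and _ _ _ (mero_eq_shift _ _ 1%C Eh p) (Eh p)). apply near'_imp. cbv beta. intros z [-> ->].
    rewrite (normalized_per tau H (proj1 LH)). auto.
  - intros x Hx. unfold h. destruct (em (inS x)) as [Z|Z]; auto. contradiction.
  - apply SK_mod_iff. exists H, K. auto.
Qed.

Lemma disc_in_strip x : cdisc (0, T / 2)%R (T / 2) x -> 0 < Im x < T.
Proof.
  unfold cdisc. intros H. assert (K := im_le_Cmod (x - (0, T / 2)%R)). assert (K2 := Rle_lt_trans _ _ _ K H).
  rewrite Im_minus in K2. simpl in K2. apply Rabs_def2 in K2. lra.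
Qed.

Lemma strip_identity f g : meromorphic f -> meromorphic g -> (forall x, 0 < Im x < T -> f x = g x) -> mero_eq f g.
Proof.
  intros Hf Hg H. apply identity_theorem with (0, T / 2)%R (T / 2); auto. lra. intros z Hz. apply H, disc_in_strip, Hz.
Qed.

Lemma is_conv_unique f g h h' : is_conv tau f g h -> is_conv tau f g h' -> mero_eq h h'.
Proof.
  intros [A [_ B]] [A' [_ B']]. apply strip_identity; auto. intros x Hx. rewrite B, B' by lra. auto.
Qed.

Lemma conv_is_conv r s f g : SKm r f -> SKm s g -> is_conv tau f g (conv tau f g).
Proof. intros Hf Hg. destruct (conv_exists r s f g Hf Hg) as [h [Hh _]]. unfold conv. apply epsilon_spec. exists h; auto. Qed.

Lemma SK_mod_ext k f g : mero_eq f g -> SKm k f -> SKm k g.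
Proof.
  rewrite !SK_mod_iff. intros H [f1 [c [L E]]]. exists f1, c. split; auto. eapply mero_eq_trans; [|exact E]. apply mero_eq_sym; auto.
Qed.

Lemma is_conv_SK r s f g h : SKm r f -> SKm s g -> is_conv tau f g h -> SKm (r + s) h.
Proof.
  intros Hf Hg Hh. destruct (conv_exists r s f g Hf Hg) as [h' [Hh' Hs]]. apply SK_mod_ext with h'; auto. eapply is_conv_unique; eauto.
Qed.

(** Equalities modulo constants need only be checked on one strip. *)
Lemma constant_of_strip A B c : meromorphic A -> meromorphic B -> (forall x, 0 < Im x < T -> A x = (B x + c)%C) -> constant_fun (sub_fun A B).
Proof.
  intros HA HB H. exists c. assert (E : mero_eq A (fun z => B z + c)%C).
  { apply strip_identity; auto. apply meromorphic_plus; auto. apply meromorphic_iff. intros; apply mero_at_const. }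
  intros p. eapply near'_imp; [|exact (E p)]. unfold sub_fun. intros z ->. ring.
Qed.
End Classes.

(** * The filtered algebra *)

Section Algebra.
Variable tau : C.
Hypothesis Htau : 0 < Im tau.
Notation T := (Im tau).
Notation Lam := (lattice tau).
Notation SKm := (SK_mod tau).

(** Both sides equal the integral over the unit square of
    f(x - u - t) g((u + t) - (w + s)) h(w + s), with Im u = Im x / 2 and Im w = Im x / 4: the heights
    are chosen so that all three arguments stay in the basic strip. *)
Lemma conv_assoc_normalized f g h P Q : normalized tau f -> normalized tau g -> normalized tau h -> normalized tau P -> normalized tau Q ->
  (forall x, 0 < Im x < T -> P x = conv_integral f g x) -> (forall x, 0 < Im x < T -> Q x = conv_integral g h x) ->
  forall x, 0 < Im x < T -> conv_integral P h x = conv_integral f Q x.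
Proof.
  intros Hf Hg Hh HP HQ EP EQ x Hx.
  assert (Pf := normalized_pstrip tau Htau f Hf). assert (Pg := normalized_pstrip tau Htau g Hg). assert (Ph := normalized_pstrip tau Htau h Hh).
  assert (PP := normalized_pstrip tau Htau P HP). assert (PQ := normalized_pstrip tau Htau Q HQ).
  set (y := Im x) in *. set (w := (0, y / 4)%R : C). set (u := (0, y / 2)%R : C).
  assert (Iw : Im w = y / 4) by reflexivity. assert (Iu : Im u = y / 2) by reflexivity.
  set (k := fun s t : R => (f (x - (u + RtoC t)) * g ((u + RtoC t) - (w + RtoC s)) * h (w + RtoC s))%C).
  rewrite (conv_eq_line_conv tau P h x w), (conv_eq_line_conv tau f Q x u) by (auto; unfold strip; rewrite ?Im_minus; fold y; lra).
  assert (Jk : jointly_cts k).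
  { apply jointly_cts_of_continuous. intros s t. pose (U := prod_UniformSpace R_UniformSpace R_UniformSpace).
    assert (C1 : continuous (T := U) (U := C_UniformSpace) (fun q => u + RtoC (snd q))%C (s, t)).
    { apply (cts_plus (U := U)). apply cts_const. apply (cts_RtoC (U := U)). apply (continuous_snd (U := R_UniformSpace) (V := R_UniformSpace)). }
    assert (C2 : continuous (T := U) (U := C_UniformSpace) (fun q => w + RtoC (fst q))%C (s, t)).
    { apply (cts_plus (U := U)). apply cts_const. apply (cts_RtoC (U := U)). apply (continuous_fst (U := R_UniformSpace) (V := R_UniformSpace)). }
    unfold k. apply (cts_mult (U := U)). apply (cts_mult (U := U)).
    - apply (cts_comp (U := U) (fun q => x - (u + RtoC (snd q)))%C f). apply (cts_minus (U := U)); auto. apply cts_const.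
      eapply holo_cts. apply Pf. unfold strip. simpl snd. rewrite Im_minus, Im_plus, Im_RtoC. fold y. lra.
    - apply (cts_comp (U := U) (fun q => (u + RtoC (snd q)) - (w + RtoC (fst q)))%C g). apply (cts_minus (U := U)); auto.
      eapply holo_cts. apply Pg. unfold strip. simpl. lra.
    - apply (cts_comp (U := U) (fun q => w + RtoC (fst q))%C h); auto.
      eapply holo_cts. apply Ph. unfold strip. simpl. lra. }
  transitivity (CInt (fun s => CInt (k s) 0 1) 0 1).
  - apply CInt_ext. intros s. set (v := (x - (w + RtoC s))%C).
    assert (Iv : Im v = 3 * y / 4) by (unfold v; rewrite Im_minus, Im_plus, Im_RtoC; fold y; lra).
    rewrite EP by (rewrite Iv; lra).
    rewrite (conv_eq_line_conv tau f g v (u - (w + RtoC s))%C); auto; unfold strip; rewrite ?Im_minus, ?Im_plus, ?Im_RtoC; try (fold y; lra).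
    rewrite Cmult_comm. unfold line_conv. rewrite <- CInt_scal.
    + apply CInt_ext. intros t. unfold k, v.
      replace (x - (w + s) - (u - (w + s) + t))%C with (x - (u + t))%C by ring.
      replace (u - (w + s) + t)%C with (u + t - (w + s))%C by ring. ring.
    + apply (ex_line_conv 0 T 0 T); auto. apply Pf. apply Pg.
      unfold strip; rewrite ?Im_minus, ?Im_plus, ?Im_RtoC; fold y; lra. unfold strip; rewrite ?Im_minus, ?Im_plus, ?Im_RtoC; fold y; lra.
  - rewrite CInt_fubini by auto. apply CInt_ext. intros t. set (v := (u + RtoC t)%C).
    assert (Iv : Im v = y / 2) by (unfold v; rewrite Im_plus, Im_RtoC; lra).
    rewrite EQ by (rewrite Iv; lra).
    rewrite (conv_eq_line_conv tau g h v w); auto; unfold strip; rewrite ?Im_minus; try lra.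
    unfold line_conv. rewrite <- CInt_scal.
    + apply CInt_ext. intros s. unfold k. fold v. ring.
    + apply (ex_line_conv 0 T 0 T); auto. apply Pg. apply Ph. unfold strip; lra. unfold strip; rewrite Im_minus; lra.
Qed.

Lemma SK_mod_add k f g : SKm k f -> SKm k g -> SKm k (add_fun f g).
Proof.
  rewrite !SK_mod_iff by auto. intros [f1 [a [Lf Ef]]] [g1 [b [Lg Eg]]]. exists (fun z => f1 z + g1 z)%C, (a + b)%C.
  split. apply normalized_SK_plus; auto. intros p. generalize (near'_and _ _ _ (Ef p) (Eg p)). apply near'_imp. unfold add_fun. intros z [-> ->]. ring.
Qed.

Lemma SK_mod_scal k c f : SKm k f -> SKm k (scal_fun c f).
Proof.
  rewrite !SK_mod_iff by auto. intros [f1 [a [Lf Ef]]]. exists (fun z => c * f1 z)%C, (c * a)%C.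
  split. apply normalized_SK_scal; auto. intros p. eapply near'_imp; [|exact (Ef p)]. unfold scal_fun. intros z ->. ring.
Qed.

Lemma SK_mod_le j k f : (j <= k)%nat -> SKm j f -> SKm k f.
Proof.
  intros Hjk. rewrite !SK_mod_iff by auto. intros [f1 [a [Lf Ef]]]. exists f1, a. split; auto. apply normalized_SK_le with j; auto.
Qed.

Lemma SK_mod_add_max r s f g : SKm r f -> SKm s g -> SKm (Nat.max r s) (add_fun f g).
Proof. intros Hf Hg. apply SK_mod_add; [apply SK_mod_le with r | apply SK_mod_le with s]; auto; lia. Qed.

Lemma constant_SK_mod k f : constant_fun f -> SKm k f.
Proof.
  intros [c H]. apply SK_mod_iff; auto. exists (fun _ => 0%C), c. split. apply normalized_SK_0. eapply mero_eq_trans. exact H. apply mero_eq_ext. intros; ring.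
Qed.

Lemma constant_subspace : subspace constant_fun.
Proof.
  split; [|split].
  - exists 0%C. apply mero_eq_ext; auto.
  - intros f g [a A] [b B]. exists (a + b)%C. intros p. generalize (near'_and _ _ _ (A p) (B p)). apply near'_imp. unfold add_fun. intros z [-> ->]. auto.
  - intros c f [a A]. exists (c * a)%C. intros p. eapply near'_imp; [|exact (A p)]. unfold scal_fun. intros z ->. auto.
Qed.

Lemma conv_val r s f g x : SKm r f -> SKm s g -> 0 < Im x < T -> conv tau f g x = conv_integral f g x.
Proof. intros Hf Hg Hx. apply (conv_is_conv tau Htau r s f g Hf Hg). lra. Qed.

Lemma conv_mero r s f g : SKm r f -> SKm s g -> meromorphic (conv tau f g).
Proof. intros Hf Hg. apply (conv_is_conv tau Htau r s f g Hf Hg). Qed.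

(** Linearity of the integral is applied to the given functions themselves, whose values on a
    discrete set are arbitrary. *)
Lemma class_integrable r s f g x : SKm r f -> SKm s g -> 0 < Im x < 2 * T ->
  ex_CInt (fun t => f (x - ((0, Im x / 2)%R + RtoC t)) * g ((0, Im x / 2)%R + RtoC t))%C 0 1.
Proof.
  rewrite !SK_mod_iff by auto. intros [f1 [a [[Lf _] Ef]]] [g1 [b [[Lg _] Eg]]] Hx.
  eexists. apply (is_conv_integral tau f g _ _ x Ef Eg); auto; apply pstrip_add_const, normalized_pstrip; auto.
Qed.

Lemma conv_classes r s f g f1 g1 a b : SKm r f -> SKm s g -> normalized tau f1 -> normalized tau g1 ->
  mero_eq f (fun z => f1 z + a)%C -> mero_eq g (fun z => g1 z + b)%C ->
  exists K, forall x, 0 < Im x < T -> conv tau f g x = (conv_integral f1 g1 x + K)%C.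
Proof.
  intros Hf Hg Lf Lg Ef Eg. destruct (conv_integral_classes tau Htau f1 g1 a b Lf Lg) as [K HK]. exists K.
  intros x Hx. rewrite (conv_val r s) by auto. apply HK; auto. lra.
Qed.

Lemma conv_filtered_algebra : filtered_algebra_mod constant_fun SKm (conv tau).
Proof.
  constructor.
  - apply constant_subspace.
  - intros k. split; [|split]. apply constant_SK_mod. apply constant_subspace. apply SK_mod_add. intros; apply SK_mod_scal; auto.
  - apply constant_SK_mod.
  - intros k f. apply SK_mod_le. lia.
  - intros r s f g Hf Hg. eapply is_conv_SK; eauto. eapply conv_is_conv; eauto.
  - intros r s f f' g g' Hf Hf' Hg Hg' [c Hc] [d Hd].
    destruct (proj1 (SK_mod_iff tau Htau _ _) Hf) as [f1 [a [[Lf _] Ef]]]. destruct (proj1 (SK_mod_iff tau Htau _ _) Hg) as [g1 [b [[Lg _] Eg]]].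
    assert (Ef' : mero_eq f' (fun z => f1 z + (a - c))%C).
    { intros p. generalize (near'_and _ _ _ (Ef p) (Hc p)). apply near'_imp. unfold sub_fun. intros z [E1 E2].
      replace (f' z) with (f z - (f z - f' z))%C by ring. rewrite E2, E1. ring. }
    assert (Eg' : mero_eq g' (fun z => g1 z + (b - d))%C).
    { intros p. generalize (near'_and _ _ _ (Eg p) (Hd p)). apply near'_imp. unfold sub_fun. intros z [E1 E2].
      replace (g' z) with (g z - (g z - g' z))%C by ring. rewrite E2, E1. ring. }
    destruct (conv_classes r s f g f1 g1 a b) as [K HK]; auto.
    destruct (conv_classes r s f' g' f1 g1 (a - c) (b - d)) as [K' HK']; auto.
    apply (constant_of_strip tau Htau _ _ (K - K')); try (eapply conv_mero; eauto). intros x Hx. rewrite HK, HK' by auto. ring.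
  - intros r s t f g h Hf Hg Hh. assert (Hfg := SK_mod_add_max r s f g Hf Hg).
    apply (constant_of_strip tau Htau _ _ 0). eapply conv_mero; eauto. apply meromorphic_plus; eapply conv_mero; eauto.
    intros x Hx. unfold add_fun at 2. rewrite (conv_val _ _ _ _ x Hfg Hh), (conv_val r t f h), (conv_val s t g h), !conv_integral_line by auto.
    unfold line_conv. rewrite Cplus_0_r, <- CInt_plus by (eapply class_integrable; eauto; lra).
    apply CInt_ext. intros; unfold add_fun; ring.
  - intros r s t f g h Hf Hg Hh. assert (Hgh := SK_mod_add_max s t g h Hg Hh).
    apply (constant_of_strip tau Htau _ _ 0). eapply conv_mero; eauto. apply meromorphic_plus; eapply conv_mero; eauto.
    intros x Hx. unfold add_fun at 2. rewrite (conv_val _ _ _ _ x Hf Hgh), (conv_val r s f g), (conv_val r t f h), !conv_integral_line by auto.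
    unfold line_conv. rewrite Cplus_0_r, <- CInt_plus by (eapply class_integrable; eauto; lra).
    apply CInt_ext. intros; unfold add_fun; ring.
  - intros r s k f g Hf Hg. assert (Hkf := SK_mod_scal r k f Hf).
    apply (constant_of_strip tau Htau _ _ 0). eapply conv_mero; eauto. apply meromorphic_scal. eapply conv_mero; eauto.
    intros x Hx. unfold scal_fun at 2. rewrite (conv_val _ _ _ _ x Hkf Hg), (conv_val r s f g), !conv_integral_line by auto.
    unfold line_conv. rewrite Cplus_0_r, <- CInt_scal by (eapply class_integrable; eauto; lra).
    apply CInt_ext. intros; unfold scal_fun; ring.
  - intros r s k f g Hf Hg. assert (Hkg := SK_mod_scal s k g Hg).
    apply (constant_of_strip tau Htau _ _ 0). eapply conv_mero; eauto. apply meromorphic_scal. eapply conv_mero; eauto.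
    intros x Hx. unfold scal_fun at 2. rewrite (conv_val _ _ _ _ x Hf Hkg), (conv_val r s f g), !conv_integral_line by auto.
    unfold line_conv. rewrite Cplus_0_r, <- CInt_scal by (eapply class_integrable; eauto; lra).
    apply CInt_ext. intros; unfold scal_fun; ring.
  - intros r s t f g h Hf Hg Hh.
    assert (Hfg : SKm (r + s) (conv tau f g)) by (eapply is_conv_SK; eauto; eapply conv_is_conv; eauto).
    assert (Hgh : SKm (s + t) (conv tau g h)) by (eapply is_conv_SK; eauto; eapply conv_is_conv; eauto).
    destruct (proj1 (SK_mod_iff tau Htau _ _) Hf) as [f1 [a [Lf Ef]]]. destruct (proj1 (SK_mod_iff tau Htau _ _) Hg) as [g1 [b [Lg Eg]]].
    destruct (proj1 (SK_mod_iff tau Htau _ _) Hh) as [h1 [c [Lh Eh]]].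
    destruct (conv_continuation tau Htau r s f1 g1 Lf Lg) as [P [[LP _] EP]].
    destruct (conv_continuation tau Htau s t g1 h1 Lg Lh) as [Q [[LQ _] EQ]].
    destruct Lf as [Lf _]. destruct Lg as [Lg _]. destruct Lh as [Lh _].
    assert (EP' : forall x, 0 < Im x < T -> P x = conv_integral f1 g1 x) by (intros x Hx; apply EP; [lra | apply strip_nonlat; auto]).
    assert (EQ' : forall x, 0 < Im x < T -> Q x = conv_integral g1 h1 x) by (intros x Hx; apply EQ; [lra | apply strip_nonlat; auto]).
    destruct (conv_classes r s f g f1 g1 a b) as [K1 HK1]; auto. destruct (conv_classes s t g h g1 h1 b c) as [K2 HK2]; auto.
    assert (XP : mero_eq (conv tau f g) (fun z => P z + K1)%C).
    { apply (strip_identity tau Htau). eapply conv_mero; eauto. apply meromorphic_plus. apply normalized_meromorphic with tau; auto. apply meromorphic_iff; intros; apply mero_at_const.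
      intros x Hx. rewrite HK1, EP' by auto. auto. }
    assert (XQ : mero_eq (conv tau g h) (fun z => Q z + K2)%C).
    { apply (strip_identity tau Htau). eapply conv_mero; eauto. apply meromorphic_plus. apply normalized_meromorphic with tau; auto. apply meromorphic_iff; intros; apply mero_at_const.
      intros x Hx. rewrite HK2, EQ' by auto. auto. }
    destruct (conv_classes _ t (conv tau f g) h P h1 K1 c Hfg) as [K3 HK3]; auto.
    destruct (conv_classes r _ f (conv tau g h) f1 Q a K2 Hf Hgh) as [K4 HK4]; auto.
    apply (constant_of_strip tau Htau _ _ (K3 - K4)); [apply (conv_mero (r + s) t) | apply (conv_mero r (s + t)) |]; auto.
    intros x Hx. rewrite HK3, HK4 by auto. rewrite (conv_assoc_normalized f1 g1 h1 P Q); auto. ring.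
Qed.
End Algebra.

Theorem lemma2 (tau : C) (Htau : (0 < Im tau)%R) :
  (forall (r s : nat) (f g : C -> C), SK_mod tau r f -> SK_mod tau s g ->
     is_conv tau f g (conv tau f g) /\
     (forall h : C -> C, is_conv tau f g h ->
        mero_eq h (conv tau f g) /\ SK_mod tau (r + s)%nat h)) /\
  filtered_algebra_mod constant_fun (SK_mod tau) (conv tau).
Proof.
  split.
  - intros r s f g Hf Hg. assert (Hc := conv_is_conv tau Htau r s f g Hf Hg). split; auto.
    intros h Hh. split. apply (is_conv_unique tau Htau f g); auto. apply (is_conv_SK tau Htau r s f g); auto.
  - apply conv_filtered_algebra; auto.
Qed.
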